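(* Let $\varepsilon\in\mathbb R\setminus\frac12\mathbb Z$ and let $w_h:S_{h,\varepsilon}\times S_h\to\mathbb C$ be the bilinear form defined in the context. Assume that $\varphi\in\mathcal D$ and $\mathrm W\varphi=0$ imply $\varphi=0$. Then there exist $h_0>0$ and $\beta_\varepsilon>0$ such that for all $h=1/N\le h_0$ ($N$ a positive integer), $$\sup_{0\neq\psi_h\in S_{h,\varepsilon}}\frac{|w_h(\psi_h,\varphi_h)|}{\|\psi_h\|_0}\ \ge\ \beta_\varepsilon\,\|\varphi_h\|_0\qquad\forall\,\varphi_h\in S_h.$$
   Context: $\mathcal D$ is the space of complex-valued $1$-periodic $C^\infty$ functions on $\mathbb R$. For $\ell\in\{1,2\}$ let $V_\ell(s,t)=\frac{\imath}{2\pi}A_\ell(s,t)\log(\sin^2\pi(s-t))+K_\ell(s,t)$, where $A_1,A_2,K_1,K_2\in C^\infty(\mathbb R^2)$ are complex-valued and $1$-periodic in each variable, and $A_1(s,s)\equiv\alpha$ for a constant $\alpha\ne0$. Set $\mathrm V_\ell\varphi=\int_0^1V_\ell(\cdot,t)\varphi(t)\,dt$, $\mathrm D\varphi=\varphi'$, $\mathrm W=-\mathrm D\mathrm V_1\mathrm D+\mathrm V_2$. For a positive integer $N$ and $h=1/N$ let, for $i\in\mathbb Z$, $s_i=(i-\frac12)h$, $t_i=ih$, $s_{i+\varepsilon}=(i+\varepsilon-\frac12)h$, $t_{i+\varepsilon}=(i+\varepsilon)h$. Let $\chi_i$ and $\chi_{i+\varepsilon}$ be the $1$-periodizations of the characteristic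 functions of $(s_i,s_{i+1})$ and $(s_{i+\varepsilon},s_{i+1+\varepsilon})$. Let $S_h=\mathrm{span}\{\chi_i:0\le i\le N-1\}$ and $S_{h,\varepsilon}=\mathrm{span}\{\chi_{i+\varepsilon}:0\le i\le N-1\}$. $\|\cdot\|_0$ is the $L^2(0,1)$ norm. For $\psi_h=\sum_{i=0}^{N-1}\psi_i\chi_{i+\varepsilon}$ and $\varphi_h=\sum_{j=0}^{N-1}\varphi_j\chi_j$ define $$w_h(\psi_h,\varphi_h)=\sum_{i,j=0}^{N-1}\psi_i\varphi_j\big[V_1(s_{i+1+\varepsilon},s_{j+1})-V_1(s_{i+\varepsilon},s_{j+1})-V_1(s_{i+1+\varepsilon},s_j)+V_1(s_{i+\varepsilon},s_j)+h^2V_2(t_{i+\varepsilon},t_j)\big].$$ *)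

(* Defs.v *)
From HB Require Import structures.
From mathcomp Require Import all_boot all_order all_algebra.
From mathcomp Require Import complex.
From mathcomp Require Import all_classical all_reals all_analysis.
From mathcomp Require Import zify ring lra.
Import Order.TTheory GRing.Theory Num.Theory.
Import numFieldNormedType.Exports.

Set Implicit Arguments.
Unset Strict Implicit.
Unset Printing Implicit Defensive.

Local Open Scope classical_set_scope.
Local Open Scope ring_scope.
Local Open Scope complex_scope.

Section Smoothness.
Context {R : realType}.

Definition Cinfty1 (f : R -> R) : Prop :=
  forall (n : nat) (x : R), derivable (derive1n n f) x 1.

Fixpoint Ck2 (n : nat) (f : R * R -> R) : Prop :=
  continuous f /\
  if n is m.+1 then
    (forall p, derivable f p (1, 0)) /\ (forall p, derivable f p (0, 1)) /\
    Ck2 m (fun p => 'D_(1, 0) f p) /\ Ck2 m (fun p => 'D_(0, 1) f p)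
  else True.

Definition Cinfty2 (f : R * R -> R) : Prop := forall n, Ck2 n f.

Definition smooth_periodic2 (A : R -> R -> R[i]) : Prop :=
  [/\ Cinfty2 (fun p => complex.Re (A p.1 p.2)),
      Cinfty2 (fun p => complex.Im (A p.1 p.2)),
      forall t, periodic (fun s => A s t) 1 &
      forall s, periodic (A s) 1].

Definition calD : set (R -> R[i]) :=
  [set f | [/\ Cinfty1 (fun x => complex.Re (f x)),
               Cinfty1 (fun x => complex.Im (f x)) &
               periodic f 1]].

End Smoothness.

Section Operators.
Context {R : realType}.
Implicit Types (V : R -> R -> R[i]) (f : R -> R[i]).

(* On the diagonal [s - t \in int] the value is junk, since [ln 0 = 0]. *)
Definition log_kernel (A K : R -> R -> R[i]) (s t : R) : R[i] :=
  (0 +i* (2 * pi)^-1) * A s t * (ln (sin (pi * (s - t)) ^+ 2))%:C + K s t.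

Definition int01 f : R[i] :=
  (\int[lebesgue_measure]_(x in `[0, 1]) complex.Re (f x)) +i*
  (\int[lebesgue_measure]_(x in `[0, 1]) complex.Im (f x)).

Definition opV V f : R -> R[i] := fun s => int01 (fun t => V s t * f t).

Definition opD f : R -> R[i] := fun x =>
  derive1 (fun y => complex.Re (f y)) x +i*
  derive1 (fun y => complex.Im (f y)) x.

Definition opW (V1 V2 : R -> R -> R[i]) f : R -> R[i] :=
  fun s => - opD (opV V1 (opD f)) s + opV V2 f s.

Definition L2norm f : R :=
  Num.sqrt (\int[lebesgue_measure]_(x in `[0, 1]) (Normc.normc (f x) ^+ 2)).

End Operators.

Section Splines.
Context {R : realType}.

(* The index is real, so that [s_{i + eps}] is [node_s N (i + eps)]. *)
Definition node_s (N : nat) (x : R) : R := (x - 2^-1) / N%:R.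
Definition node_t (N : nat) (x : R) : R := x / N%:R.

Definition periodization (f : R -> R) (x : R) : R :=
  \sum_(k \in [set: int]) f (x + k%:~R).

Definition chi (N : nat) (x : R) : R -> R :=
  periodization \1_(`]node_s N x, node_s N (x + 1)[%classic).

Definition spline (N : nat) (eps : R) (c : {ffun 'I_N -> R[i]}) : R -> R[i] :=
  fun x => \sum_(i < N) c i * (chi N (i%:R + eps) x)%:C.

Definition spline_space (N : nat) (eps : R) : set (R -> R[i]) :=
  range (@spline N eps).

(* By [splineK], these are the coordinates of [f] in the basis [chi]. *)
Definition coord (N : nat) (eps : R) (f : R -> R[i]) : {ffun 'I_N -> R[i]} :=
  xget [ffun=> 0] [set c | f = spline eps c].

Lemma chi_node (N : nat) (eps : R) (i j : 'I_N) :
  chi N (i%:R + eps) (node_t N (j%:R + eps)) = (i == j)%:R.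
Proof.
have N0 : (0 < N%:R :> R) by rewrite ltr0n (leq_ltn_trans _ (ltn_ord i)).
have memE (k : int) :
    (node_t N (j%:R + eps) + k%:~R \in
      `]node_s N (i%:R + eps), node_s N (i%:R + eps + 1)[) =
    (i == j) && (k == 0).
  rewrite in_itv /= /node_s /node_t.
  have -> : (j%:R + eps) / N%:R + k%:~R = (j%:R + eps + k%:~R * N%:R) / N%:R :> R.
    by rewrite [RHS]mulrDl mulfK // gt_eqF.
  rewrite !ltr_pM2r ?invr_gt0//.
  pose d : int := (j%:Z - i%:Z + k * N%:Z)%R.
  have dE : d%:~R = j%:R - i%:R + k%:~R * N%:R :> R.
    by rewrite /d !rmorphD rmorphN rmorphM.
  have -> : (i%:R + eps - 2^-1 < j%:R + eps + k%:~R * N%:R) = (-1 < d).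
    rewrite -(ltr_int R) dE rmorphN /=.
    have -> : (i%:R + eps - 2^-1 < j%:R + eps + k%:~R * N%:R)
            = (- 2^-1 < d%:~R :> R) by rewrite dE; apply/idP/idP; lra.
    have [d0|d0] := lerP 0 d.
      have d0' : 0 <= d%:~R :> R by rewrite ler0z.
      by rewrite -dE; apply/idP/idP; lra.
    have d0' : d%:~R <= -1 :> R.
      by rewrite -[-1]/((-1)%:~R) ler_int; move: d0; clear; lia.
    by rewrite -dE; apply/idP/idP; lra.
  have -> : (j%:R + eps + k%:~R * N%:R < i%:R + eps + 1 - 2^-1) = (d < 1).
    rewrite -(ltr_int R) dE /=.
    have -> : (j%:R + eps + k%:~R * N%:R < i%:R + eps + 1 - 2^-1)
            = (d%:~R < 2^-1 :> R) by rewrite dE; apply/idP/idP; lra.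
    have [d0|d0] := lerP d 0.
      have d0' : d%:~R <= 0 :> R by rewrite lerz0.
      by rewrite -dE; apply/idP/idP; lra.
    have d0' : 1 <= d%:~R :> R.
      by rewrite -[1]/(1%:~R) ler_int; move: d0; clear; lia.
    by rewrite -dE; apply/idP/idP; lra.
  have := ltn_ord i; have := ltn_ord j; rewrite -val_eqE /d /=; clear => hj hi.
  apply/idP/idP; last first.
    by move=> /andP[/eqP -> /eqP ->]; rewrite mul0r subrr addr0.
  move=> /andP[h1 h2]; have [k0|k0|k0] := ltrgtP k 0.
  - by exfalso; nia.
  - by exfalso; nia.
  by move: h1 h2; rewrite k0 => h1 h2; rewrite andbT; apply/eqP; lia.
have indE (k : int) :
    \1_(`]node_s N (i%:R + eps), node_s N (i%:R + eps + 1)[%classic)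
      (node_t N (j%:R + eps) + k%:~R) = ((i == j) && (k == 0))%:R :> R.
  by rewrite indicE mem_setE memE.
rewrite /chi /periodization -(@fsbig_widen _ _ _ _ [set 0%R])//.
  by rewrite fsbig_set1 indE eqxx andbT.
by move=> k [_ /= /eqP k0]; rewrite indE (negbTE k0) andbF.
Qed.

Lemma spline_node (N : nat) (eps : R) (c : {ffun 'I_N -> R[i]}) (j : 'I_N) :
  spline eps c (node_t N (j%:R + eps)) = c j.
Proof.
rewrite /spline (bigD1 j) //= chi_node eqxx big1 => [|i ij].
  by rewrite rmorph1 mulr1 addr0.
by rewrite chi_node (negbTE ij) rmorph0 mulr0.
Qed.

Lemma splineK (N : nat) (eps : R) : cancel (@spline N eps) (@coord N eps).
Proof.
move=> c; rewrite /coord; case: xgetP => [c' _ /= e|/(_ c)/= []//].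
by apply/ffunP => j; rewrite -(spline_node eps c') -e spline_node.
Qed.

Definition wh (V1 V2 : R -> R -> R[i]) (N : nat) (eps : R)
    (psi phi : R -> R[i]) : R[i] :=
  \sum_(i < N) \sum_(j < N)
    coord N eps psi i * coord N 0 phi j *
    (V1 (node_s N (i%:R + 1 + eps)) (node_s N (j%:R + 1))
     - V1 (node_s N (i%:R + eps)) (node_s N (j%:R + 1))
     - V1 (node_s N (i%:R + 1 + eps)) (node_s N j%:R)
     + V1 (node_s N (i%:R + eps)) (node_s N j%:R)
     + (N%:R^-1) ^+ 2 * V2 (node_t N (i%:R + eps)) (node_t N j%:R)).

Lemma wh_spline (V1 V2 : R -> R -> R[i]) (N : nat) (eps : R)
    (psi phi : {ffun 'I_N -> R[i]}) :
  wh V1 V2 N eps (spline eps psi) (spline 0 phi) =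
  \sum_(i < N) \sum_(j < N) psi i * phi j *
    (V1 (node_s N (i%:R + 1 + eps)) (node_s N (j%:R + 1))
     - V1 (node_s N (i%:R + eps)) (node_s N (j%:R + 1))
     - V1 (node_s N (i%:R + 1 + eps)) (node_s N j%:R)
     + V1 (node_s N (i%:R + eps)) (node_s N j%:R)
     + (N%:R^-1) ^+ 2 * V2 (node_t N (i%:R + eps)) (node_t N j%:R)).
Proof. by rewrite /wh !splineK. Qed.

End Splines.

(* Main.v *)
Require Import Defs.
From mathcomp Require Import all_boot all_order all_algebra.
From mathcomp Require Import complex.
From mathcomp Require Import all_classical all_reals all_analysis.
From mathcomp Require Import measurable_realfun.
From mathcomp Require Import zify ring lra.
Import Order.TTheory GRing.Theory Num.Theory.
Import numFieldNormedType.Exports.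

(** Why the inequality holds. Testing with the conjugate of the residual turns the supremum into
the Euclidean norm of the collocation matrix applied to the coefficients of [phih]
([spline_norm], [theorem1]), so that the claim is a lower bound for this matrix, uniform in [N]
([galerkin_coercive]).

In Fourier variables the matrix is explicit. Write [A] and [K] as absolutely convergent series
in [cis (p (s - t)) * cis (r t)] with rapidly decreasing coefficients
([fourier_convolution_expansion]). The discrete Fourier transform of the grid functions then has
to satisfy the row equations of [galerkin_dft], whose coefficients are made of the transform
[symb] of the kernel [ln (sin (pi x) ^ 2)] sampled at the nodes [(k + eps) / N]. That transform
is controlled without estimating any logarithm: up to a constant the kernel is the logarithm of
[|1 - r e^(2 i pi x)|^2] at [r = 1]; the derivative in [r] of the sampled transform is a finite
geometric sum ([dlogsumE]), with denominators [1 - r ^ N cis eps] that stay away from zero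
because [2 * eps] is not an integer. Integrating from [r = 0] gives a lower bound of order [1 /
|m|] ([symb_ge]), a gain of two powers for differences in [m] ([symb_diff]) and convergence to
the Fourier coefficients of the kernel ([symb_lim]).

Since [A1] is the constant [alpha] on the diagonal, the first kernel is [alpha] times the pure
logarithm plus terms which only involve differences of the symbol. Hence the rows have a
diagonal part of order [|m|] ([lam_ge]) and a remainder bounded by summable weights, uniformly
in [N] ([drow_remainder]).

If the lower bound failed there would be normalized grid functions with residuals tending to
zero while [N] tends to infinity. Their Fourier coefficients decay uniformly like [1 / |m|], so
no mass escapes to high frequencies, and limits along an ultrafilter exist, are not all zero and
satisfy the limiting row equations ([no_degenerate_sequence]). In these equations each use of
the diagonal part gains a power of [|m|], so the limiting coefficients decrease rapidly and are
those of a smooth function. The limiting equations say exactly that [opW] annihilates this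
function ([opW_series]), which therefore vanishes by hypothesis: a contradiction.

The last step needs the continuous operator on characters, that is, the Fourier coefficients of
the logarithmic kernel ([int01_lnk_cis]). They are obtained from the same discrete sums: Riemann
sums of the regularized kernel are logarithmic sums at shifted roots of unity, and the limit [r
--> 1] is justified by Fatou's lemma and an elementary comparison of [quad r] with [quad 1]. *)

Set Implicit Arguments.
Unset Strict Implicit.
Unset Printing Implicit Defensive.

Local Open Scope classical_set_scope.
Local Open Scope ring_scope.
Local Open Scope complex_scope.

Local Notation nc := Normc.normc.
Local Notation cj := (@conjc _).
Local Notation re := (@complex.Re (Real.sort _)).
Local Notation im := (@complex.Im (Real.sort _)).

Local Arguments conjc : simpl never.
Local Arguments Normc.normc : simpl never.

(** * The modulus and the characters of the circle *)

Section Modulus.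
Context {R : realType}.
Implicit Types (z w : R[i]) (x y : R).

Lemma cReD z w : re (z + w) = re z + re w.
Proof. by case: z; case: w. Qed.
Lemma cImD z w : im (z + w) = im z + im w.
Proof. by case: z; case: w. Qed.
Lemma cReN z : re (- z) = - re z. Proof. by case: z. Qed.
Lemma cImN z : im (- z) = - im z. Proof. by case: z. Qed.
Lemma cReM z w : re (z * w) =
  re z * re w - im z * im w.
Proof. by case: z; case: w. Qed.
Lemma cImM z w : im (z * w) =
  re z * im w + im z * re w.
Proof. by case: z; case: w. Qed.

Lemma Re_sum (I : Type) (r : seq I) (P : pred I) (f : I -> R[i]) :
  re (\sum_(i <- r | P i) f i) = \sum_(i <- r | P i) re (f i).
Proof. by elim/big_rec2: _ => //= i x y _ <-; rewrite cReD. Qed.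
Lemma Im_sum (I : Type) (r : seq I) (P : pred I) (f : I -> R[i]) :
  im (\sum_(i <- r | P i) f i) = \sum_(i <- r | P i) im (f i).
Proof. by elim/big_rec2: _ => //= i x y _ <-; rewrite cImD. Qed.

Lemma ncE z : nc z = Num.sqrt (re z ^+ 2 + im z ^+ 2).
Proof. by case: z. Qed.

Lemma nc_ge0 z : 0 <= nc z. Proof. by rewrite ncE sqrtr_ge0. Qed.

Lemma ncsq z : nc z ^+ 2 = re z ^+ 2 + im z ^+ 2.
Proof. by rewrite ncE sqr_sqrtr // addr_ge0 ?sqr_ge0. Qed.

Lemma ncD z w : nc (z + w) <= nc z + nc w.
Proof. exact: le_normcD. Qed.

Lemma ncN z : nc (- z) = nc z.
Proof. exact: normcN. Qed.

Lemma ncM z w : nc (z * w) = nc z * nc w.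
Proof. exact: Normc.normcM. Qed.

Lemma ncV z : nc z^-1 = (nc z)^-1.
Proof. exact: Normc.normcV. Qed.

Lemma nc0 : nc (0 : R[i]) = 0. Proof. exact: Normc.normc0. Qed.
Lemma nc1 : nc (1 : R[i]) = 1. Proof. exact: Normc.normc1. Qed.

Lemma ncX z n : nc (z ^+ n) = nc z ^+ n.
Proof. by elim: n => [|n IH]; rewrite ?expr0 ?nc1 // !exprS ncM IH. Qed.

Lemma nc_eq0 z : (nc z == 0) = (z == 0).
Proof. by apply/eqP/eqP => [/Normc.eq0_normc|->]; rewrite ?nc0. Qed.

Lemma nc_gt0 z : (0 < nc z) = (z != 0).
Proof. by rewrite lt_def nc_eq0 nc_ge0 andbT. Qed.

Lemma ncB z w : nc (z - w) <= nc z + nc w.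
Proof. by rewrite -(ncN w) ncD. Qed.

Lemma ncC z w : nc (z - w) = nc (w - z).
Proof. by rewrite -ncN opprB. Qed.

Lemma ncBl z w : nc z - nc w <= nc (z - w).
Proof. by rewrite lerBlDr -[leLHS]/(nc z) -{1}(subrK w z) ncD. Qed.

Lemma nc_sum (I : Type) (r : seq I) (P : pred I) (f : I -> R[i]) :
  nc (\sum_(i <- r | P i) f i) <= \sum_(i <- r | P i) nc (f i).
Proof.
elim/big_ind2: _ => [|z1 x1 z2 x2 h1 h2|//]; first by rewrite nc0.
by apply: le_trans (ncD _ _) _; rewrite lerD.
Qed.

Lemma nc_real x : nc x%:C = `|x|.
Proof. by rewrite ncE /= expr0n addr0 sqrtr_sqr. Qed.

Lemma ncJ z : nc (cj z) = nc z.
Proof. by case: z => a b; rewrite !ncE /= sqrrN. Qed.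

Lemma nc_Re z : `|re z| <= nc z.
Proof. by rewrite ncE -sqrtr_sqr ler_wsqrtr // lerDl sqr_ge0. Qed.

Lemma nc_Im z : `|im z| <= nc z.
Proof. by rewrite ncE -sqrtr_sqr ler_wsqrtr // lerDr sqr_ge0. Qed.

Lemma nc_ReIm z : nc z <= `|re z| + `|im z|.
Proof.
rewrite {1}(complexE z); apply: le_trans (ncD _ _) _; rewrite ncM !nc_real.
by rewrite (ncE 'i%C) /= expr0n expr1n add0r sqrtr1 mul1r.
Qed.

Lemma mulcJ z : z * cj z = (nc z ^+ 2)%:C.
Proof. by rewrite ncsq; case: z => a b; simpc => /=; congr (_ +i* _); ring. Qed.

Lemma cjM z w : cj (z * w) = cj z * cj w. Proof. exact: rmorphM. Qed.

Lemma cjB z w : cj (z - w) = cj z - cj w. Proof. exact: rmorphB. Qed.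

Lemma Re_mulr_real z x : re (z * x%:C) = re z * x.
Proof. by rewrite cReM /= mulr0 subr0. Qed.

Lemma Im_mulr_real z x : im (z * x%:C) = im z * x.
Proof. by rewrite cImM /= mulr0 add0r. Qed.

Lemma cj_sum (I : Type) (r : seq I) (P : pred I) (f : I -> R[i]) :
  cj (\sum_(i <- r | P i) f i) = \sum_(i <- r | P i) cj (f i).
Proof. exact: rmorph_sum. Qed.

Lemma complex_eq z w :
  re z = re w -> im z = im w -> z = w.
Proof. by case: z => a b; case: w => c d /= -> ->. Qed.

(** The dual description of the modulus reduces complex estimates to real ones. *)
Lemma nc_le_Re z (C : R) :
  (forall u, nc u = 1 -> re (u * z) <= C) -> nc z <= C.
Proof.
move=> h; have [zE|z0] := eqVneq z 0.
  by have := h 1 nc1; rewrite zE mulr0 nc0.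
have n0 : nc z != 0 by rewrite nc_eq0.
have := h (cj z * ((nc z)^-1)%:C); rewrite ncM ncJ nc_real ger0_norm ?invr_ge0 ?nc_ge0 //.
rewrite mulfV // => /(_ erefl).
rewrite mulrAC [cj z * z]mulrC mulcJ -rmorphM /=.
by rewrite expr2 mulfK.
Qed.

End Modulus.

Section Exponential.
Context {R : realType}.
Implicit Types (x y : R) (n m : int).

(** The character x |-> exp (2 i pi x) of the circle of length one. *)
Definition cis x : R[i] := cos (2 * pi * x) +i* sin (2 * pi * x).

Lemma cisD x y : cis (x + y) = cis x * cis y.
Proof.
rewrite /cis mulrDr cosD sinD; simpc => /=; congr (_ +i* _).
by rewrite addrC.
Qed.

Lemma cis0 : cis 0 = 1.
Proof. by rewrite /cis mulr0 cos0 sin0. Qed.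

Lemma cisN x : cis (- x) = cj (cis x).
Proof. by rewrite /cis mulrN cosN sinN. Qed.

Lemma nc_cis x : nc (cis x) = 1.
Proof. by rewrite ncE /= cos2Dsin2 sqrtr1. Qed.

Lemma cisNK x : cis (- x) * cis x = 1.
Proof. by rewrite -cisD addNr cis0. Qed.

Lemma cis1 : cis 1 = 1.
Proof. by rewrite /cis mulr1 mulr_natl cos2pi sin2pi. Qed.

Lemma cisMn x k : cis (k%:R * x) = cis x ^+ k.
Proof.
elim: k => [|k IH]; first by rewrite mul0r cis0 expr0.
by rewrite -natr1 mulrDl mul1r cisD IH exprSr.
Qed.

Lemma cis_int n : cis n%:~R = 1.
Proof.
have h k : cis k%:R = 1 by rewrite -[k%:R]mulr1 cisMn cis1 expr1n.
case: n => k; first by rewrite -[k%:~R]/(k%:R).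
by rewrite NegzE rmorphN /= cisN h conjc1.
Qed.

Lemma cisDz x n : cis (x + n%:~R) = cis x.
Proof. by rewrite cisD cis_int mulr1. Qed.

Lemma nc_cis_sub1_sq x : nc (cis x - 1) ^+ 2 = 4 * sin (pi * x) ^+ 2.
Proof.
rewrite ncsq /= subr0.
have -> : 2 * pi * x = (pi * x) *+ 2 :> R by rewrite -mulrA mulr_natl.
rewrite sin_mulr2n cos_mulr2n; have := cos2Dsin2 (pi * x).
move: (cos _) (sin _) => c s cs; rewrite (_ : c ^+ 2 = 1 - s ^+ 2); last by lra.
rewrite -[_ *+ 2 in X in _ + X]mulr_natl -mulr_natl 2!exprMn (_ : c ^+ 2 = 1 - s ^+ 2); last by lra.
by ring.
Qed.

Lemma nc_cis_sub1 x : nc (cis x - 1) = 2 * `|sin (pi * x)|.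
Proof.
apply/eqP; rewrite -(@eqrXn2 _ 2) ?nc_ge0 ?mulr_ge0 //.
by rewrite nc_cis_sub1_sq exprMn real_normK ?num_real //; apply/eqP; ring.
Qed.


Lemma mean_value (f df : R -> R) (a b : R) : a <= b ->
  (forall x, a <= x <= b -> is_derive x 1 f (df x)) ->
  exists2 c, a <= c <= b & f b - f a = df c * (b - a).
Proof.
move=> ab fd; have [||c cab fE] := @MVT_segment R f df a b ab.
- by move=> x; rewrite in_itv /= => /andP[/ltW ax /ltW xb]; apply: fd; rewrite ax.
- apply: derivable_within_continuous => x; rewrite in_itv /= => xab.
  by have ? := fd x xab; exact: ex_derive.
by exists c.
Qed.

(** Comparison of increments takes the place of integrating an inequality between derivatives.
*)
Lemma derive_le_incr (f df g dg : R -> R) (a b : R) : a <= b ->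
  (forall x, a <= x <= b -> is_derive x 1 f (df x)) ->
  (forall x, a <= x <= b -> is_derive x 1 g (dg x)) ->
  (forall x, a <= x <= b -> df x <= dg x) -> f b - f a <= g b - g a.
Proof.
move=> ab fd gd fg.
have [|c cab] := @mean_value (g - f) (dg \- df) a b ab.
  by move=> x xab; have ? := fd x xab; have ? := gd x xab; apply: is_deriveB.
rewrite !fctE => E; rewrite -subr_ge0.
rewrite (_ : _ - _ = (dg c - df c) * (b - a)); last by rewrite -E; ring.
by rewrite mulr_ge0 ?subr_ge0 ?fg.
Qed.

Lemma norm_sin_le x : `|sin x| <= `|x|.
Proof.
wlog x0 : x / 0 <= x.
  move=> h; have [|/ltW x0] := leP 0 x; first exact: h.
  by rewrite -normrN -sinN -(normrN x) h // oppr_ge0.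
have [c _] := @mean_value sin cos 0 x x0 (fun z _ => is_derive_sin z).
rewrite sin0 !subr0 => ->; rewrite normrM -[leRHS]mul1r ler_wpM2r ?normr_ge0 //.
exact: cos_max.
Qed.

Lemma cos_pi4_sq : cos (pi / 4 : R) ^+ 2 = 2^-1.
Proof.
have := cos_pihalf R; rewrite (_ : pi / 2 = (pi / 4) *+ 2); last by lra.
by rewrite cos_mulr2n => h; lra.
Qed.

Lemma sin_ge_half x : 0 <= x <= pi / 2 -> x / 2 <= sin x.
Proof.
move=> /andP[x0 xpi]; have pi0 := pi_gt0 R.
have cq y : 0 <= y <= pi / 4 -> cos (pi / 4) <= cos y.
  move=> /andP[y0 y4]; have [->//|ny] := eqVneq y (pi / 4).
  have [yl] : y < pi / 4 by rewrite lt_neqAle ny.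
  by apply/ltW; rewrite ltr_cos // in_itv /=; apply/andP; split; lra.
have c0 : 0 <= cos (pi / 4 : R).
  by apply: cos_ge0_pihalf; apply/andP; split; lra.
have x2 : 0 <= x / 2 <= pi / 4 by apply/andP; split; lra.
have x20 : 0 <= x / 2 by lra.
have [c] := @mean_value sin cos 0 (x / 2) x20 (fun z _ => is_derive_sin z).
rewrite sin0 !subr0 => /andP[c1 c2] E.
have sx : x / 2 * cos (pi / 4) <= sin (x / 2).
  by rewrite E mulrC ler_wpM2r ?cq //; apply/andP; split; lra.
rewrite (_ : sin x = sin ((x / 2) *+ 2)); last by congr sin; lra.
rewrite sin_mulr2n.
have := ler_pM (mulr_ge0 _ c0) c0 sx (cq _ x2).
rewrite -mulrA -expr2 cos_pi4_sq => /(_ _) h.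
have : x / 2 * 2^-1 <= sin (x / 2) * cos (x / 2) by apply: h; lra.
by rewrite [cos _ * _]mulrC => h2; lra.
Qed.

Lemma nc_cis_sub1_le x : nc (cis x - 1) <= 2 * pi * `|x|.
Proof.
rewrite nc_cis_sub1 -mulrA ler_pM2l // (le_trans (norm_sin_le _)) //.
by rewrite normrM (ger0_norm (pi_ge0 R)).
Qed.

(** On half a period chords are comparable to arcs; this is what keeps the difference quotients
elliptic up to the highest resolved frequency. *)
Lemma nc_cis_sub1_ge x : `|x| <= 2^-1 -> 2 * `|x| <= nc (cis x - 1).
Proof.
rewrite nc_cis_sub1 => xh; rewrite ler_pM2l //.
have pi2 := pi_ge2 R.
wlog x0 : x xh / 0 <= x.
  move=> h; have [|/ltW x0] := leP 0 x; first exact: h.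
  by rewrite -normrN -(normrN (sin _)) -sinN -mulrN h ?normrN // oppr_ge0.
move: xh; rewrite ger0_norm // => xh.
apply: le_trans (ler_norm _).
have : pi * x / 2 <= sin (pi * x) by apply: sin_ge_half; apply/andP; split; nra.
by nra.
Qed.

Lemma nc_cisB_le x y : nc (cis x - cis y) <= 2 * pi * `|x - y|.
Proof.
rewrite (_ : cis x - cis y = cis y * (cis (x - y) - 1)).
  by rewrite ncM nc_cis mul1r nc_cis_sub1_le.
by rewrite mulrBr mulr1 -cisD [y + _]addrC subrK.
Qed.

End Exponential.

Arguments cis {R} x : simpl never.

(** * Periodic sums and the discrete Fourier transform *)

Section PeriodicSums.
Context {R : realType}.
Variables (N : nat) (N0 : (0 < N)%N).
Implicit Types (f g : int -> R[i]) (m n : int).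

Definition Nper f := forall j, f (j + N%:Z) = f j.

Definition psum (f : int -> R[i]) : R[i] := \sum_(i < N) f i%:Z.

Lemma psum_shift f m : Nper f -> psum (fun j => f (j + m)) = psum f.
Proof.
move=> pf.
have step k : psum (fun j => f (j + (k + 1))) = psum (fun j => f (j + k)).
  rewrite /psum; move: N0 pf; rewrite /Nper; case: (N) => // M _ pf.
  rewrite big_ord_recr /= [RHS]big_ord_recl /= addrC; congr (_ + _).
    by rewrite (_ : M%:Z + (k + 1) = 0%:Z + k + M.+1%:Z) ?pf //; lia.
  by apply: eq_bigr => i _; congr f; rewrite /= /bump /=; lia.
elim/int_ind: m => [|n|n].
- by congr psum; apply/funext => j; rewrite addr0.
- by move=> <-; rewrite -(step n%:Z); congr psum; apply/funext => j; congr f; lia.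
- move=> <-; rewrite -(step (- n.+1%:Z)); congr psum.
  by apply/funext => j; congr f; lia.
Qed.

Lemma Nper_mul f m k : Nper f -> f (m + k * N%:Z) = f m.
Proof.
move=> pf; elim/int_ind: k => [|n|n]; first by rewrite mul0r addr0.
- by move=> <-; rewrite -[RHS]pf; congr f; lia.
- by move=> <-; rewrite -[LHS]pf; congr f; lia.
Qed.

Lemma Nper_modz f m : Nper f -> f m = f (m %% N%:Z)%Z.
Proof. by move=> pf; rewrite {1}(divz_eq m N%:Z) addrC Nper_mul. Qed.

Lemma psumD f g : psum (fun j => f j + g j) = psum f + psum g.
Proof. exact: big_split. Qed.

Lemma psumZ (a : R[i]) f : psum (fun j => a * f j) = a * psum f.
Proof. by rewrite /psum mulr_sumr. Qed.

Lemma psum_reflect f : Nper f -> psum (fun j => f (- j)) = psum f.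
Proof.
move=> pf; rewrite -(@psum_shift (fun j => f (- j)) 1); last first.
  by move=> j; rewrite -[RHS](@Nper_mul _ _ (-1)) //; congr f; lia.
rewrite /psum (reindex_inj rev_ord_inj) /=; apply: eq_bigr => i _.
have := ltn_ord i => iN.
by rewrite -(@Nper_mul _ _ 1) //; congr f; lia.
Qed.

Lemma cis_natM (n : nat) (x : R) : cis (n%:R * x) = cis x ^+ n.
Proof. exact: cisMn. Qed.

Let NR : (N%:R : R) != 0. Proof. by rewrite pnatr_eq0 -lt0n. Qed.
Let NC : (N%:R : R[i]) != 0. Proof. by rewrite pnatr_eq0 -lt0n. Qed.

Lemma Nper_cis n : Nper (fun j => cis (n%:~R * j%:~R / N%:R)).
Proof.
move=> j /=; rewrite rmorphD /= mulrDr mulrDl mulfK //.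
by rewrite cisDz.
Qed.

Lemma cis_neq1 n : ~~ (N%:Z %| n)%Z -> cis (n%:~R / N%:R : R) != 1.
Proof.
move=> ndvd; rewrite -subr_eq0 -nc_gt0 nc_cis_sub1 mulr_gt0 // normr_gt0.
set r := (n %% N%:Z)%Z.
have r0 : r != 0 by apply: contra ndvd => /eqP h; apply/dvdz_mod0P.
have rge : 0 <= r by apply: modz_ge0; lia.
have rlt : r < N%:Z by apply: ltz_pmod; lia.
have E : n%:~R / N%:R = r%:~R / N%:R + ((n %/ N%:Z)%Z)%:~R :> R.
  by rewrite {1}(divz_eq n N%:Z) rmorphD rmorphM /= mulrDl mulfK // addrC.
have := nc_cis_sub1_sq (n%:~R / N%:R : R); rewrite E cisDz nc_cis_sub1_sq -E => /eqP.
apply: contraTneq => ->; rewrite expr0n mulr0 mulf_neq0 // expf_neq0 // gt_eqF //.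
have rR : 0 < r%:~R :> R by rewrite ltr0z; lia.
have rRN : r%:~R < N%:R :> R by rewrite -[N%:R]/(N%:Z%:~R) ltr_int.
have N0R : 0 < N%:R :> R by rewrite ltr0n.
apply: sin_gt0_pi; apply/andP; split; first by rewrite mulr_gt0 ?pi_gt0 ?divr_gt0.
by rewrite gtr_pMr ?pi_gt0 // ltr_pdivrMr // mul1r.
Qed.

Lemma psum_cis n : psum (fun j => cis (n%:~R * j%:~R / N%:R)) =
  if (N%:Z %| n)%Z then N%:R else 0.
Proof.
have E : psum (fun j => cis (n%:~R * j%:~R / N%:R)) =
    \sum_(i < N) cis (n%:~R / N%:R : R) ^+ i.
  by apply: eq_bigr => i _; rewrite -cis_natM; congr cis; ring.
rewrite E; case: ifPn => [/dvdzP[k ->]|nd].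
  rewrite rmorphM /= mulfK // cis_int.
  by under eq_bigr do rewrite expr1n; rewrite sumr_const card_ord.
have := subrX1 (cis (n%:~R / N%:R : R)) N.
rewrite -cis_natM mulrC mulfVK // cis_int subrr => /esym/eqP.
by rewrite mulf_eq0 subr_eq0 (negbTE (cis_neq1 nd)) /= => /eqP.
Qed.

Definition dft f m : R[i] := N%:R^-1 * psum (fun j => f j * cis (- (m%:~R * j%:~R / N%:R))).

Lemma Nper_dft f : Nper (dft f).
Proof.
move=> m; rewrite /dft; congr (_ * _); apply: eq_bigr => i _; congr (_ * _).
by rewrite !cisN; congr conjc; rewrite ![_ * i%:~R]mulrC Nper_cis.
Qed.

Lemma dftK f j : Nper f -> psum (fun m => dft f m * cis (m%:~R * j%:~R / N%:R)) = f j.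
Proof.
move=> pf; rewrite /psum /dft.
under eq_bigr => m _ do rewrite /psum mulrAC mulr_sumr.
rewrite exchange_big /=.
transitivity (\sum_(i < N) f i%:Z * N%:R^-1 *
    psum (fun m => cis ((j - i%:Z)%:~R * m%:~R / N%:R : R))).
  apply: eq_bigr => i _; rewrite mulr_sumr; apply: eq_bigr => m _.
  rewrite (_ : cis ((j - i%:Z)%:~R * m%:~R / N%:R) =
    cis (m%:~R * j%:~R / N%:R) * cis (- (m%:~R * i%:~R / N%:R))); first by ring.
  by rewrite -cisD; congr cis; rewrite rmorphB /=; ring.
have N1 : (0 < N%:Z)%R by lia.
have rlt : (absz (j %% N%:Z)%Z < N)%N.
  by have := ltz_pmod j N1; have := @modz_ge0 j N%:Z; lia.
rewrite (bigD1 (Ordinal rlt)) //= [X in _ + X]big1 ?addr0.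
  rewrite psum_cis ifT; last first.
    rewrite gez0_abs; last by apply: modz_ge0; lia.
    by apply/dvdzP; exists (j %/ N%:Z)%Z; rewrite {1}(divz_eq j N%:Z) addrK.
  rewrite mulfVK // gez0_abs; last by apply: modz_ge0; lia.
  by rewrite -Nper_modz.
move=> i; rewrite -val_eqE /= => ij; rewrite psum_cis ifN ?mulr0 //.
apply: contra ij => /dvdzP[k kE].
rewrite (_ : j = i%:Z + k * N%:Z); last by lia.
by rewrite addrC modzMDl modz_small ?absz_nat //; have := ltn_ord i; lia.
Qed.

(** Plancherel's identity for the discrete Fourier transform. *)
Lemma dft_parseval f : Nper f ->
  \sum_(m < N) nc (dft f m%:Z) ^+ 2 = N%:R^-1 * \sum_(j < N) nc (f j%:Z) ^+ 2.
Proof.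
move=> pf; apply: complexI; rewrite rmorphM /= !rmorph_sum /= fmorphV /= rmorph_nat.
under eq_bigr do rewrite -mulcJ.
under [in RHS]eq_bigr do rewrite -mulcJ.
rewrite mulr_sumr.
transitivity (\sum_(m < N) \sum_(i < N)
   N%:R^-1 * cj (f i%:Z) * (dft f m%:Z * cis (m%:~R * i%:~R / N%:R))).
  apply: eq_bigr => m _; rewrite (_ : cj (dft f m%:Z) = N%:R^-1 *
     \sum_(i < N) cj (f i%:Z) * cis (m%:~R * i%:~R / N%:R)).
    by rewrite !mulr_sumr; apply: eq_bigr => i _; ring.
  rewrite /dft cjM cj_sum conjc_inv conjc_nat; congr (_ * _).
  by apply: eq_bigr => i _; rewrite cjM -cisN opprK.
rewrite exchange_big /=; apply: eq_bigr => i _.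
rewrite -mulr_sumr [\sum_(_ < _) _](dftK _ pf); ring.
Qed.

End PeriodicSums.

(** * Logarithmic sums over shifted roots of unity *)

Section LogarithmicSums.
Context {R : realType}.
Variables (N : nat) (N0 : (0 < N)%N) (eps : R).
Implicit Types (n m : int) (r x : R) (u z : R[i]).

Let NR : (N%:R : R) != 0. Proof. by rewrite pnatr_eq0 -lt0n. Qed.
Let NC : (N%:R : R[i]) != 0. Proof. by rewrite pnatr_eq0 -lt0n. Qed.

Definition node (k : int) : R := (k%:~R + eps) / N%:R.

(** The squared distance from [1] to [r * cis x], see [quadE]. *)
Definition quad r x : R := 1 - 2 * r * cos (2 * pi * x) + r ^+ 2.

Lemma quadE r x : quad r x = nc (1 - r%:C * cis x) ^+ 2.
Proof.
rewrite ncsq !(cReD,cImD,cReN,cImN,cReM,cImM) /= !(mul0r,addr0,subr0,add0r) sqrrN exprMn.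
by have := cos2Dsin2 (2 * pi * x); rewrite /quad => h; nra.
Qed.

(** The parameter [r] interpolates between [r = 0], where the sum vanishes, and the case of
interest [r = 1]; in between the derivative is explicit. *)
Definition logsum n r : R[i] :=
  N%:R^-1 * psum N (fun k => (ln (quad r (node k)))%:C * cis (- (n%:~R * node k))).

Definition dlogsum n r : R[i] :=
  N%:R^-1 * psum N (fun k => ((2 * r - 2 * cos (2 * pi * node k)) / quad r (node k))%:C
    * cis (- (n%:~R * node k))).

Lemma nc_node_pow r k : (r%:C * cis (node k)) ^+ N = (r ^+ N)%:C * cis eps.
Proof.
rewrite exprMn -rmorphXn /=; congr (_ * _).
by rewrite -cisMn /node mulrC mulfVK // addrC cisDz.
Qed.

Lemma sub_rpow r k :
  (1 - r%:C * cis (node k)) * (\sum_(l < N) (r%:C * cis (node k)) ^+ l)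
  = 1 - (r ^+ N)%:C * cis eps.
Proof. by rewrite -(nc_node_pow r k) -opprB mulNr -subrX1 opprB. Qed.

Lemma psum_node n : psum N (fun k => cis (n%:~R * node k)) =
  if (N%:Z %| n)%Z then N%:R * cis (n%:~R * eps / N%:R) else 0.
Proof.
transitivity (cis (n%:~R * eps / N%:R) *
    psum N (fun k => cis (n%:~R * k%:~R / N%:R))).
  by rewrite -psumZ; apply: eq_bigr => k _; rewrite -cisD; congr cis; rewrite /node; ring.
by rewrite psum_cis //; case: ifP; rewrite ?mulr0 // mulrC.
Qed.

Lemma Re_logsum u n r : re (u * logsum n r) =
  \sum_(k < N) re (u * N%:R^-1 * cis (- (n%:~R * node k))) * ln (quad r (node k)).
Proof.
rewrite /logsum mulrA mulr_sumr Re_sum; apply: eq_bigr => k _.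
by rewrite mulrCA mulrC Re_mulr_real.
Qed.

Lemma Re_dlogsum u n r : re (u * dlogsum n r) =
  \sum_(k < N) re (u * N%:R^-1 * cis (- (n%:~R * node k))) *
     ((2 * r - 2 * cos (2 * pi * node k)) / quad r (node k)).
Proof.
rewrite /dlogsum mulrA mulr_sumr Re_sum; apply: eq_bigr => k _.
by rewrite mulrCA mulrC Re_mulr_real.
Qed.

Lemma is_derive_logsum u n r : (forall k, 0 < quad r (node k)) ->
  is_derive r 1 (fun r => re (u * logsum n r)) (re (u * dlogsum n r)).
Proof.
move=> q0; rewrite Re_dlogsum.
rewrite (_ : (fun r => _) = \sum_(k < N) (fun r =>
  re (u * N%:R^-1 * cis (- (n%:~R * node k))) * ln (quad r (node k)))); last first.
  by apply/funext => y; rewrite Re_logsum fct_sumE.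
apply: is_derive_sum => k.
have dq : is_derive r 1 (fun r => quad r (node k)) (2 * r - 2 * cos (2 * pi * node k)).
  rewrite /quad; apply: is_derive_eq; rewrite /GRing.scale /=; ring.
have dl : is_derive (quad r (node k)) 1 (@ln R) (quad r (node k))^-1 by exact: is_derive1_ln.
have dc := @is_derive1_comp _ (@ln R) (fun r => quad r (node k)) r _ _ dl dq.
apply: (@is_derive_eq _ _ _ _ _ _ _ _ (is_deriveZ _ _)).
by rewrite /GRing.scale /= [_^-1 * _]mulrC.
Qed.

Lemma logsum0 n : logsum n 0 = 0.
Proof.
rewrite /logsum /psum big1 ?mulr0 // => k _.
by rewrite /quad mulr0 mul0r subr0 expr0n addr0 ln1 mul0r.
Qed.

Lemma logsumN n r : logsum (- n) r = cj (logsum n r).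
Proof.
rewrite /logsum cjM conjc_inv conjc_nat cj_sum; congr (_ * _).
apply: eq_bigr => k _; rewrite cjM conjc_real -cisN.
by rewrite rmorphN /= mulNr.
Qed.

(** The derivative of [ln (quad r x)] is minus twice the real part of [z / (1 - r z)] with [z =
cis x]; this is the sum of that holomorphic function. *)
Definition polesum n r : R[i] :=
  N%:R^-1 * psum N (fun k => cis (node k) / (1 - r%:C * cis (node k))
    * cis (- (n%:~R * node k))).

Lemma polesum_shift n r : polesum n r = cis eps * polesum (n + N%:Z) r.
Proof.
rewrite /polesum mulrCA; congr (_ * _); rewrite -psumZ; apply: eq_bigr => k _.
rewrite [RHS]mulrCA -cisD; congr (_ * _).
rewrite [in RHS](_ : _ + - _ = - (n%:~R * node k) + (- k%:~R)); last first.
  by rewrite rmorphD /= mulrDl opprD /node; field.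
by rewrite -rmorphN cisDz.
Qed.

Lemma dlogsum_polesum n r : (forall k, 1 - r%:C * cis (node k) != 0) ->
  dlogsum n r = - (polesum n r + cj (polesum (- n) r)).
Proof.
move=> z0; rewrite /dlogsum /polesum cjM conjc_inv conjc_nat cj_sum -mulrDr -mulrN.
congr (_ * _); rewrite -big_split -sumrN /=; apply: eq_bigr => k _.
rewrite cjM -cisN opprK rmorphN /= mulNr -mulrDl -[RHS]mulNr.
congr (_ * _).
set q := 1 - _; have q0 : q != 0 by exact: z0.
have cqE : cj q = 1 - r%:C * cj (cis (node k)) by rewrite cjB cjM conjc1 conjc_real.
have cq0 : 1 - r%:C * cj (cis (node k)) != 0 by rewrite -cqE conjc_eq0.
have -> x : (x / quad r (node k))%:C = x%:C / (q * cj q).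
  by rewrite mulcJ -quadE rmorphM /= fmorphV.
rewrite cjM conjc_inv cqE.
have cc : cis (node k) * cj (cis (node k)) = 1 by rewrite -cisN mulrC cisNK.
have -> : (2 * r - 2 * cos (2 * pi * node k))%:C = 2 * r%:C - cis (node k) - cj (cis (node k)).
  by rewrite /cis /conjc; simpc => /=; congr (_ +i* _); ring.
rewrite -[RHS]mulN1r; apply: (canLR (mulfK _)); first by rewrite mulf_neq0.
rewrite mulN1r mulNr (_ : (_ / _ + _) * _ = cis (node k) + cj (cis (node k))
    - 2 * r%:C * (cis (node k) * cj (cis (node k)))).
  by rewrite cc; ring.
by rewrite /q; field; rewrite z0 cq0.
Qed.

(** The geometric series of [1 / (1 - r zeta)] is finite because all nodes
[zeta] have the same [N]-th power; orthogonality of characters then leaves a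
single term. *)
Lemma polesumE (n : nat) r : (1 <= n <= N)%N ->
  1 - (r ^+ N)%:C * cis eps != 0 ->
  polesum n%:Z r = (r ^+ n.-1)%:C / (1 - (r ^+ N)%:C * cis eps).
Proof.
move=> /andP[n1 nN] w0; set w := 1 - _ in w0 *.
have z0 k : 1 - r%:C * cis (node k) != 0.
  by apply: contra w0 => /eqP h; rewrite /w -(sub_rpow r k) h mul0r.
have inv k : (1 - r%:C * cis (node k))^-1 = (\sum_(l < N) (r%:C * cis (node k)) ^+ l) / w.
  by apply: (mulfI (z0 k)); rewrite mulfV // mulrA sub_rpow mulfV.
rewrite /polesum.
transitivity (N%:R^-1 * (w^-1 * \sum_(l < N) (r ^+ l)%:C *
    psum N (fun k => cis ((l%:Z + 1 - n%:Z)%:~R * node k)))).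
  congr (_ * _); rewrite mulr_sumr.
  under [RHS]eq_bigr => l _ do rewrite 2!mulr_sumr.
  rewrite exchange_big /=; apply: eq_bigr => k _.
  rewrite inv mulrA mulr_sumr mulr_suml mulr_suml; apply: eq_bigr => l _.
  rewrite exprMn -rmorphXn /= -cisMn !rmorphB rmorphD /=.
  rewrite (_ : (_ + 1 - _) * node k = node k + l%:R * node k + (- (n%:R * node k))).
    by rewrite 2!cisD; ring.
  by rewrite !mulrBl mulrDl mul1r; ring.
have n1N : (n.-1 < N)%N by lia.
rewrite (bigD1 (Ordinal n1N)) //= big1 ?addr0.
  rewrite psum_node (_ : n.-1%:Z + 1 - n%:Z = 0); last by lia.
  by rewrite dvdz0 !mul0r cis0; field; rewrite NC w0.
move=> l; rewrite -val_eqE /= => ln; rewrite psum_node ifN ?mulr0 //.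
apply: contra ln => /dvdzP[q qE]; have lN := ltn_ord l; apply/eqP.
have q0 : q = 0 by nia.
by rewrite q0 in qE; lia.
Qed.

(** The derivative of a logarithmic sum is a rational function of [r] with
denominators bounded away from zero, so that no individual logarithm has to be
estimated. *)
Lemma dlogsumE (n : nat) r : (1 <= n < N)%N ->
  1 - (r ^+ N)%:C * cis eps != 0 ->
  dlogsum n%:Z r =
    - ((r ^+ n.-1)%:C / (1 - (r ^+ N)%:C * cis eps)
     + cj (cis eps) * (r ^+ (N - n).-1)%:C / (1 - (r ^+ N)%:C * cj (cis eps))).
Proof.
move=> /andP[n1 nN] w0.
have z0 k : 1 - r%:C * cis (node k) != 0.
  by apply: contra w0 => /eqP h; rewrite -(sub_rpow r k) h mul0r.
have NnN : (1 <= N - n <= N)%N by lia.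
rewrite dlogsum_polesum //; congr (- (_ + _)).
  by rewrite polesumE // n1 ltnW.
rewrite polesum_shift (_ : - n%:Z + N%:Z = (N - n)%N%:Z); last by lia.
rewrite polesumE // !cjM conjc_inv cjB cjM conjc1 !conjc_real; ring.
Qed.

Lemma dlogsum0E r : 1 - (r ^+ N)%:C * cis eps != 0 ->
  dlogsum 0 r =
    - (cis eps * (r ^+ N.-1)%:C / (1 - (r ^+ N)%:C * cis eps)
     + cj (cis eps) * (r ^+ N.-1)%:C / (1 - (r ^+ N)%:C * cj (cis eps))).
Proof.
move=> w0.
have z0 k : 1 - r%:C * cis (node k) != 0.
  by apply: contra w0 => /eqP h; rewrite -(sub_rpow r k) h mul0r.
rewrite dlogsum_polesum // oppr0 polesum_shift add0r polesumE ?N0 ?leqnn //.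
rewrite !cjM conjc_inv cjB cjM conjc1 !conjc_real; congr (- (_ + _)); ring.
Qed.

End LogarithmicSums.

(** * Bounds for logarithmic sums *)

Section LogarithmicSumBounds.
Context {R : realType}.
Implicit Types (r t x y : R) (u z : R[i]).

(** The mean value inequality in the form used below: a bound on the derivative in [r] that is
itself the derivative of an explicit function. *)
Lemma nc_derive_le (F DF : R -> R[i]) (H DH : R -> R) (a b : R) : a <= b ->
  (forall u r, a <= r <= b ->
     is_derive r 1 (fun r => re (u * F r)) (re (u * DF r))) ->
  (forall r, a <= r <= b -> is_derive r 1 H (DH r)) ->
  (forall r, a <= r <= b -> nc (DF r) <= DH r) -> nc (F b - F a) <= H b - H a.
Proof.
move=> ab dF dH FH; apply: nc_le_Re => u u1.
rewrite mulrBr cReD cReN.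
apply: (derive_le_incr ab (fun r h => dF u r h) dH) => r rab.
apply: le_trans (FH r rab); apply: le_trans (ler_norm _) _.
by apply: le_trans (nc_Re _) _; rewrite ncM u1 mul1r.
Qed.

Lemma is_derive_powdiv (n : nat) r : (0 < n)%N ->
  is_derive r 1 (fun y => y ^+ n / n%:R) (r ^+ n.-1).
Proof.
move=> n0; rewrite (_ : (fun y => _) = n%:R^-1 \*: (fun y => y ^+ n)); last first.
  by apply/funext => y; rewrite mulrC.
have h : is_derive r 1 (fun y : R => y ^+ n) (n%:R *: r ^+ n.-1 *: 1).
  by apply: DeriveDef; [exact: exprn_derivable|exact: exp_derive].
apply: (@is_derive_eq _ _ _ _ _ _ _ _ (is_deriveZ _ h)).
by rewrite /GRing.scale /= mulr1 mulKf // pnatr_eq0 -lt0n.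
Qed.

(** Multiplying by the conjugate of [cis x] turns the right-hand side into the distance of a
real number to a point of imaginary part [- im (cis x)]. *)
Lemma Im_cis_bound x t : `|im (cis x)| <= nc (1 - t%:C * cis x).
Proof.
rewrite -[leRHS]mul1r -(nc_cis (- x)) -ncM mulrBr mulr1 mulrCA cisNK mulr1.
apply: le_trans (nc_Im _); rewrite cisN cImD cImN /= subr0.
by rewrite /cis /conjc /= normrN.
Qed.

Lemma logkernelE x : sin (pi * x) != 0 ->
  ln (sin (pi * x) ^+ 2) = ln (quad 1 x) - ln 4.
Proof.
move=> s0; have s2 : 0 < sin (pi * x) ^+ 2 by rewrite exprn_even_gt0.
have -> : quad 1 x = 4 * sin (pi * x) ^+ 2.
  by rewrite quadE rmorph1 mul1r ncC nc_cis_sub1_sq.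
by rewrite lnM ?posrE // addrC addKr.
Qed.

Variables (N : nat) (N0 : (0 < N)%N) (eps : R).
(* [sigma] bounds the denominators of the derivative from below: it is [`|im (cis eps)|] for the
discrete symbol at [rho = 1], and [1 - rho] for the regularized kernel, whatever the shift. *)
Variables (rho sigma : R).
Hypotheses (rho0 : 0 <= rho) (rho1 : rho <= 1) (sigma0 : 0 < sigma).
Hypothesis sigmaP : forall t, 0 <= t <= rho ^+ N -> sigma <= nc (1 - t%:C * cis eps).

Let rN r : 0 <= r <= rho -> 0 <= r ^+ N <= rho ^+ N.
Proof. by move=> /andP[r0 rr]; rewrite exprn_ge0 //= lerXn2r // nnegrE (le_trans r0). Qed.

Lemma quad_gt0 r (k : int) : 0 <= r <= rho -> 0 < quad r (node N eps k).
Proof.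
move=> rr; rewrite quadE exprn_gt0 // nc_gt0.
have := sigmaP (rN rr); apply: contraTneq => h.
by rewrite -(sub_rpow N0 eps r k) h mul0r nc0 -ltNge.
Qed.

Let w_neq0 r : 0 <= r <= rho -> 1 - (r ^+ N)%:C * cis eps != 0.
Proof. by move=> rr; rewrite -nc_gt0 (lt_le_trans sigma0) ?sigmaP ?rN. Qed.

Let ncw r : 0 <= r <= rho -> nc (1 - (r ^+ N)%:C * cis eps)^-1 <= sigma^-1.
Proof. by move=> rr; rewrite ncV lef_pV2 ?posrE ?(lt_le_trans sigma0) ?sigmaP ?rN. Qed.

Let ncw' r : 0 <= r <= rho -> nc (1 - (r ^+ N)%:C * cj (cis eps))^-1 <= sigma^-1.
Proof.
move=> rr; rewrite -[1]conjc1 -[(r ^+ N)%:C]conjc_real -cjM -cjB -conjc_inv ncJ.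
exact: ncw.
Qed.

Let dlog u n r : 0 <= r <= rho ->
  is_derive r 1 (fun r => re (u * logsum N eps n r))
    (re (u * dlogsum N eps n r)).
Proof. by move=> rr; apply: is_derive_logsum => // k; exact: quad_gt0. Qed.

Let ncr r n : 0 <= r -> nc (r ^+ n)%:C = r ^+ n.
Proof. by move=> r0; rewrite nc_real ger0_norm // exprn_ge0. Qed.

Lemma logsum_le (n : nat) : (1 <= n < N)%N ->
  nc (logsum N eps n%:Z rho) <= sigma^-1 * (rho ^+ n / n%:R + rho ^+ (N - n) / (N - n)%:R).
Proof.
move=> nN; have [n1 n2] := andP nN.
have n3 : (0 < N - n)%N by lia.
pose H y : R := sigma^-1 * (y ^+ n / n%:R + y ^+ (N - n) / (N - n)%:R).
have H0 : H 0 = 0 by rewrite /H !expr0n !gtn_eqF // !mul0r addr0 mulr0.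
rewrite -[leRHS]/(H rho) -[leRHS]subr0 -H0 -[logsum _ _ _ _]subr0 -(logsum0 N eps n%:Z).
apply: (@nc_derive_le _ (dlogsum N eps n%:Z) H
   (fun y => sigma^-1 * (y ^+ n.-1 + y ^+ (N - n).-1))) => //.
- by move=> u r; exact: dlog.
- move=> r rr; have h1 := @is_derive_powdiv n r n1; have h2 := @is_derive_powdiv _ r n3.
  exact: is_deriveZ.
- move=> r rr; have r0 : 0 <= r by case/andP: rr.
  rewrite dlogsumE ?w_neq0 // ncN mulrDr; apply: le_trans (ncD _ _) _.
  rewrite !ncM ncJ nc_cis mul1r !ncr // ![sigma^-1 * _]mulrC.
  by rewrite lerD // ler_wpM2l ?exprn_ge0 ?ncw ?ncw'.
Qed.

(** The leading term of the derivative is [- r ^ (n - 1)] up to a relative error of order [r ^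
N]; the other term is of order [r ^ (N - n)]. *)
Lemma logsum_approx (n : nat) : (1 <= n < N)%N ->
  nc (logsum N eps n%:Z rho + (rho ^+ n / n%:R)%:C) <=
  sigma^-1 * (rho ^+ (N + n) / (N + n)%:R + rho ^+ (N - n) / (N - n)%:R).
Proof.
move=> nN; have [n1 n2] := andP nN.
have n3 : (0 < N - n)%N by lia. have n4 : (0 < N + n)%N by lia.
have n5 : ((N + n).-1 = n.-1 + N)%N by lia.
pose H y : R := sigma^-1 * (y ^+ (N + n) / (N + n)%:R + y ^+ (N - n) / (N - n)%:R).
pose F y := logsum N eps n%:Z y + (y ^+ n / n%:R)%:C.
have H0 : H 0 = 0 by rewrite /H !expr0n !gtn_eqF // !mul0r addr0 mulr0.
have F0 : F 0 = 0 by rewrite /F logsum0 expr0n gtn_eqF // mul0r addr0.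
rewrite -[leRHS]/(H rho) -[leRHS]subr0 -H0 -[leLHS]/(nc (F rho)) -[F rho]subr0 -F0.
apply: (@nc_derive_le _ (fun y => dlogsum N eps n%:Z y + (y ^+ n.-1)%:C) H
   (fun y => sigma^-1 * (y ^+ (N + n).-1 + y ^+ (N - n).-1))) => //.
- move=> u r rr; have h := dlog u n%:Z rr; have h1 := @is_derive_powdiv n r n1.
  rewrite mulrDr cReD Re_mulr_real.
  rewrite (_ : (fun r => _) = (fun r => re (u * logsum N eps n%:Z r)) +
     re u \*: (fun y => y ^+ n / n%:R)); last first.
    by apply/funext => y; rewrite /F mulrDr cReD Re_mulr_real.
  exact: is_deriveD.
- move=> r rr; have h1 := @is_derive_powdiv _ r n3; have h2 := @is_derive_powdiv _ r n4.
  exact: is_deriveZ.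
- move=> r rr; have r0 : 0 <= r by case/andP: rr.
  rewrite dlogsumE ?w_neq0 //.
  rewrite (_ : _ + _ = - ((r ^+ (N + n).-1)%:C * cis eps / (1 - (r ^+ N)%:C * cis eps) +
     cj (cis eps) * (r ^+ (N - n).-1)%:C / (1 - (r ^+ N)%:C * cj (cis eps)))); last first.
    rewrite n5.
    rewrite exprD rmorphM /= [RHS]opprD [in LHS]opprD addrAC; congr (_ - _).
    by have w0 := w_neq0 rr; field.
  rewrite ncN mulrDr; apply: le_trans (ncD _ _) _.
  rewrite !ncM ncJ nc_cis mul1r mulr1 !ncr // ![sigma^-1 * _]mulrC.
  by rewrite lerD // ler_wpM2l ?exprn_ge0 ?ncw ?ncw'.
Qed.

Lemma logsum0_le : nc (logsum N eps 0 rho) <= 2 * sigma^-1 * (rho ^+ N / N%:R).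
Proof.
pose H y : R := 2 * sigma^-1 * (y ^+ N / N%:R).
have H0 : H 0 = 0 by rewrite /H expr0n gtn_eqF // mul0r mulr0.
rewrite -[leRHS]/(H rho) -[leRHS]subr0 -H0 -[logsum _ _ _ _]subr0 -(logsum0 N eps 0).
apply: (@nc_derive_le _ (dlogsum N eps 0) H (fun y => 2 * sigma^-1 * y ^+ N.-1)) => //.
- by move=> u r; exact: dlog.
- move=> r rr; have h1 := @is_derive_powdiv N r N0.
  exact: is_deriveZ.
- move=> r rr; have r0 : 0 <= r by case/andP: rr.
  rewrite dlogsum0E ?w_neq0 // ncN; apply: le_trans (ncD _ _) _.
  rewrite !ncM ncJ nc_cis !mul1r !ncr // -mulrA mulr_natl mulr2n ![sigma^-1 * _]mulrC.
  by rewrite lerD // ler_wpM2l ?exprn_ge0 ?ncw ?ncw'.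
Qed.

(** Both terms of the derivative are monotone in the frequency, so that the difference of two
derivatives has coefficients of constant sign that integrate exactly. *)
Lemma logsum_diff_le (n n' : nat) : (1 <= n)%N -> (n <= n')%N -> (n' < N)%N ->
  nc (logsum N eps n%:Z rho - logsum N eps n'%:Z rho) <=
  sigma^-1 * ((rho ^+ n / n%:R - rho ^+ n' / n'%:R) +
              (rho ^+ (N - n') / (N - n')%:R - rho ^+ (N - n) / (N - n)%:R)).
Proof.
move=> n1 nn' nN'.
have n1' : (1 <= n')%N by lia.
have nN : (n < N)%N by lia.
have n3 : (0 < N - n)%N by lia. have n3' : (0 < N - n')%N by lia.
have n4 : (n.-1 <= n'.-1)%N by lia. have n5 : ((N - n').-1 <= (N - n).-1)%N by lia.
pose H y : R := sigma^-1 * ((y ^+ n / n%:R - y ^+ n' / n'%:R) +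
              (y ^+ (N - n') / (N - n')%:R - y ^+ (N - n) / (N - n)%:R)).
pose F y := logsum N eps n%:Z y - logsum N eps n'%:Z y.
have H0 : H 0 = 0 by rewrite /H !expr0n !gtn_eqF // !mul0r !subr0 addr0 mulr0.
have F0 : F 0 = 0 by rewrite /F !logsum0 subr0.
rewrite -[leRHS]/(H rho) -[leRHS]subr0 -H0 -[leLHS]/(nc (F rho)) -[F rho]subr0 -F0.
apply: (@nc_derive_le _ (fun y => dlogsum N eps n%:Z y - dlogsum N eps n'%:Z y) H
   (fun y => sigma^-1 * ((y ^+ n.-1 - y ^+ n'.-1) +
        (y ^+ (N - n').-1 - y ^+ (N - n).-1)))) => //.
- move=> u r rr; have h := dlog u n%:Z rr; have h' := dlog u n'%:Z rr.
  rewrite mulrBr cReD cReN.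
  rewrite (_ : (fun r => _) = (fun r => re (u * logsum N eps n%:Z r)) -
     (fun r => re (u * logsum N eps n'%:Z r))); last first.
    by apply/funext => y; rewrite /F mulrBr cReD cReN.
  exact: is_deriveB.
- move=> r rr; have h1 := @is_derive_powdiv _ r n3; have h2 := @is_derive_powdiv _ r n1.
  have h1' := @is_derive_powdiv _ r n3'; have h2' := @is_derive_powdiv _ r n1'.
  exact: is_deriveZ.
- move=> r rr; have [r0 rr1] := andP rr; have r1 : r <= 1 by exact: le_trans rr1 rho1.
  rewrite !dlogsumE ?w_neq0 ?n1 ?n1' //.
  have g1 : r ^+ n'.-1 <= r ^+ n.-1 by rewrite ler_wiXn2l.
  have g2 : r ^+ (N - n).-1 <= r ^+ (N - n').-1 by rewrite ler_wiXn2l.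
  move: g1 g2; set a := r ^+ _; set b := r ^+ _; set c := r ^+ _; set d := r ^+ _ => g1 g2.
  rewrite [X in nc X](_ : _ = - ((b - a)%:C / (1 - (r ^+ N)%:C * cis eps) -
     cj (cis eps) * (d - c)%:C / (1 - (r ^+ N)%:C * cj (cis eps)))); last first.
    by rewrite !rmorphB /=; ring.
  rewrite ncN; apply: le_trans (ncB _ _) _.
  rewrite !ncM ncJ nc_cis mul1r !nc_real !ger0_norm ?subr_ge0 // mulrDr ![sigma^-1 * _]mulrC.
  by rewrite lerD // ler_wpM2l ?subr_ge0 ?ncw ?ncw'.
Qed.

(** After multiplication by [cis eps] the two terms of the derivative have real
coefficients of opposite monotonicity in front of a fixed non-real number, so
that their imaginary parts cannot cancel. *)
Lemma logsum_ge (n : nat) : (1 <= n < N)%N ->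
  `|im (cis eps)| / 4 *
    (rho ^+ n / n%:R - rho ^+ (2 * N - n) / (2 * N - n)%:R) <= nc (logsum N eps n%:Z rho).
Proof.
move=> nN; have [n1 n2] := andP nN.
have n3 : (0 < 2 * N - n)%N by lia.
have n4 : ((2 * N - n).-1 = (N - n).-1 + N)%N by lia.
have n5 : (n.-1 <= (2 * N - n).-1)%N by lia.
set s := im (cis eps).
pose u : R[i] := 'i%C * cis eps * (Num.sg s)%:C.
have u1 : nc u <= 1.
  rewrite /u !ncM nc_cis nc_real mulr1 (ncE 'i%C) /= expr0n expr1n add0r sqrtr1 mul1r.
  by rewrite normr_sg lern1 leq_b1.
pose H y : R := `|s| / 4 * (y ^+ n / n%:R - y ^+ (2 * N - n) / (2 * N - n)%:R).
have H0 : H 0 = 0 by rewrite /H !expr0n !gtn_eqF // !mul0r subr0 mulr0.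
apply: (@le_trans _ _ (re (u * logsum N eps n%:Z rho))); last first.
  apply: le_trans (ler_norm _) _; apply: le_trans (nc_Re _) _.
  by rewrite ncM ler_piMl ?nc_ge0.
rewrite -[leLHS]/(H rho) -[leLHS]subr0 -H0.
rewrite -[re _]subr0 -[X in _ <= _ - X](_ : re (u * logsum N eps n%:Z 0) = 0); last first.
  by rewrite logsum0 mulr0.
apply: (@derive_le_incr R H (fun y => `|s| / 4 * (y ^+ n.-1 - y ^+ (2 * N - n).-1))
  (fun y => re (u * logsum N eps n%:Z y))
  (fun y => re (u * dlogsum N eps n%:Z y)) 0 rho rho0).
- move=> r rr; have h1 := @is_derive_powdiv _ r n1; have h2 := @is_derive_powdiv _ r n3.
  exact: is_deriveZ.
- by move=> r; exact: dlog.
- move=> r rr; have [r0 rr1] := andP rr; have r1 : r <= 1 by exact: le_trans rr1 rho1.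
  rewrite dlogsumE ?w_neq0 //.
  have w0 := w_neq0 rr; set t := r ^+ N in w0 *.
  have cc : cis eps * cj (cis eps) = 1 by rewrite -cisN mulrC cisNK.
  have w'0 : 1 - t%:C * cj (cis eps) != 0.
    by rewrite -[1]conjc1 -[t%:C]conjc_real -cjM -cjB conjc_eq0.
  have wE : (1 - t%:C * cis eps) * (1 - t%:C * cj (cis eps)) = (nc (1 - t%:C * cis eps) ^+ 2)%:C.
    by rewrite -mulcJ cjB cjM conjc1 conjc_real.
  set W := nc (1 - t%:C * cis eps) in wE.
  have W0 : 0 < W by rewrite nc_gt0.
  have t01 : 0 <= t <= 1 by rewrite exprn_ge0 // exprn_ile1.
  have W2 : W ^+ 2 <= 4.
    have : W <= 2.
      apply: le_trans (ncB _ _) _; rewrite nc1 ncM nc_cis mulr1 nc_real ger0_norm; last by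
        case/andP: t01.
      by case/andP: t01 => _ t1; lra.
    by move=> h; nra.
  set a := r ^+ n.-1; set b := r ^+ (N - n).-1.
  have bE : r ^+ (2 * N - n).-1 = b * t by rewrite /b /t -exprD n4.
  rewrite bE.
  have ab : b * t <= a by rewrite -bE /a ler_wiXn2l.
  rewrite (_ : u * _ = (- Num.sg s / W ^+ 2)%:C * ('i%C * (a%:C * (cis eps - t%:C) +
      b%:C * (1 - t%:C * cis eps)))); last first.
    rewrite rmorphM rmorphN /= fmorphV /= -wE /u.
    apply: (@mulIf _ ((1 - t%:C * cis eps) * (1 - t%:C * cj (cis eps)))); first by rewrite
      mulf_neq0.
    rewrite [RHS](_ : _ = (- (Num.sg s)%:C) * ('i%C * (a%:C * (cis eps - t%:C * (cis eps * cj
      (cis eps))) +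
      b%:C * (cis eps * cj (cis eps) - t%:C * cis eps * (cis eps * cj (cis eps)))))); last first.
      by rewrite cc !mulr1 mulrAC mulfVK // mulf_neq0.
    by field; rewrite w0 w'0.
  rewrite [X in re X]mulrC Re_mulr_real.
  rewrite !(cImD, cImM, cReM, cReD, cImN, cReN) /= !(mul0r, addr0, add0r, subr0, mulr0, oppr0,
    sub0r).
  rewrite -[sin (2 * pi * eps)]/s.
  rewrite (_ : - (1 * _) * _ = Num.sg s * s * ((a - b * t) / W ^+ 2)); last first.
    by field; rewrite gt_eqF.
  rewrite -normrEsg -mulrA ler_wpM2l // mulrC ler_wpM2l ?subr_ge0 //.
  by rewrite lef_pV2 // posrE ?exprn_gt0.
Qed.

End LogarithmicSumBounds.

(** * The sampled logarithmic kernel *)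

Section LogarithmicSymbol.
Context {R : realType}.

(** For [n] in the resolved window and [a], [b] close to [n], both [a * b] and the mirrored
product are comparable to [n ^ 2]. *)
Lemma window_prod (n N a b : nat) : (1 <= a)%N -> (a <= b)%N -> (b < N)%N ->
  (2 * n <= N)%N -> (2 * (b - a) < n)%N -> a = n \/ b = n ->
  [/\ (0 < a * b)%N, (0 < (N - a) * (N - b))%N, (n ^ 2 <= 2 * (a * b))%N &
      (n ^ 2 <= 2 * ((N - a) * (N - b)))%N].
Proof.
move=> a1 ab bN nN abn h.
have a2 : (n <= 2 * a)%N by lia.
have Na : (n <= 2 * (N - a))%N by lia.
have Nb : (n <= 2 * (N - b))%N by lia.
have Na1 : (0 < N - a)%N by lia.
have Nb1 : (0 < N - b)%N by lia.
have b1 : (0 < b)%N by lia.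
have b2 : (n <= b)%N by lia.
have Na2 : (n <= N - a)%N by lia.
rewrite !muln_gt0 a1 b1 Na1 Nb1; split=> //.
- by rewrite mulnA; exact: leq_mul.
- by rewrite mulnCA; exact: leq_mul.
Qed.

Definition lnk (x : R) : R := ln (sin (pi * x) ^+ 2).

Lemma lnkDz x (n : int) : lnk (x + n%:~R) = lnk x.
Proof.
rewrite /lnk; congr ln; apply: (@mulfI _ 4); first by rewrite pnatr_eq0.
by rewrite -!nc_cis_sub1_sq cisDz.
Qed.

Lemma cis_eq1 (x : R) : cis x = 1 -> exists n : int, x = n%:~R.
Proof.
move=> x1; exists (Num.floor x); apply/eqP; rewrite -subr_eq0.
set r := x - _; apply/negP => /negP r0.
have /andP[fl fu] := real_floor_itv (num_real x).
have r00 : 0 < r by rewrite lt_def r0 subr_ge0.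
have r1 : r < 1 by rewrite ltrBlDr addrC -[1]/(1%:~R) -intrD.
have : nc (cis r - 1) = 0.
  by rewrite /r -rmorphN cisDz x1 subrr nc0.
rewrite nc_cis_sub1 => /eqP; rewrite mulf_eq0 pnatr_eq0 normr_eq0 /= gt_eqF //.
apply: sin_gt0_pi; rewrite mulr_gt0 ?pi_gt0 //=.
by rewrite gtr_pMr ?pi_gt0.
Qed.

Lemma im_cis_neq0 (eps : R) : (forall k : int, eps <> k%:~R / 2) -> 0 < `|im (cis eps)|.
Proof.
move=> heps; rewrite normr_gt0; apply/eqP => h.
have : cis (2 * eps) = 1.
  rewrite cisMn; apply: complex_eq.
    rewrite expr2 cReM h mulr0 subr0 /=; have := ncsq (cis eps).
    by rewrite nc_cis h expr1n expr0n addr0 -expr2.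
  by rewrite expr2 cImM h mulr0 mul0r addr0.
move=> /cis_eq1[n nE]; by apply: (heps n); lra.
Qed.

Variables (eps : R).
Local Notation s := `|im (cis eps)|.
Hypothesis s0 : 0 < s.

Section FixedN.
Variables (N : nat) (N0 : (0 < N)%N).
Implicit Types (m p : int).

(** The discrete Fourier coefficients of the kernel sampled at the shifted nodes. The shift
keeps all nodes away from the singularity. *)
Definition symb (m : int) : R[i] :=
  N%:R^-1 * psum N (fun k => (lnk (node N eps k))%:C * cis (- (m%:~R * node N eps k))).

Let sP t : 0 <= t <= 1 ^+ N -> s <= nc (1 - t%:C * cis eps).
Proof. by move=> _; exact: Im_cis_bound. Qed.

Let NR : 0 < N%:R :> R. Proof. by rewrite ltr0n. Qed.

Lemma sin_node_neq0 (k : int) : sin (pi * node N eps k) != 0.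
Proof.
have := @quad_gt0 _ N N0 eps 1 s ler01 s0 sP 1 k; rewrite lexx ler01 => /(_ isT).
rewrite quadE rmorph1 mul1r ncC nc_cis_sub1_sq.
by apply: contraTneq => ->; rewrite expr0n mulr0 ltxx.
Qed.

Lemma symbE m : symb m = logsum N eps m 1 -
  (if (N%:Z %| m)%Z then (ln 4)%:C * cis (- (m%:~R * eps / N%:R)) else 0).
Proof.
transitivity (logsum N eps m 1 - (ln 4)%:C * (N%:R^-1 * psum N (fun k => cis ((- m)%:~R * node N
  eps k)))).
  rewrite /symb /logsum mulrCA -mulrBr; congr (_ * _).
  rewrite -psumZ /psum -sumrB; apply: eq_bigr => k _.
  by rewrite /lnk logkernelE ?sin_node_neq0 // rmorphB /= mulrBl rmorphN /= mulNr.
congr (_ - _); rewrite psum_node // (_ : (N%:Z %| - m)%Z = (N%:Z %| m)%Z); last first.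
  by apply/dvdzP/dvdzP => -[q qE]; exists (- q); rewrite mulNr -qE ?opprK.
case: ifP => _; last by rewrite !mulr0.
by rewrite mulKf ?pnatr_eq0 -?lt0n // rmorphN /= !mulNr.
Qed.

Lemma symbN m : symb (- m) = cj (symb m).
Proof.
rewrite /symb cjM conjc_inv conjc_nat cj_sum; congr (_ * _).
apply: eq_bigr => k _; rewrite cjM conjc_real -cisN.
by rewrite rmorphN /= mulNr.
Qed.

Lemma symb_shift m : symb m = cis eps * symb (m + N%:Z).
Proof.
rewrite /symb mulrCA; congr (_ * _); rewrite -psumZ; apply: eq_bigr => k _.
rewrite [RHS]mulrCA -cisD; congr (_ * _).
rewrite [in RHS](_ : eps + _ = - (m%:~R * node N eps k) + (- k%:~R)); last first.
  by rewrite rmorphD /= mulrDl opprD /node; field; rewrite gt_eqF.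
by rewrite -rmorphN cisDz.
Qed.

Lemma nc_symb_shift m (q : int) : nc (symb (m + q * N%:Z)) = nc (symb m).
Proof.
have h k : nc (symb (k + N%:Z)) = nc (symb k) by rewrite (symb_shift k) ncM nc_cis mul1r.
elim/int_ind: q => [|q|q]; first by rewrite mul0r addr0.
- by move=> <-; rewrite -(h (m + q%:Z * N%:Z)); congr (nc (symb _)); lia.
- by move=> <-; rewrite -(h (m + - q.+1%:Z * N%:Z)); congr (nc (symb _)); lia.
Qed.

Lemma symb_logsum (n : nat) : (1 <= n < N)%N -> symb n%:Z = logsum N eps n%:Z 1.
Proof.
move=> /andP[n1 nN]; rewrite symbE ifF ?subr0 //; apply/negbTE/negP => /dvdzP[q qE].
have : q = 0 by nia.
by move=> q0; rewrite q0 in qE; lia.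
Qed.

Lemma logsum_le1 (n : nat) : (1 <= n < N)%N -> nc (symb n%:Z) <= 2 * s^-1.
Proof.
move=> nN; rewrite symb_logsum //; have [n1 n2] := andP nN.
have := @logsum_le _ N N0 eps 1 s ler01 (lexx _) s0 sP n nN.
rewrite !expr1n !mul1r => /le_trans; apply.
rewrite mulrC ler_wpM2r ?invr_ge0 ?(ltW s0) //.
rewrite (_ : 2 = 1 + 1) // lerD // invf_le1 ?ltr0n ?ler1n //; lia.
Qed.

Lemma symb_le m : nc (symb m) <= 2 * s^-1 + ln 4.
Proof.
have N1 : (0 < N%:Z)%R by lia.
rewrite (divz_eq m N%:Z) addrC nc_symb_shift.
have := ltz_pmod m N1; have : (0 <= (m %% N%:Z)%Z)%R by apply: modz_ge0; lia.
move: (m %% N%:Z)%Z => [n _ nN|//].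
have ln40 : 0 <= ln 4 :> R by apply: ln_ge0; rewrite ler1n.
have [n0|n0] := posnP n; last first.
  by apply: le_trans (logsum_le1 _) _; [lia|rewrite lerDl].
rewrite n0 symbE dvdz0 mul0r mul0r oppr0 cis0 mulr1.
apply: le_trans (ncB _ _) _; rewrite nc_real ger0_norm // lerD2r.
apply: le_trans (logsum0_le N0 ler01 s0 sP) _.
rewrite expr1n mul1r ler_piMr // ?mulr_ge0 ?invr_ge0 ?(ltW s0) //.
by rewrite invf_le1 ?ltr0n ?ler1n.
Qed.

Let natz m : 1 <= `|m| -> exists n : nat, (1 <= n)%N /\ (m = n%:Z \/ m = - n%:Z).
Proof.
move=> m1; exists (absz m); split; first by lia.
by have [m0|m0] := lerP 0 m; [left|right]; lia.
Qed.

(** Ellipticity, inherited from [logsum_ge]; negative frequencies follow by conjugation. *)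
Lemma symb_ge m : 1 <= `|m| -> 2 * `|m| <= N%:Z ->
  s / 8 / `|m|%:~R <= nc (symb m).
Proof.
move=> m1 mN; have [n [n1 mE]] := natz m1.
have nN : (1 <= n < N)%N by case: mE => E; rewrite E in m1 mN; lia.
have n2N : (2 * n <= N)%N by case: mE => E; rewrite E in m1 mN; lia.
have -> : nc (symb m) = nc (symb n%:Z) by case: mE => ->; rewrite ?symbN ?ncJ.
have -> : `|m| = n%:Z by case: mE => ->; lia.
rewrite symb_logsum //.
have := @logsum_ge _ N N0 eps 1 s ler01 (lexx _) s0 sP n nN.
rewrite !expr1n !mul1r => /(le_trans _); apply.
rewrite (_ : s / 8 / _ = s / 4 * (2^-1 / n%:R)); last first.
  by field; rewrite pnatr_eq0 -lt0n.
rewrite ler_wpM2l ?divr_ge0 ?(ltW s0) //.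
have nR : 1 <= n%:R :> R by rewrite ler1n.
have nNR : 2 * n%:R <= N%:R :> R by rewrite -natrM ler_nat.
rewrite natrB; last by lia.
rewrite natrM lerBrDl -lerBrDr.
have -> : n%:R^-1 - 2^-1 / n%:R = (2 * n%:R)^-1 :> R by field; rewrite gt_eqF //; lra.
by rewrite lef_pV2 ?posrE //; lra.
Qed.

Lemma symb_diff_nat (n n' : nat) : (1 <= n)%N -> (n <= n')%N -> (n' < N)%N ->
  nc (symb n%:Z - symb n'%:Z) <= s^-1 * (n'%:R - n%:R) *
      ((n%:R * n'%:R)^-1 + ((N - n)%:R * (N - n')%:R)^-1).
Proof.
move=> n1 nn nN; rewrite !symb_logsum; try lia.
have := @logsum_diff_le _ N N0 eps 1 s ler01 (lexx _) s0 sP n n' n1 nn nN.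
rewrite !expr1n !mul1r => /le_trans; apply; rewrite -mulrA ler_wpM2l ?invr_ge0 ?(ltW s0) //.
have nR : 1 <= n%:R :> R by rewrite ler1n.
have nnR : n%:R <= n'%:R :> R by rewrite ler_nat.
have nNR : 1 + n'%:R <= N%:R :> R by rewrite addrC natr1 ler_nat.
rewrite !natrB; try lia.
rewrite le_eqVlt; apply/orP; left; apply/eqP; field; apply/and4P; split; apply/eqP; lra.
Qed.

(** Smoothing of the commutator: small shifts are covered by [symb_diff_nat], while for a shift
comparable to [m] the crude bound [symb_le] suffices. *)
Lemma symb_diff m p : 1 <= `|m| -> 2 * `|m| <= N%:Z ->
  nc (symb (m - p) - symb m) <=
    (8 * (2 * s^-1 + ln 4) + 8 * s^-1) * (1 + `|p|%:~R) ^+ 2 / `|m|%:~R ^+ 2.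
Proof.
move=> m1 mN; have [n [n1 mE]] := natz m1.
have nN : (1 <= n < N)%N by case: mE => E; rewrite E in m1 mN; lia.
have n2N : (2 * n <= N)%N by case: mE => E; rewrite E in m1 mN; lia.
wlog -> : m p m1 mN mE / m = n%:Z.
  move=> h; case: (mE) => [|E]; first exact: h.
  have := h n%:Z (- p); rewrite E !normrN => h'.
  rewrite (_ : - n%:Z - p = - (n%:Z - - p)); last by lia.
  rewrite !symbN -cjB ncJ; apply: h' => //; [lia..|by left].
have sV : 0 < s^-1 by rewrite invr_gt0.
have ln40 : 0 <= ln 4 :> R by apply: ln_ge0; rewrite ler1n.
rewrite [`|n%:Z|]ger0_norm //.
have nR : 1 <= n%:R :> R by rewrite ler1n.
have nNR : 2 * n%:R <= N%:R :> R by rewrite -natrM ler_nat.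
have p0 : 0 <= `|p|%:~R :> R by rewrite ler0z.
rewrite ler_pdivlMr ?exprn_gt0 //; last by rewrite -[n%:~R]/(n%:R); lra.
rewrite -[n%:~R]/(n%:R : R).
have [pb|ps] := lerP n%:Z (2 * `|p|).
  have pbR : n%:R <= 2 * `|p|%:~R :> R by rewrite -[n%:R]/(n%:Z%:~R) -[2]/(2%:~R) -intrM ler_int.
  have := ncB (symb (n%:Z - p)) (symb n%:Z); have := symb_le (n%:Z - p); have := symb_le n%:Z.
  have := nc_ge0 (symb (n%:Z - p) - symb n%:Z).
  set c := _ + ln 4; move: (nc _) (nc (symb _)) (nc (symb _)) => x y z x0 yc zc xyz.
  have c0 : 0 <= c by lra.
  have xc : x <= 2 * c by lra.
  have n2 : n%:R ^+ 2 <= 4 * (1 + `|p|%:~R) ^+ 2 :> R by nra.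
  apply: (@le_trans _ _ (2 * c * (4 * (1 + `|p|%:~R) ^+ 2))).
    by rewrite ler_pM ?sqr_ge0.
  rewrite [leRHS]mulrDl (_ : 2 * c * _ = 8 * c * (1 + `|p|%:~R) ^+ 2); last by ring.
  by rewrite lerDl mulr_ge0 ?sqr_ge0 //; lra.
have main (a b : nat) : (1 <= a)%N -> (a <= b)%N -> (b < N)%N -> b%:Z - a%:Z = `|p| ->
    (a = n \/ b = n) ->
    nc (symb a%:Z - symb b%:Z) * n%:R ^+ 2 <= 8 * s^-1 * `|p|%:~R.
  move=> a1 ab bN abp abn.
  have aR : 1 <= a%:R :> R by rewrite ler1n.
  have baR : b%:R - a%:R = `|p|%:~R :> R by rewrite -abp rmorphB.
  have abp' : (2 * (b - a) < n)%N by lia.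
  have [abR NaR aab Nab] := window_prod a1 ab bN n2N abp' abn.
  move: abR NaR aab Nab; rewrite -!(ltr_nat R) -!(ler_nat R) natrX !natrM => abR NaR aab Nab.
  have q1 : (a%:R * b%:R)^-1 * n%:R ^+ 2 <= 2 :> R by rewrite mulrC ler_pdivrMr.
  have q2 : ((N - a)%:R * (N - b)%:R)^-1 * n%:R ^+ 2 <= 2 :> R by rewrite mulrC ler_pdivrMr.
  apply: (@le_trans _ _ (s^-1 * (b%:R - a%:R) *
      ((a%:R * b%:R)^-1 + ((N - a)%:R * (N - b)%:R)^-1) * n%:R ^+ 2)).
    by rewrite ler_wpM2r ?sqr_ge0 ?symb_diff_nat.
  rewrite baR -[leLHS]mulrA mulrDl.
  have sp0 : 0 <= s^-1 * `|p|%:~R by rewrite mulr_ge0 // ltW.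
  apply: (@le_trans _ _ (s^-1 * `|p|%:~R * 4)); last by lra.
  by apply: ler_wpM2l => //; lra.
have fin : 8 * s^-1 * `|p|%:~R <= (8 * (2 * s^-1 + ln 4) + 8 * s^-1) * (1 + `|p|%:~R) ^+ 2.
  by nra.
apply: le_trans fin.
have [pp|pn] := lerP 0 p.
  have E : n%:Z - p = (n - absz p)%N%:Z by lia.
  by rewrite E; apply: main; [lia..|right].
have E : n%:Z - p = (n + absz p)%N%:Z by lia.
by rewrite E ncC; apply: main; [lia..|left].
Qed.

(** The Fourier coefficients of [lnk] on the circle, see [int01_lnk_cis]. *)
Definition Lhat (m : int) : R := if m == 0 then - ln 4 else - `|m|%:~R^-1.

Lemma symb_lim m : 2 * `|m| < N%:Z -> nc (symb m - (Lhat m)%:C) <= 3 * s^-1 / N%:R.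
Proof.
move=> mN; have sV : 0 < s^-1 by rewrite invr_gt0.
have [->|m0] := eqVneq m 0.
  rewrite /Lhat eqxx symbE dvdz0 mul0r mul0r oppr0 cis0 mulr1 rmorphN /= opprK subrK.
  apply: le_trans (logsum0_le N0 ler01 s0 sP) _.
  rewrite expr1n mul1r ler_wpM2r ?invr_ge0 ?(ltW NR) //; lra.
have m1 : 1 <= `|m| by lia.
have [n [n1 mE]] := natz m1.
have nN : (1 <= n < N)%N by case: mE => E; rewrite E in m1 mN; lia.
have n2N : (2 * n < N)%N by case: mE => E; rewrite E in m1 mN; lia.
have -> : nc (symb m - (Lhat m)%:C) = nc (symb n%:Z - (Lhat n%:Z)%:C).
  case: mE => -> //; rewrite symbN -ncJ cjB conjcK conjc_real; congr (nc (_ - _%:C)).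
  by rewrite /Lhat oppr_eq0 normrN.
rewrite symb_logsum // /Lhat ifF; last by apply/eqP; lia.
rewrite [X in nc (_ - X)]rmorphN opprK [`|n%:Z|]ger0_norm //.
have := @logsum_approx _ N N0 eps 1 s ler01 (lexx _) s0 sP n nN.
rewrite !expr1n !mul1r => /le_trans; apply.
rewrite [3 * _]mulrC -[leRHS]mulrA; apply: ler_wpM2l; first exact: ltW.
have nR : 1 <= n%:R :> R by rewrite ler1n.
have nNR : 2 * n%:R <= N%:R :> R by rewrite -natrM ler_nat ltnW.
rewrite natrD natrB; last by lia.
have h1 : (N%:R + n%:R)^-1 <= N%:R^-1 :> R by rewrite lef_pV2 ?posrE; lra.
have h2 : (N%:R - n%:R)^-1 <= 2 / N%:R :> R.
  by rewrite -[2]invrK -invfM lef_pV2 ?posrE; lra.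
lra.
Qed.

End FixedN.
End LogarithmicSymbol.

(** * Unconditional sums *)

Section UnconditionalSums.
Context {R : realType}.

Section OneType.
Variable T : choiceType.
Implicit Types (f g : T -> R[i]) (B : T -> R) (s t : seq T).

(** Finite index sets are duplicate-free lists, so that sums can be taken over
any index type without an enumeration. *)
Definition sumle B (C : R) := forall s, uniq s -> \sum_(x <- s) B x <= C.

Definition hasSum f (S : R[i]) := forall e : R, 0 < e ->
  exists2 s0, uniq s0 &
    forall s, uniq s -> {subset s0 <= s} -> nc (\sum_(x <- s) f x - S) <= e.

Lemma seqU s t : uniq s -> uniq t -> exists u,
  [/\ uniq u, {subset s <= u} & {subset t <= u}].
Proof.
move=> us ut; exists (undup (s ++ t)); split; rewrite ?undup_uniq // => x xs.
  by rewrite mem_undup mem_cat xs.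
by rewrite mem_undup mem_cat xs orbT.
Qed.

Lemma sum_subset (V : zmodType) (f : T -> V) s t : uniq s -> uniq t -> {subset s <= t} ->
  \sum_(x <- t) f x = \sum_(x <- s) f x + \sum_(x <- t | x \notin s) f x.
Proof.
move=> us ut st; rewrite (bigID [in s]) /=; congr (_ + _).
rewrite -big_filter; apply: perm_big; apply: uniq_perm => //; first exact: filter_uniq.
by move=> x; rewrite mem_filter andb_idr //; exact: st.
Qed.

Lemma hasSum_unique f S S' : hasSum f S -> hasSum f S' -> S = S'.
Proof.
move=> h h'; apply/eqP; rewrite -subr_eq0 -nc_eq0 eq_le nc_ge0 andbT.
apply/ler_addgt0Pr => e e0; rewrite add0r.
have e2 : 0 < e / 2 by rewrite divr_gt0.
have [s us sP] := h _ e2; have [s' us' sP'] := h' _ e2.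
have [u [uu su su']] := seqU us us'.
have a := sP u uu su; have b := sP' u uu su'.
rewrite (_ : S - S' = (\sum_(x <- u) f x - S') - (\sum_(x <- u) f x - S)); last by ring.
by apply: le_trans (ncB _ _) _; lra.
Qed.

Lemma hasSumD f g S S' : hasSum f S -> hasSum g S' -> hasSum (fun x => f x + g x) (S + S').
Proof.
move=> h h' e e0; have e2 : 0 < e / 2 by rewrite divr_gt0.
have [s us sP] := h _ e2; have [s' us' sP'] := h' _ e2.
have [u [uu su su']] := seqU us us'.
exists u => // v uv vu; rewrite big_split /= opprD addrACA.
apply: le_trans (ncD _ _) _.
have a := sP v uv (fun x h => vu x (su x h)).
have b := sP' v uv (fun x h => vu x (su' x h)); lra.
Qed.

Lemma hasSumZ (a : R[i]) f S : hasSum f S -> hasSum (fun x => a * f x) (a * S).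
Proof.
move=> h e e0; have a0 := nc_ge0 a; have a1 : 0 < nc a + 1 by lra.
have [s us sP] := h (e / (nc a + 1)) (divr_gt0 e0 a1).
exists s => // t ut ts; rewrite -mulr_sumr -mulrBr ncM.
apply: (@le_trans _ _ (nc a * (e / (nc a + 1)))); first by rewrite ler_wpM2l ?sP.
rewrite mulrA ler_pdivrMr //; nra.
Qed.

Lemma hasSumB f g S S' : hasSum f S -> hasSum g S' -> hasSum (fun x => f x - g x) (S - S').
Proof.
move=> h /(@hasSumZ (-1)) h'; have := hasSumD h h'; rewrite mulN1r.
by congr hasSum; apply/funext => x; rewrite mulN1r.
Qed.

Lemma hasSum_finite f s : uniq s -> (forall x, x \notin s -> f x = 0) ->
  hasSum f (\sum_(x <- s) f x).
Proof.
move=> us f0 e e0; exists s => // t ut st.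
rewrite (sum_subset f us ut st) [X in _ + X - _]big1 ?addr0 ?subrr ?nc0 ?ltW //.
Qed.

Lemma hasSum0 : hasSum (fun=> 0) 0.
Proof. by have := @hasSum_finite (fun=> 0) [::] isT (fun _ _ => erefl); rewrite big_nil. Qed.

Lemma hasSum_big (I : Type) (r : seq I) (F : I -> T -> R[i]) (S : I -> R[i]) :
  (forall i, hasSum (F i) (S i)) ->
  hasSum (fun x => \sum_(i <- r) F i x) (\sum_(i <- r) S i).
Proof.
move=> h; elim: r => [|i r IH].
  rewrite big_nil (_ : (fun x => _) = fun=> 0); first exact: hasSum0.
  by apply/funext => x; rewrite big_nil.
rewrite big_cons (_ : (fun x => _) = fun x => F i x + \sum_(i <- r) F i x).
  exact: hasSumD.
by apply/funext => x; rewrite big_cons.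
Qed.

Lemma hasSum_bound f S (C : R) : hasSum f S -> sumle (fun x => nc (f x)) C -> nc S <= C.
Proof.
move=> h fC; apply/ler_addgt0Pr => e e0.
have [s us sP] := h e e0; have := sP s us (fun _ => id).
have := fC s us; have := nc_sum s xpredT f; have := ncBl S (S - \sum_(x <- s) f x).
rewrite opprB addrCA subrr addr0 ncC; lra.
Qed.

Lemma sumle_le B B' (C : R) : (forall x, B x <= B' x) -> sumle B' C -> sumle B C.
Proof. by move=> BB h s us; apply: le_trans (h s us); apply: ler_sum => x _; exact: BB. Qed.

Lemma sumleZ B (C a : R) : 0 <= a -> sumle B C -> sumle (fun x => a * B x) (a * C).
Proof. by move=> a0 h s us; rewrite -mulr_sumr ler_wpM2l ?h. Qed.

Lemma sumleD B B' (C C' : R) :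
  sumle B C -> sumle B' C' -> sumle (fun x => B x + B' x) (C + C').
Proof. by move=> h h' s us; rewrite big_split lerD ?h ?h'. Qed.

Lemma sumle_ge0 B (C : R) : sumle B C -> 0 <= C.
Proof. by move=> /(_ [::] isT); rewrite big_nil. Qed.

Lemma sumle_tail B (C : R) : (forall x, 0 <= B x) -> sumle B C ->
  forall e, 0 < e -> exists2 s0, uniq s0 &
    forall s, uniq s -> (forall x, x \in s -> x \notin s0) -> \sum_(x <- s) B x <= e.
Proof.
move=> B0 BC e e0.
pose E := [set r : R | exists2 s, uniq s & r = \sum_(x <- s) B x].
have supE : has_sup E.
  split; first by exists 0, [::]; rewrite ?big_nil.
  by exists C => _ [s us ->]; exact: BC.
have [_ [s0 us0 ->] hs0] := sup_adherent e0 supE.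
exists s0 => // s us dis.
have uss : uniq (s0 ++ s).
  rewrite cat_uniq us0 us andbT /=; apply/hasPn => x xs; exact: dis.
have : \sum_(x <- s0 ++ s) B x <= sup E.
  by apply: ub_le_sup; [case: supE|exists (s0 ++ s)].
by rewrite big_cat /=; lra.
Qed.

Lemma hasSum_ge0 B (C : R) : (forall x, 0 <= B x) -> sumle B C ->
  exists S, hasSum (fun x => (B x)%:C) S.
Proof.
move=> B0 BC.
pose E := [set r : R | exists2 s, uniq s & r = \sum_(x <- s) B x].
have supE : has_sup E.
  split; first by exists 0, [::]; rewrite ?big_nil.
  by exists C => _ [s us ->]; exact: BC.
exists (sup E)%:C => e e0; have [_ [s0 us0 ->] hs0] := sup_adherent e0 supE.
exists s0 => // s us ss; rewrite -rmorph_sum -rmorphB nc_real.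
have h1 : \sum_(x <- s) B x <= sup E.
  by apply: ub_le_sup; [case: supE|exists s].
have h2 : \sum_(x <- s0) B x <= \sum_(x <- s) B x.
  by rewrite (sum_subset B us0 us ss) lerDl sumr_ge0.
by rewrite ler_norml; apply/andP; split; lra.
Qed.

Lemma hasSum_exists f (C : R) : sumle (fun x => nc (f x)) C -> exists S, hasSum f S.
Proof.
move=> fC.
have real (g : T -> R) : (forall x, `|g x| <= nc (f x)) -> exists S, hasSum (fun x => (g x)%:C) S.
  move=> gf.
  have [||S1 h1] := @hasSum_ge0 (fun x => `|g x|) C.
  - by move=> x; exact: normr_ge0.
  - exact: sumle_le fC.
  have [||S2 h2] := @hasSum_ge0 (fun x => `|g x| - g x) (2 * C).
  - by move=> x; rewrite subr_ge0 ler_norm.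
  - apply: sumle_le (sumleZ _ fC) => // x; have := gf x; have := ler_norm (- g x); rewrite
    normrN; lra.
  exists (S1 - S2); have := hasSumB h1 h2; congr hasSum; apply/funext => x.
  by rewrite -rmorphB /= opprB addrC subrK.
have [S1 h1] := real _ (fun x => nc_Re (f x)).
have [S2 h2] := real _ (fun x => nc_Im (f x)).
exists (S1 + 'i%C * S2); have := hasSumD h1 (hasSumZ 'i%C h2); congr hasSum.
by apply/funext => x; rewrite -complexE.
Qed.

Lemma hasSum_tail f S B (e : R) s0 : hasSum f S -> (forall x, nc (f x) <= B x) ->
  uniq s0 ->
  (forall s, uniq s -> (forall x, x \in s -> x \notin s0) -> \sum_(x <- s) B x <= e) ->
  nc (S - \sum_(x <- s0) f x) <= e.
Proof.
move=> h fB us0 tail; apply/ler_addgt0Pr => d d0.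
have [s us sP] := h d d0; have [u [uu su s0u]] := seqU us us0.
have := sP u uu su; rewrite ncC (sum_subset f us0 uu s0u) => hd.
rewrite (_ : _ - S = (\sum_(x <- s0) f x + \sum_(x <- u | x \notin s0) f x - S) -
   \sum_(x <- u | x \notin s0) f x); last by ring.
apply: le_trans (ncB _ _) _; rewrite addrC lerD //.
apply: le_trans (nc_sum _ _ _) _; rewrite -big_filter.
apply: le_trans (tail [seq x <- u | x \notin s0] _ _).
- by apply: ler_sum => x _; exact: fB.
- exact: filter_uniq.
- by move=> x; rewrite mem_filter => /andP[].
Qed.

(** Dominated convergence: outside a finite set the majorant is small, on it the convergence is
uniform. *)
Lemma sumle_limit (I : Type) (U : set_system I) (FU : ProperFilter U)
   (F : I -> T -> R[i]) f B (SS : I -> R[i]) S (C : R) :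
  (forall x, 0 <= B x) -> sumle B C ->
  (forall i x, nc (F i x) <= B x) ->
  (forall x e, 0 < e -> U [set i | nc (F i x - f x) <= e]) ->
  (forall i, hasSum (F i) (SS i)) -> hasSum f S ->
  forall e, 0 < e -> U [set i | nc (SS i - S) <= e].
Proof.
move=> B0 BC FB Ff hF hf e e0.
have fB x : nc (f x) <= B x.
  apply/ler_addgt0Pr => d d0; have [i /=] := filter_ex (Ff x d d0).
  have := FB i x; have := ncBl (f x) (F i x); rewrite ncC; lra.
have e4 : 0 < e / 4 by rewrite divr_gt0.
have [s0 us0 tail] := sumle_tail B0 BC e4.
have d0 : 0 < e / (4 * (size s0).+1%:R) by rewrite divr_gt0 // mulr_gt0.
have fin : U [set i | forall x, x \in s0 -> nc (F i x - f x) <= e / (4 * (size s0).+1%:R)].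
  move: {tail us0} (e / _) d0 => d d0; elim: s0 => [|x s IH].
    by apply: filterS filterT.
  apply: filterS (filterI (Ff x d d0) IH) => i [h1 h2] y; rewrite inE => /orP[/eqP->//|].
  exact: h2.
apply: filterS fin => i /= hi.
have t1 := hasSum_tail (hF i) (FB i) us0 tail.
have t2 := hasSum_tail hf fB us0 tail.
rewrite (_ : SS i - S = (SS i - \sum_(x <- s0) F i x) - (S - \sum_(x <- s0) f x)
   + \sum_(x <- s0) (F i x - f x)); last by rewrite sumrB; ring.
apply: le_trans (ncD _ _) _.
have h3 : nc (\sum_(x <- s0) (F i x - f x)) <= e / 4.
  apply: le_trans (nc_sum _ _ _) _.
  apply: (@le_trans _ _ (\sum_(x <- s0) (e / (4 * (size s0).+1%:R)))).
    by rewrite big_seq [leRHS]big_seq; apply: ler_sum => x; exact: hi.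
  rewrite big_const_seq count_predT iter_addr_0 -[leLHS]mulr_natr.
  rewrite (_ : e / _ * _ = e / 4 * ((size s0)%:R / (size s0).+1%:R)); last first.
    by rewrite invfM; ring.
  rewrite ler_piMr ?(ltW e4) // ler_pdivrMr // mul1r ler_nat; exact: leqnSn.
have := ncB (SS i - \sum_(x <- s0) F i x) (S - \sum_(x <- s0) f x); lra.
Qed.

End OneType.

Lemma hasSum_reindex (T T' : choiceType) (h : T' -> T) (k : T -> T') f S :
  cancel h k -> cancel k h -> hasSum f S -> hasSum (fun x => f (h x)) S.
Proof.
move=> hk kh hf e e0; have [s us sP] := hf e e0.
exists (map k s); first by rewrite map_inj_uniq //; exact: can_inj kh.
move=> t ut st; rewrite -(big_map h xpredT f); apply: sP.
  by rewrite map_inj_uniq //; exact: can_inj hk.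
by move=> x xs; rewrite -(kh x) map_f // st // map_f.
Qed.

Lemma sumle_reindex (T T' : choiceType) (h : T' -> T) (B : T -> R) C :
  injective h -> sumle B C -> sumle (fun x => B (h x)) C.
Proof. by move=> hi h0 s us; rewrite -(big_map h xpredT B) h0 ?map_inj_uniq. Qed.

Lemma hasSum_sigma (T1 T2 : choiceType) (F : T1 * T2 -> R[i]) (g : T1 -> R[i]) S :
  hasSum F S -> (forall x, hasSum (fun y => F (x, y)) (g x)) -> hasSum g S.
Proof.
move=> hF hg e e0; have e2 : 0 < e / 2 by rewrite divr_gt0.
have [s0 us0 sP] := hF _ e2.
exists (undup (map fst s0)); first exact: undup_uniq.
move=> s us ss.
have d0 : 0 < e / (2 * (size s).+1%:R) by rewrite divr_gt0 // mulr_gt0.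
have [t [ut st tP]] : exists t, [/\ uniq t, {subset undup (map snd s0) <= t} &
    forall x, x \in s -> nc (\sum_(y <- t) F (x, y) - g x) <= e / (2 * (size s).+1%:R)].
  suff [t ut tP] : exists2 t, uniq t & forall x, x \in s -> forall t', uniq t' ->
      {subset t <= t'} -> nc (\sum_(y <- t') F (x, y) - g x) <= e / (2 * (size s).+1%:R).
    have [u [uu tu t0u]] := seqU ut (undup_uniq (map snd s0)).
    by exists u; split=> // x xs; exact: tP.
  move: {us ss} (e / _) d0 => d d0; elim: s => [|x s [t ut tP]]; first by exists [::].
  have [t1 ut1 t1P] := hg x d d0; have [u [uu tu t1u]] := seqU ut ut1.
  exists u => // y; rewrite inE => /orP[/eqP->|ys] t' ut' uut'.
    by apply: t1P => // z zt; apply/uut'/t1u.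
  by apply: tP => // z zt; apply/uut'/tu.
have := sP [seq (x, y) | x <- s, y <- t] _ _.
rewrite allpairs_uniq // => [/(_ isT)|[? ?] [? ?] //].
have sub : {subset s0 <= [seq (x, y) | x <- s, y <- t]}.
  move=> [x y] xy; apply/allpairsP; exists (x, y); split => //=.
    by apply: ss; rewrite mem_undup; apply/mapP; exists (x, y).
  by apply: st; rewrite mem_undup; apply/mapP; exists (x, y).
move=> /(_ sub); rewrite big_allpairs /= => h.
rewrite (_ : _ - S = (\sum_(x <- s) \sum_(y <- t) F (x, y) - S) -
   \sum_(x <- s) (\sum_(y <- t) F (x, y) - g x)); last by rewrite sumrB; ring.
apply: le_trans (ncB _ _) _.
have : nc (\sum_(x <- s) (\sum_(y <- t) F (x, y) - g x)) <= e / 2.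
  apply: le_trans (nc_sum _ _ _) _.
  apply: (@le_trans _ _ (\sum_(x <- s) (e / (2 * (size s).+1%:R)))).
    by rewrite big_seq [leRHS]big_seq; apply: ler_sum => x; exact: tP.
  rewrite big_const_seq count_predT iter_addr_0 -[leLHS]mulr_natr.
  rewrite (_ : e / _ * _ = e / 2 * ((size s)%:R / (size s).+1%:R)); last first.
    by rewrite invfM; ring.
  rewrite ler_piMr ?(ltW e2) // ler_pdivrMr // mul1r ler_nat; exact: leqnSn.
by lra.
Qed.

Lemma sumle_prod (T1 T2 : choiceType) (B1 : T1 -> R) (B2 : T2 -> R) C1 C2 :
  (forall x, 0 <= B1 x) -> (forall x, 0 <= B2 x) -> sumle B1 C1 -> sumle B2 C2 ->
  sumle (fun x : T1 * T2 => B1 x.1 * B2 x.2) (C1 * C2).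
Proof.
move=> B10 B20 h1 h2 s us.
pose t := [seq (x, y) | x <- undup (map fst s), y <- undup (map snd s)].
have ut : uniq t by apply: allpairs_uniq; rewrite ?undup_uniq // => -[? ?] [? ?].
have st : {subset s <= t}.
  move=> [x y] xy; apply/allpairsP; exists (x, y); split => //=.
    by rewrite mem_undup; apply/mapP; exists (x, y).
  by rewrite mem_undup; apply/mapP; exists (x, y).
apply: (@le_trans _ _ (\sum_(x <- t) B1 x.1 * B2 x.2)).
  rewrite (sum_subset (fun x : T1 * T2 => B1 x.1 * B2 x.2) us ut st) lerDl.
  by rewrite sumr_ge0 // => x _; rewrite mulr_ge0.
rewrite big_allpairs /=; under eq_bigr do rewrite -mulr_sumr.
rewrite -mulr_suml ler_pM ?sumr_ge0 // => *; [exact: h1 (undup_uniq _)|exact: h2 (undup_uniq _)].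
Qed.

(** The Japanese bracket, in the variant that is polynomial in [`|p|]. *)
Definition wt (p : int) : R := 1 + `|p|%:~R.

Lemma wt_ge1 p : 1 <= wt p.
Proof. by rewrite /wt lerDl ler0z. Qed.

Lemma wt_gt0 p : 0 < wt p. Proof. exact: lt_le_trans (wt_ge1 p). Qed.

Lemma wtN p : wt (- p) = wt p.
Proof. by rewrite /wt normrN. Qed.

Lemma wtD p q : wt (p + q) <= wt p * wt q.
Proof.
rewrite /wt; have : `|p + q|%:~R <= `|p|%:~R + `|q|%:~R :> R.
  by rewrite -intrD ler_int ler_normD.
have : 0 <= `|p|%:~R :> R by rewrite ler0z.
have : 0 <= `|q|%:~R :> R by rewrite ler0z.
by nra.
Qed.

Lemma sumle_wt : sumle (fun p : int => (wt p ^+ 2)^-1) 4.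
Proof.
have hn (n : nat) : \sum_(i < n) ((1 + i%:R) ^+ 2)^-1 <= 2 - 2 / (1 + n%:R) :> R.
  elim: n => [|n IH]; first by rewrite big_ord0 addr0; lra.
  rewrite big_ord_recr /=; apply: le_trans (lerD IH (lexx _)) _.
  have n0 : 0 <= n%:R :> R by exact: ler0n.
  rewrite -natr1.
  rewrite -lerBrDl (_ : 2 - _ - _ = (2^-1 * (1 + n%:R) * (1 + (n%:R + 1)))^-1).
    by rewrite lef_pV2 ?posrE; nra.
  by field; apply/andP; split; apply/eqP; lra.
have hs (s : seq nat) : uniq s -> \sum_(i <- s) ((1 + i%:R) ^+ 2)^-1 <= 2 :> R.
  move=> us; pose n := (\max_(i <- s) i).+1.
  have sn : {subset s <= iota 0 n}.
    by move=> i si; rewrite mem_iota /= add0n ltnS; exact: (@leq_bigmax_seq _ _ _ id).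
  apply: (@le_trans _ _ (\sum_(i <- iota 0 n) ((1 + i%:R) ^+ 2)^-1)).
    rewrite (sum_subset (fun i : nat => ((1 + i%:R) ^+ 2)^-1 : R) us (iota_uniq _ _) sn) lerDl.
    by rewrite sumr_ge0 // => x _; rewrite invr_ge0 sqr_ge0.
  have := hn n; rewrite -(big_mkord xpredT (fun i : nat => ((1 + i%:R) ^+ 2)^-1 : R)).
  rewrite /index_iota subn0 => /le_trans; apply; rewrite lerBlDl lerDr.
  by rewrite divr_ge0 // addr_ge0.
move=> s us; rewrite (bigID (fun p => 0 <= p)) /= (_ : 4 = 2 + 2 :> R); last by lra.
have F (P : pred int) : {in P &, injective absz} ->
    \sum_(p <- s | P p) (wt p ^+ 2)^-1 <= 2.
  move=> inj; rewrite -big_filter.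
  rewrite (eq_bigr (fun p => ((1 + (absz p)%:R) ^+ 2)^-1)); last first.
    by move=> p _; rewrite /wt -abszE.
  rewrite -(big_map absz xpredT (fun i : nat => ((1 + i%:R) ^+ 2)^-1 : R)); apply: hs.
  rewrite map_inj_in_uniq ?filter_uniq // => x y.
  by rewrite !mem_filter => /andP[Px _] /andP[Py _]; exact: inj.
by apply: lerD; apply: F => x y; rewrite ?inE; lia.
Qed.

End UnconditionalSums.

(** * Limits along an ultrafilter *)

Section UltraLimits.
Context {R : realType}.

(** Along an ultrafilter every bounded sequence converges, which replaces the extraction of a
diagonal subsequence for countably many Fourier coefficients. *)
Definition ucvg (U : set_system nat) (u : nat -> R[i]) (l : R[i]) :=
  forall e : R, 0 < e -> U [set n | nc (u n - l) <= e].

Lemma ultra_exists : exists2 U : set_system nat, UltraFilter U &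
  forall m : nat, U [set n | (m <= n)%N].
Proof.
have [U [UU sub]] := @ultraFilterLemma nat \oo _.
by exists U => // m; apply: sub; exists m.
Qed.

Variables (U : set_system nat) (UU : UltraFilter U).
Hypothesis Uoo : forall m : nat, U [set n | (m <= n)%N].
Implicit Types (u v : nat -> R[i]) (l : R[i]).

(** The limit is the supremum of the numbers that the sequence exceeds on a set of the
ultrafilter. *)
Lemma ultra_lim_real (u : nat -> R) (C : R) : (forall n, `|u n| <= C) ->
  exists l : R, forall e, 0 < e -> U [set n | `|u n - l| <= e].
Proof.
move=> uC; pose S := [set x : R | U [set n | x <= u n]].
have bnd n : - C <= u n <= C by rewrite -ler_norml.
have SC : S (- C) by apply: filterS filterT => n _ /=; case/andP: (bnd n).
have supS : has_sup S.
  split; first by exists (- C).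
  exists C => x Sx; have [n /= xn] := filter_ex Sx.
  by apply: le_trans xn _; case/andP: (bnd n).
exists (sup S) => e e0.
have [x Sx xs] := sup_adherent e0 supS.
have nS : ~ S (sup S + e).
  by move=> h; have := ub_le_sup supS.2 h; lra.
have [//|h] := in_ultra_setVsetC [set n | sup S + e <= u n] UU.
apply: filterS (filterI Sx h) => n /= [h1 /negP]; rewrite -ltNge => h2.
by rewrite ler_norml; apply/andP; split; lra.
Qed.

Lemma ultra_lim u (C : R) : (forall n, nc (u n) <= C) -> exists l, ucvg U u l.
Proof.
move=> uC.
have [a aP] := @ultra_lim_real (fun n => re (u n)) C (fun n => le_trans (nc_Re _) (uC n)).
have [b bP] := @ultra_lim_real (fun n => im (u n)) C (fun n => le_trans (nc_Im _) (uC n)).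
exists (a +i* b) => e e0; have e2 : 0 < e / 2 by rewrite divr_gt0.
apply: filterS (filterI (aP _ e2) (bP _ e2)) => n /= [h1 h2].
apply: le_trans (nc_ReIm _) _; rewrite cReD cImD /=; lra.
Qed.

Lemma ucvg_unique u l l' : ucvg U u l -> ucvg U u l' -> l = l'.
Proof.
move=> h h'; apply/eqP; rewrite -subr_eq0 -nc_eq0 eq_le nc_ge0 andbT.
apply/ler_addgt0Pr => e e0; rewrite add0r.
have e2 : 0 < e / 2 by rewrite divr_gt0.
have [n /= [a b]] := filter_ex (filterI (h _ e2) (h' _ e2)).
rewrite (_ : l - l' = (u n - l') - (u n - l)); last by ring.
by apply: le_trans (ncB _ _) _; lra.
Qed.

Lemma ucvg_cst l : ucvg U (fun=> l) l.
Proof. by move=> e e0; apply: filterS filterT => n _ /=; rewrite subrr nc0 ltW. Qed.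

Lemma ucvgD u v l l' : ucvg U u l -> ucvg U v l' -> ucvg U (fun n => u n + v n) (l + l').
Proof.
move=> h h' e e0; have e2 : 0 < e / 2 by rewrite divr_gt0.
apply: filterS (filterI (h _ e2) (h' _ e2)) => n /= [h1 h2].
by rewrite opprD addrACA; apply: le_trans (ncD _ _) _; lra.
Qed.

Lemma ucvgM u v l l' : ucvg U u l -> ucvg U v l' -> ucvg U (fun n => u n * v n) (l * l').
Proof.
move=> h h' e e0.
have a0 := nc_ge0 l; have b0 := nc_ge0 l'.
pose d := Num.min 1 (e / (nc l + nc l' + 1)).
have s0 : 0 < nc l + nc l' + 1 by lra.
have d0 : 0 < d by rewrite /d lt_min ltr01 divr_gt0.
have d1 : d <= 1 by rewrite /d ge_min lexx.
have de : d * (nc l + nc l' + 1) <= e by rewrite -ler_pdivlMr // /d ge_min lexx orbT.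
apply: filterS (filterI (h _ d0) (h' _ d0)) => n /= [h1 h2].
rewrite (_ : u n * v n - l * l' = (u n - l) * (v n - l') + (u n - l) * l' + l * (v n - l')); last
  by ring.
apply: le_trans (ncD _ _) _; apply: le_trans (lerD (ncD _ _) (lexx _)) _; rewrite !ncM.
have := nc_ge0 (u n - l); have := nc_ge0 (v n - l'); nra.
Qed.

Lemma ucvg_near u v l : U [set n | u n = v n] -> ucvg U u l -> ucvg U v l.
Proof. by move=> uv h e e0; apply: filterS (filterI uv (h e e0)) => n /= [->]. Qed.

Lemma ucvg_rate u l (C : R) : U [set n | nc (u n - l) <= C / n.+1%:R] -> ucvg U u l.
Proof.
move=> h e e0; apply: filterS (filterI h (Uoo (Num.bound `|C / e|))) => n /= [h1 mn].
apply: le_trans h1 _; rewrite ler_pdivrMr // mulrC -ler_pdivrMr //.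
apply: le_trans (ler_norm _) _; apply/ltW.
apply: lt_le_trans (archi_boundP (normr_ge0 _)) _.
by rewrite ler_nat (leq_trans mn).
Qed.

Lemma ucvg_bound u l (C : R) : U [set n | nc (u n) <= C] -> ucvg U u l -> nc l <= C.
Proof.
move=> uC h; apply/ler_addgt0Pr => d d0; have [n /= [h1 h2]] := filter_ex (filterI uC (h d d0)).
have := ncBl l (u n); rewrite ncC; lra.
Qed.

End UltraLimits.

Section SmoothDifferences.
Context {R : realType}.
Implicit Types (f g : R * R -> R) (p : R * R) (h s t : R).

Definition per2 f := forall s t, f (s + 1, t) = f (s, t) /\ f (s, t + 1) = f (s, t).

Definition D1 f p := 'D_(1, 0) f p.
Definition D2 f p := 'D_(0, 1) f p.

Definition smooth2 f := Cinfty2 f /\ per2 f.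

Lemma per2_D f v : per2 f -> per2 (fun p => 'D_v f p).
Proof.
move=> pf s t.
have E (w : R * R) : (forall p, f (w + p) = f p) -> forall p, 'D_v f (w + p) = 'D_v f p.
  move=> fw p; rewrite /derive.
  rewrite (_ : (fun h : R => h^-1 *: ((f \o shift (w + p)) (h *: v) - f (w + p))) =
    (fun h => h^-1 *: ((f \o shift p) (h *: v) - f p))) //.
  by apply/funext => x /=; rewrite addrCA !fw.
have e1 a b : (a + 1, b) = (1, 0) + (a, b) :> R * R.
  by apply: injective_projections => /=; rewrite ?add0r // addrC.
have e2 a b : (a, b + 1) = (0, 1) + (a, b) :> R * R.
  by apply: injective_projections => /=; rewrite ?add0r // addrC.
split; rewrite ?e1 ?e2; apply: E => -[a b]; rewrite -?e1 -?e2; exact: (pf _ _).1 || exact: (pf _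
  _).2.
Qed.

Lemma smooth2_D1 f : smooth2 f -> smooth2 (D1 f).
Proof. by move=> [fs fp]; split; [move=> n; have [_ [_ [_ []]]] := fs n.+1|exact: per2_D]. Qed.

Lemma smooth2_D2 f : smooth2 f -> smooth2 (D2 f).
Proof. by move=> [fs fp]; split; [move=> n; have [_ [_ [_ []]]] := fs n.+1|exact: per2_D]. Qed.

Lemma is_derive_D1 f s t : smooth2 f -> is_derive s 1 (fun s => f (s, t)) (D1 f (s, t)).
Proof.
move=> [fs _]; have [_ [d1 _]] := fs 1%N.
have E : (fun h : R => h^-1 *: (((fun s => f (s, t)) \o shift s) (h *: 1) - f (s, t))) =
   (fun h => h^-1 *: ((f \o shift (s, t)) (h *: (1, 0)) - f (s, t))).
  apply/funext => h /=; congr (_ *: (f _ - _)).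
  by apply: injective_projections => /=; rewrite ?scaler0 ?add0r.
by apply: DeriveDef; rewrite /derivable /derive E //; exact: d1.
Qed.

Lemma is_derive_D2 f s t : smooth2 f -> is_derive t 1 (fun t => f (s, t)) (D2 f (s, t)).
Proof.
move=> [fs _]; have [_ [_ [d2 _]]] := fs 1%N.
have E : (fun h : R => h^-1 *: (((fun t => f (s, t)) \o shift t) (h *: 1) - f (s, t))) =
   (fun h => h^-1 *: ((f \o shift (s, t)) (h *: (0, 1)) - f (s, t))).
  apply/funext => h /=; congr (_ *: (f _ - _)).
  by apply: injective_projections => /=; rewrite ?scaler0 ?add0r.
by apply: DeriveDef; rewrite /derivable /derive E //; exact: d2.
Qed.

Lemma per2_int f (m n : int) s t : per2 f -> f (s + m%:~R, t + n%:~R) = f (s, t).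
Proof.
move=> pf.
have h1 (k : int) a b : f (a + k%:~R, b) = f (a, b).
  elim/int_ind: k => [|k|k]; first by rewrite addr0.
  - by rewrite -[in X in _ -> X]addn1 PoszD intrD addrA (pf _ _).1.
  - by move=> <-; rewrite -(pf _ _).1 -addrA -intrD1; congr (f (_ + _%:~R, _)); lia.
have h2 (k : int) a b : f (a, b + k%:~R) = f (a, b).
  elim/int_ind: k => [|k|k]; first by rewrite addr0.
  - by rewrite -[in X in _ -> X]addn1 PoszD intrD addrA (pf _ _).2.
  - by move=> <-; rewrite -(pf _ _).2 -addrA -intrD1; congr (f (_, _ + _%:~R)); lia.
by rewrite h1 h2.
Qed.

Lemma smooth2_bounded f : smooth2 f -> exists2 C, 0 <= C & forall p, `|f p| <= C.
Proof.
move=> [fs pf]; have [cf _] := fs 0%N.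
have cK : compact (`[0 : R, 1] `*` `[0 : R, 1]).
  by apply: compact_setX; exact: segment_compact.
have : bounded_set (f @` (`[0 : R, 1] `*` `[0 : R, 1])).
  apply: compact_bounded; apply: continuous_compact cK.
  exact: continuous_subspaceT.
move=> [M [_ fM]]; have MM : M < `|M| + 1 by have := ler_norm M; lra.
exists (`|M| + 1) => [|[s t]]; first by have := normr_ge0 M; lra.
have F (x : R) : 0 <= x - (Num.floor x)%:~R <= 1.
  have /andP[fl fu] := real_floor_itv (num_real x).
  by rewrite subr_ge0 fl lerBlDr addrC -[1]/(1%:~R) -intrD ltW.
have -> : f (s, t) = f (s - (Num.floor s)%:~R, t - (Num.floor t)%:~R).
  by rewrite -!rmorphN per2_int.
apply: (fM _ MM); exists (s - (Num.floor s)%:~R, t - (Num.floor t)%:~R) => //.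
by split; rewrite /= in_itv /= F.
Qed.

Definition df1 h f p := f (p.1 + h, p.2) - f p.
Definition df2 h f p := f (p.1, p.2 + h) - f p.

Definition mixdiff h k l f := iter k (df1 h) (iter l (df2 h) f).

Lemma is_derive_mixdiff1 h k l f s t : smooth2 f ->
  is_derive s 1 (fun s => mixdiff h k l f (s, t)) (mixdiff h k l (D1 f) (s, t)).
Proof.
move=> sf; elim: k s t => [|k IH] s t.
  elim: l s t => [|l IH] s t; first exact: is_derive_D1.
  exact: is_deriveB (IH s (t + h)) (IH s t).
have hs : is_derive s 1 (fun s => s + h) 1 by apply: is_derive_eq; rewrite addr0.
have := is_derive1_comp (f := fun s => mixdiff h k l f (s, t)) (g := fun s => s + h) (IH (s + h)
  t) hs.
by rewrite mulr1 => h1; exact: is_deriveB h1 (IH s t).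
Qed.

Lemma is_derive_mixdiff2 h l f s t : smooth2 f ->
  is_derive t 1 (fun t => mixdiff h 0 l f (s, t)) (mixdiff h 0 l (D2 f) (s, t)).
Proof.
move=> sf; elim: l s t => [|l IH] s t; first exact: is_derive_D2.
have ht : is_derive t 1 (fun t => t + h) 1 by apply: is_derive_eq; rewrite addr0.
have := is_derive1_comp (f := fun t => mixdiff h 0 l f (s, t)) (g := fun t => t + h) (IH s (t +
  h)) ht.
by rewrite mulr1 => h1; exact: is_deriveB h1 (IH s t).
Qed.

(** By the mean value theorem each difference costs one derivative and gains one factor [h]. *)
Lemma mixdiff_bound k l f : smooth2 f ->
  exists2 C, 0 <= C & forall h p, 0 <= h -> `|mixdiff h k l f p| <= C * h ^+ (k + l).
Proof.
elim: k f => [|k IH] f sf.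
  elim: l f sf => [|l IH] f sf.
    have [C C0 fC] := smooth2_bounded sf; exists C => // h p _.
    by rewrite expr0 mulr1; exact: fC.
  have [C C0 fC] := IH _ (smooth2_D2 sf); exists C => // h [s t] h0.
  have [||c _] := @mean_value R (fun t => mixdiff h 0 l f (s, t)) (fun t => mixdiff h 0 l (D2 f)
    (s, t)) t (t + h).
  - by rewrite lerDl.
  - by move=> x _; exact: is_derive_mixdiff2.
  rewrite addrAC subrr add0r /mixdiff /= /df2 /= => ->.
  by rewrite normrM (ger0_norm h0) exprSr mulrA ler_wpM2r //; exact: fC.
have [C C0 fC] := IH _ (smooth2_D1 sf); exists C => // h [s t] h0.
have [||c _] := @mean_value R (fun s => mixdiff h k l f (s, t)) (fun s => mixdiff h k l (D1 f)
  (s, t)) s (s + h).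
- by rewrite lerDl.
- by move=> x _; exact: is_derive_mixdiff1.
rewrite addrAC subrr add0r /mixdiff /= /df1 /= => ->.
by rewrite normrM (ger0_norm h0) exprSr mulrA ler_wpM2r //; exact: fC.
Qed.

End SmoothDifferences.

(** * Fourier series of smooth periodic functions *)

Section FourierSeries.
Context {R : realType}.

Section DftDecay.
Variables (N : nat) (N0 : (0 < N)%N).
Implicit Types (f : int -> R[i]) (g : int -> int -> R[i]) (m p q : int).

Let NR : (N%:R : R) != 0. Proof. by rewrite pnatr_eq0 -lt0n. Qed.

Lemma dftB f f' m : dft N (fun j => f j - f' j) m = dft N f m - dft N f' m.
Proof.
rewrite /dft -mulrBr /psum -sumrB; congr (_ * _); apply: eq_bigr => i _.
by rewrite mulrBl.
Qed.

Lemma Nper_mulcis f (i : int) : Nper N f -> Nper N (fun m => f m * cis (m%:~R * i%:~R / N%:R)).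
Proof. by move=> pf m; rewrite pf ![_ * i%:~R]mulrC; congr (_ * _); exact: Nper_cis. Qed.

Lemma dft_shift f m : Nper N f ->
  dft N (fun j => f (j + 1)) m = cis (m%:~R / N%:R) * dft N f m.
Proof.
move=> pf; rewrite /dft mulrCA; congr (_ * _).
pose F j := f j * cis (- (m%:~R * j%:~R / N%:R)).
have pF : Nper N F.
  by move=> j; rewrite /F pf !cisN; congr (_ * cj _); exact: Nper_cis.
rewrite -[psum N F](psum_shift N0 1) //= -psumZ; apply: eq_bigr => i _.
rewrite /F mulrCA -cisD; congr (_ * cis _); rewrite rmorphD /=; field.
exact: NR.
Qed.

Lemma dft_le f m (C : R) : (forall j, nc (f j) <= C) -> nc (dft N f m) <= C.
Proof.
move=> fC; rewrite /dft ncM ncV -[N%:R]/((N%:R : R[i])) -(rmorph_nat (real_complex R)) nc_real.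
rewrite ger0_norm ?ler0n // mulrC ler_pdivrMr ?ltr0n //.
apply: le_trans (nc_sum _ _ _) _.
apply: (@le_trans _ _ (\sum_(i < N) C)).
  by apply: ler_sum => i _; rewrite ncM nc_cis mulr1.
by rewrite sumr_const card_ord mulr_natr.
Qed.

Definition dft2 g p q := dft N (fun i => dft N (g i) q) p.

Definition Nper2 g := (forall j, Nper N (g^~ j)) /\ (forall i, Nper N (g i)).

Lemma dft2_diff1 g p q : Nper2 g ->
  dft2 (fun i j => g (i + 1) j - g i j) p q = (cis (p%:~R / N%:R) - 1) * dft2 g p q.
Proof.
move=> [g1 g2]; rewrite /dft2 mulrBl mul1r -dft_shift.
  by rewrite -dftB; congr dft; apply/funext => i; rewrite dftB.
by move=> i; congr dft; apply/funext => j; exact: g1.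
Qed.

Lemma dft2_diff2 g p q : Nper2 g ->
  dft2 (fun i j => g i (j + 1) - g i j) p q = (cis (q%:~R / N%:R) - 1) * dft2 g p q.
Proof.
move=> [g1 g2]; rewrite /dft2 [in RHS]/dft mulrCA; congr (_ * _); rewrite -psumZ.
apply: eq_bigr => i _; rewrite mulrA; congr (_ * _).
by rewrite dftB dft_shift // mulrBl mul1r.
Qed.

Lemma dft2_le g p q (C : R) : (forall i j, nc (g i j) <= C) -> nc (dft2 g p q) <= C.
Proof. by move=> gC; apply: dft_le => i; apply: dft_le. Qed.

End DftDecay.

Lemma per2_df1 (h : R) f : per2 f -> per2 (df1 h f).
Proof. by move=> pf s t; rewrite /df1 /= addrAC !(pf _ _).1 !(pf _ _).2. Qed.

Lemma per2_df2 (h : R) f : per2 f -> per2 (df2 h f).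
Proof. by move=> pf s t; rewrite /df2 /= !(pf _ _).1 addrAC !(pf _ _).2. Qed.

Lemma per2_mixdiff (h : R) k l f : per2 f -> per2 (mixdiff h k l f).
Proof.
move=> pf; elim: k => [|k IH]; last exact: per2_df1.
by elim: l => [//|l IH]; exact: per2_df2.
Qed.

(** Rapid decay, the Fourier side of smoothness. *)
Definition rapid2 (a : int * int -> R[i]) := forall k, exists2 C, 0 <= C &
  forall x, nc (a x) <= C / (wt x.1 * wt x.2) ^+ k.

Section Expansion.
Variable A : R -> R -> R[i].
Hypothesis hA : smooth_periodic2 A.

Let fr (p : R * R) : R := re (A p.1 p.2).
Let fi (p : R * R) : R := im (A p.1 p.2).

Let sr : smooth2 fr.
Proof. by case: hA => [h1 h2 h3 h4]; split => // s t; rewrite /fr /= h3 h4. Qed.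
Let si : smooth2 fi.
Proof. by case: hA => [h1 h2 h3 h4]; split => // s t; rewrite /fi /= h3 h4. Qed.

Let G (N k l : nat) (i j : int) : R[i] :=
  mixdiff (N%:R^-1) k l fr (i%:~R / N%:R, j%:~R / N%:R) +i*
  mixdiff (N%:R^-1) k l fi (i%:~R / N%:R, j%:~R / N%:R).

Let G0E N i j : G N 0 0 i j = A (i%:~R / N%:R) (j%:~R / N%:R).
Proof. by rewrite /G /mixdiff /= /fr /fi /=; case: (A _ _). Qed.

Let G_per N k l : (0 < N)%N -> Nper2 N (G N k l).
Proof.
move=> N0; have NR : (N%:R : R) != 0 by rewrite pnatr_eq0 -lt0n.
have e (i : int) : (i + N%:Z)%:~R / N%:R = i%:~R / N%:R + 1 :> R.
  by rewrite rmorphD /= mulrDl divff.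
split=> [j i|i j]; rewrite /G e; congr (_ +i* _).
- exact: (per2_mixdiff _ _ _ sr.2 _ _).1.
- exact: (per2_mixdiff _ _ _ si.2 _ _).1.
- exact: (per2_mixdiff _ _ _ sr.2 _ _).2.
- exact: (per2_mixdiff _ _ _ si.2 _ _).2.
Qed.

Let dft2_G N k l p q : (0 < N)%N -> dft2 N (G N k l) p q =
  (cis (p%:~R / N%:R) - 1) ^+ k * (cis (q%:~R / N%:R) - 1) ^+ l * dft2 N (G N 0 0) p q.
Proof.
move=> N0; elim: k => [|k IH].
  elim: l => [|l IH]; first by rewrite !expr0 !mul1r.
  rewrite exprS -!mulrA mulrCA [X in _ * X]mulrA -IH -dft2_diff2 //; last exact: G_per.
  congr dft2; apply/funext => i; apply/funext => j.
  rewrite /G /mixdiff /= /df2 /= rmorphD /= [(_ + 1) / _]mulrDl mul1r.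
  by simpc.
rewrite exprS -!mulrA [X in _ * X]mulrA -IH -dft2_diff1 //; last exact: G_per.
congr dft2; apply/funext => i; apply/funext => j.
rewrite /G /mixdiff /= /df1 /= rmorphD /= [(_ + 1) / _]mulrDl mul1r.
by simpc.
Qed.

Let G_bound k l : exists2 C : R, 0 <= C &
  forall N i j, nc (G N k l i j) <= C * (N%:R^-1) ^+ (k + l).
Proof.
have [C1 C10 h1] := mixdiff_bound k l sr; have [C2 C20 h2] := mixdiff_bound k l si.
exists (C1 + C2) => [|N i j]; first exact: addr_ge0.
apply: le_trans (nc_ReIm _) _; rewrite mulrDl /=.
by rewrite lerD ?h1 ?h2 ?invr_ge0.
Qed.

(** Summation by parts: differences of the sampled function are small, and on the window each
of them multiplies the coefficient by at least [2 * `|p|] divided by [N]. *)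
Let decay_kl k l : exists2 C : R, 0 <= C & forall N p q, (0 < N)%N ->
  2 * `|p| <= N%:Z -> 2 * `|q| <= N%:Z ->
  (2 * `|p|%:~R) ^+ k * (2 * `|q|%:~R) ^+ l * nc (dft2 N (G N 0 0) p q) <= C.
Proof.
have [C C0 hC] := G_bound k l; exists C => // N p q N0 pN qN.
have NR : 0 < N%:R :> R by rewrite ltr0n.
have low (m : int) : 2 * `|m| <= N%:Z -> 2 * `|m|%:~R / N%:R <= nc (cis (m%:~R / N%:R : R) - 1).
  move=> mN; have E : `|m%:~R / N%:R| = `|m|%:~R / N%:R :> R.
    by rewrite intr_norm normrM normfV [`|N%:R|]ger0_norm ?ler0n.
  rewrite -mulrA -E nc_cis_sub1_ge // E ler_pdivrMr // mulrC ler_pdivlMr //.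
  by rewrite mulrC -[N%:R]/(N%:Z%:~R) -[2]/(2%:~R) -intrM ler_int.
have := dft2_le N0 p q (fun i j => hC N i j); rewrite dft2_G //.
move: (dft2 _ _ _ _) => d; rewrite !ncM !ncX.
have k1 : (2 * `|p|%:~R / N%:R) ^+ k <= nc (cis (p%:~R / N%:R : R) - 1) ^+ k.
  by rewrite lerXn2r ?nnegrE ?nc_ge0 ?low ?mulr_ge0 ?invr_ge0 ?ler0z.
have l1 : (2 * `|q|%:~R / N%:R) ^+ l <= nc (cis (q%:~R / N%:R : R) - 1) ^+ l.
  by rewrite lerXn2r ?nnegrE ?nc_ge0 ?low ?mulr_ge0 ?invr_ge0 ?ler0z.
move=> h; have {h} := le_trans (ler_wpM2r (nc_ge0 _) (ler_pM _ _ k1 l1)) h.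
move=> /(_ _ _); rewrite !exprMn exprD => h.
have Nk : 0 < N%:R^-1 ^+ k :> R by rewrite exprn_gt0 ?invr_gt0.
have Nl : 0 < N%:R^-1 ^+ l :> R by rewrite exprn_gt0 ?invr_gt0.
rewrite -(ler_pM2r (mulr_gt0 Nk Nl)); apply: le_trans (h _ _).
- by rewrite le_eqVlt; apply/orP; left; apply/eqP; ring.
- by rewrite !mulr_ge0 ?exprn_ge0 ?invr_ge0 ?ler0z.
- by rewrite !mulr_ge0 ?exprn_ge0 ?invr_ge0 ?ler0z.
Qed.

Let decay k : exists2 C : R, 0 <= C & forall N p q, (0 < N)%N ->
  2 * `|p| <= N%:Z -> 2 * `|q| <= N%:Z ->
  nc (dft2 N (G N 0 0) p q) <= C / (wt p * wt q) ^+ k.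
Proof.
have [C1 C10 h1] := decay_kl k k; have [C2 C20 h2] := decay_kl 0 k.
have [C3 C30 h3] := decay_kl k 0; have [C4 C40 h4] := decay_kl 0 0.
exists (C1 + C2 + C3 + C4) => [|N p q N0 pN qN]; first by rewrite !addr_ge0.
have w0 (m : int) : 0 < wt m ^+ k :> R by rewrite exprn_gt0 ?wt_gt0.
rewrite ler_pdivlMr ?exprMn ?mulr_gt0 // mulrC.
have wtm (m : int) : m != 0 -> wt m ^+ k <= (2 * `|m|%:~R) ^+ k :> R.
  move=> m0; rewrite lerXn2r ?nnegrE ?mulr_ge0 ?ler0z ?(ltW (wt_gt0 _)) // /wt.
  have : 1 <= `|m|%:~R :> R by rewrite -[1]/(1%:~R) ler_int; lia.
  by lra.
have wt00 : wt 0 ^+ k = 1 :> R by rewrite /wt normr0 addr0 expr1n.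
have d0 := nc_ge0 (dft2 N (G N 0 0) p q).
have {}h1 := h1 N p q N0 pN qN; have {}h2 := h2 N p q N0 pN qN.
have {}h3 := h3 N p q N0 pN qN; have {}h4 := h4 N p q N0 pN qN.
rewrite !expr0 ?mul1r ?mulr1 in h2 h3 h4.
have [pE|p0] := eqVneq p 0; have [qE|q0] := eqVneq q 0.
- have -> : wt p ^+ k = 1 :> R by rewrite pE wt00.
  have -> : wt q ^+ k = 1 :> R by rewrite qE wt00.
  lra.
- have -> : wt p ^+ k = 1 :> R by rewrite pE wt00.
  have := ler_wpM2r d0 (wtm _ q0); lra.
- have -> : wt q ^+ k = 1 :> R by rewrite qE wt00.
  have := ler_wpM2r d0 (wtm _ p0); lra.
- have := ler_wpM2r d0 (ler_pM (ltW (w0 p)) (ltW (w0 q)) (wtm _ p0) (wtm _ q0)); lra.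
Qed.

Lemma smooth_lipschitz : exists2 C : R, 0 <= C & forall s t h h' : R, 0 <= h -> 0 <= h' ->
  nc (A (s + h) (t + h') - A s t) <= C * (h + h').
Proof.
have [C1 C10 h1] := mixdiff_bound 1 0 sr; have [C2 C20 h2] := mixdiff_bound 1 0 si.
have [C3 C30 h3] := mixdiff_bound 0 1 sr; have [C4 C40 h4] := mixdiff_bound 0 1 si.
exists (C1 + C2 + C3 + C4) => [|s t h h' h0 h'0]; first by rewrite !addr_ge0.
rewrite (_ : A _ _ - _ = (A (s + h) (t + h') - A s (t + h')) + (A s (t + h') - A s t)); last by
  ring.
apply: le_trans (ncD _ _) _.
have a := nc_ReIm (A (s + h) (t + h') - A s (t + h')).
have b := nc_ReIm (A s (t + h') - A s t).
rewrite !cReD !cReN !cImD !cImN in a b.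
have := h1 h (s, t + h') h0; have := h2 h (s, t + h') h0.
have := h3 h' (s, t) h'0; have := h4 h' (s, t) h'0.
rewrite /mixdiff /= /df1 /df2 /fr /fi /= !expr1; nra.
Qed.

Let center (N : nat) (i : 'I_N) : int := i%:Z - (N./2)%:Z.

Let centered (N : nat) : seq (int * int) :=
  [seq (i, j) | i <- map (@center N) (enum 'I_N), j <- map (@center N) (enum 'I_N)].

Let centered_uniq N : uniq (centered N).
Proof.
have inj : injective (@center N) by move=> i j /addIr [] /val_inj.
have uC : uniq (map (@center N) (enum 'I_N)) by rewrite (map_inj_uniq inj) enum_uniq.
by apply: allpairs_uniq => // -[a b] [c d].
Qed.

Let centered_bound N x : x \in centered N -> 2 * `|x.1| <= N%:Z /\ 2 * `|x.2| <= N%:Z.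
Proof.
move=> /allpairsP[[_ _] /= [/mapP[i _ ->] /mapP[j _ ->] ->]] /=; rewrite /center.
by have := ltn_ord i; have := ltn_ord j; lia.
Qed.

Let inversion N i j : (0 < N)%N ->
  \sum_(x <- centered N) dft2 N (G N 0 0) x.1 x.2 *
     cis (x.1%:~R * (i%:~R / N%:R)) * cis (x.2%:~R * (j%:~R / N%:R)) =
  A (i%:~R / N%:R) (j%:~R / N%:R).
Proof.
move=> N0; have [G1 G2] := @G_per N 0 0 N0.
rewrite big_allpairs big_map /= -G0E -(dftK N0 i (G1 j)).
rewrite -(@psum_shift _ N N0 _ (- (N./2)%:Z)); last exact/Nper_mulcis/Nper_dft.
rewrite /psum big_enum; apply: eq_bigr => k _.
rewrite /dft2 -[_ - _]/(center k).
transitivity (dft N (fun i => psum N (fun m => dft N (G N 0 0 i) m * cis (m%:~R * j%:~R / N%:R)))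
  (center k)
    * cis ((center k)%:~R * i%:~R / N%:R)); last first.
  congr (_ * _); rewrite /dft; congr (_ * psum _ _); apply/funext => l.
  by congr (_ * _); rewrite (dftK N0 j (G2 l)).
rewrite big_map big_enum /=.
under [in RHS]eq_fun => l.
  rewrite -(@psum_shift _ N N0 _ (- (N./2)%:Z)); last exact/Nper_mulcis/Nper_dft.
  over.
rewrite [in RHS]/dft mulrAC mulr_sumr.
under [in RHS]eq_bigr => l _ do rewrite mulr_suml mulr_sumr.
rewrite exchange_big; apply: eq_bigr => l _.
rewrite /dft mulr_sumr !mulr_suml; apply: eq_bigr => m _.
by rewrite -[_ - _]/(center l) !mulrA; ring.
Qed.

(** The coefficients of the Fourier series are limits of those of the finite
Fourier expansion on a grid, which is exact on the grid; uniform decay of the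
latter comes from summation by parts. *)
Lemma fourier_expansion : exists2 a : int * int -> R[i], rapid2 a &
  forall s t, hasSum (fun x => a x * cis (x.1%:~R * s) * cis (x.2%:~R * t)) (A s t).
Proof.
have [U UU Uoo] := ultra_exists.
pose d n x := if x \in centered n.+1 then dft2 n.+1 (G n.+1 0 0) x.1 x.2 else 0.
have dB k : exists2 C : R, 0 <= C & forall n x, nc (d n x) <= C / (wt x.1 * wt x.2) ^+ k.
  have [C C0 hC] := decay k; exists C => // n x; rewrite /d; case: ifP => [xc|_].
    by have [x1 x2] := centered_bound xc; exact: hC.
  by rewrite nc0 divr_ge0 // exprn_ge0 // mulr_ge0 // ltW ?wt_gt0.
have /choice[a aP] : forall x, exists l, ucvg U (fun n => d n x) l.
  by move=> x; have [C _ hC] := dB 0%N; exact: ultra_lim (fun n => hC n x).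
exists a.
  move=> k; have [C C0 hC] := dB k; exists C => // x.
  by apply: ucvg_bound (aP x); apply: filterS filterT => n _; exact: hC.
move=> s t; have [C C0 hC] := dB 2%N.
pose B (x : int * int) : R := C * ((wt x.1 ^+ 2)^-1 * (wt x.2 ^+ 2)^-1).
have BE x : C / (wt x.1 * wt x.2) ^+ 2 = B x by rewrite /B exprMn invfM.
have wp (m : int) : 0 <= (wt m ^+ 2)^-1 :> R by rewrite invr_ge0 sqr_ge0.
have B0 x : 0 <= B x by rewrite /B !mulr_ge0.
have BC : sumle B (C * (4 * 4)).
  apply: sumleZ => //.
  by apply: (@sumle_prod _ _ _ (fun p => (wt p ^+ 2)^-1) (fun p => (wt p ^+ 2)^-1)) => //; exact:
    sumle_wt.
pose F n x := d n x * cis (x.1%:~R * ((Num.floor (s * n.+1%:R))%:~R / n.+1%:R)) *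
    cis (x.2%:~R * ((Num.floor (t * n.+1%:R))%:~R / n.+1%:R)).
pose f x := a x * cis (x.1%:~R * s) * cis (x.2%:~R * t).
have FB n x : nc (F n x) <= B x by rewrite /F !ncM !nc_cis !mulr1 -BE.
have fl (r : R) n : exists2 h, 0 <= h <= n.+1%:R^-1 &
    r = (Num.floor (r * n.+1%:R))%:~R / n.+1%:R + h.
  have /andP[f1 f2] := real_floor_itv (num_real (r * n.+1%:R)).
  exists (r - (Num.floor (r * n.+1%:R))%:~R / n.+1%:R); last by rewrite addrC subrK.
  have n0 : 0 < n.+1%:R :> R by rewrite ltr0n.
  rewrite subr_ge0 ler_pdivrMr // f1 /= -(ler_pM2r n0) mulrBl divfK ?gt_eqF // mulVf ?gt_eqF //.
  by move: f2; rewrite intrD; lra.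
have cisl (p : int) (r : R) : ucvg U
    (fun n => cis (p%:~R * ((Num.floor (r * n.+1%:R))%:~R / n.+1%:R))) (cis (p%:~R * r)).
  apply: (@ucvg_rate _ U UU Uoo _ _ (2 * pi * `|p|%:~R)); apply: filterS filterT => n _ /=.
  apply: le_trans (nc_cisB_le _ _) _; rewrite -mulrBr normrM mulrA intr_norm; apply: ler_wpM2l.
    by rewrite !mulr_ge0 ?pi_ge0.
  have [h /andP[h0 h1] rE] := fl r n.
  by rewrite -normrN opprB {1}rE addrAC subrr add0r ger0_norm.
have Ff x : ucvg U (fun n => F n x) (f x).
  by apply: ucvgM; [apply: ucvgM; [exact: aP|exact: cisl]|exact: cisl].
have [S fS] : exists S, hasSum f S.
  apply: (@hasSum_exists _ _ f (C * (4 * 4))); apply: sumle_le BC => x.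
  by apply: ucvg_bound (Ff x); apply: filterS filterT => n _; exact: FB.
suff -> : A s t = S by [].
pose AS n := A ((Num.floor (s * n.+1%:R))%:~R / n.+1%:R) ((Num.floor (t * n.+1%:R))%:~R / n.+1%:R).
apply: (@ucvg_unique _ U UU AS).
  have [D D0 hD] := smooth_lipschitz.
  apply: (@ucvg_rate _ U UU Uoo _ _ (2 * D)); apply: filterS filterT => n _ /=.
  have [h /andP[h0 h1] sE] := fl s n; have [h' /andP[h0' h1'] tE] := fl t n.
  rewrite ncC {1}sE {1}tE; apply: le_trans (hD _ _ _ _ h0 h0') _.
  rewrite (_ : 2 * D / _ = D * (n.+1%:R^-1 + n.+1%:R^-1)); last by ring.
  by rewrite ler_wpM2l // lerD.
have hF n : hasSum (F n) (AS n).
  rewrite /AS -(@inversion n.+1 _ _ isT).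
  rewrite (_ : \sum_(x <- _) _ = \sum_(x <- centered n.+1) F n x); last first.
    by rewrite !big_seq; apply: eq_bigr => x xc; rewrite /F /d xc.
  apply: hasSum_finite (centered_uniq n.+1) _ => x xc.
  by rewrite /F /d (negbTE xc) !mul0r.
move=> e e0; exact: (sumle_limit _ B0 BC FB Ff hF fS e0).
Qed.

End Expansion.

(** The same expansion in the variables [s - t] and [t], which separates a
convolution factor from a multiplication. *)
Lemma fourier_convolution_expansion (A : R -> R -> R[i]) : smooth_periodic2 A ->
  exists2 b : int * int -> R[i], rapid2 b &
  forall s t, hasSum (fun x => b x * cis (x.1%:~R * (s - t)) * cis (x.2%:~R * t)) (A s t).
Proof.
move=> /fourier_expansion[a ar aS]; exists (fun x => a (x.1, x.2 - x.1)).
  move=> k; have [C C0 hC] := ar (2 * k)%N; exists C => // x.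
  apply: le_trans (hC _) _ => /=; rewrite ler_wpM2l //.
  have w0 (m : int) : 0 < wt m :> R by exact: wt_gt0.
  rewrite lef_pV2 ?posrE ?exprn_gt0 ?mulr_gt0 // exprM lerXn2r ?nnegrE ?sqr_ge0 ?mulr_ge0 ?(ltW
    (w0 _)) //.
  have h1 := wtD (R := R) x.1 (x.2 - x.1); rewrite addrC subrK in h1.
  have := wt_ge1 (R := R) x.1; have := wt_ge1 (R := R) (x.2 - x.1); have := w0 x.2.
  move: (wt _) (wt _) (wt _) h1 => u v w; nra.
move=> s t; have := @hasSum_reindex R _ _ (fun x : int * int => (x.1, x.2 - x.1))
   (fun x => (x.1, x.2 + x.1)) _ _ _ _ (aS s t).
move=> /(_ _ _)/=; rewrite (_ : (fun x => _) = (fun x => a (x.1, x.2 - x.1) *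
     cis (x.1%:~R * (s - t)) * cis (x.2%:~R * t))).
  by apply=> -[p q] /=; rewrite ?subrK ?addrK.
apply/funext => -[p q] /=; rewrite -!mulrA -!cisD; congr (_ * cis _).
by rewrite rmorphB /=; ring.
Qed.

End FourierSeries.

(** * Integrals of complex functions over a period *)

Section ComplexIntegral.
Context {R : realType}.
Local Notation mu := (@lebesgue_measure R).
Local Notation I01 := (`[0%R : R, 1%R]%classic).
Implicit Types (f g : R -> R[i]) (G : R -> R).

Definition rint (G : R -> R) := mu.-integrable I01 (EFin \o G).

Definition cint f := rint (fun x => re (f x)) /\ rint (fun x => im (f x)).

Definition cmeas f := measurable_fun I01 (fun x => re (f x)) /\
  measurable_fun I01 (fun x => im (f x)).

Let mI : measurable (I01 : set (measurableTypeR R)). Proof. exact: measurable_itv. Qed.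

Lemma rint_le (h : R -> R) G : measurable_fun I01 h -> rint G ->
  (forall x, I01 x -> `|h x| <= G x) -> rint h.
Proof.
move=> mh iG hG; apply: (le_integrable _ _ _ iG) => //.
  exact/measurable_EFinP.
by move=> x xI /=; rewrite lee_fin (le_trans (hG x xI)) ?ler_norm.
Qed.

Lemma cint_le f G : cmeas f -> rint G -> (forall x, I01 x -> nc (f x) <= G x) -> cint f.
Proof.
move=> [m1 m2] iG fG; split; apply: (rint_le _ iG) => // x xI.
  exact: le_trans (nc_Re _) (fG x xI).
exact: le_trans (nc_Im _) (fG x xI).
Qed.

Lemma int01D f g : cint f -> cint g ->
  int01 (fun x => f x + g x) = int01 f + int01 g.
Proof.
move=> [f1 f2] [g1 g2]; rewrite /int01; apply: complex_eq; rewrite ?(cReD, cImD) /=.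
  by rewrite -RintegralD //; apply: eq_Rintegral => x _; rewrite cReD.
by rewrite -RintegralD //; apply: eq_Rintegral => x _; rewrite cImD.
Qed.

Lemma rintZ (a : R) G : rint G -> rint (fun x => a * G x).
Proof. by move=> h; have := integrableZl mI a h; apply: eq_integrable. Qed.

Lemma rintD G G' : rint G -> rint G' -> rint (fun x => G x + G' x).
Proof. by move=> h h'; have := integrableD mI h h'; apply: eq_integrable. Qed.

Lemma cintZ (a : R[i]) f : cint f -> cint (fun x => a * f x).
Proof.
move=> [f1 f2]; split.
  have := rintD (rintZ (re a) f1) (rintZ (- im a) f2); apply: eq_integrable => // x _ /=.
  by rewrite cReM mulNr.
have := rintD (rintZ (re a) f2) (rintZ (im a) f1); apply: eq_integrable => // x _ /=.
by rewrite cImM.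
Qed.

Lemma int01Z (a : R[i]) f : cint f -> int01 (fun x => a * f x) = a * int01 f.
Proof.
move=> [f1 f2]; rewrite /int01; apply: complex_eq; rewrite ?(cReM, cImM) /=.
  rewrite -mulNr -!RintegralZl // -RintegralD //; try exact: rintZ.
  by apply: eq_Rintegral => x _; rewrite cReM mulNr.
rewrite -!RintegralZl // -RintegralD //; try exact: rintZ.
by apply: eq_Rintegral => x _; rewrite cImM.
Qed.

Lemma cintD f g : cint f -> cint g -> cint (fun x => f x + g x).
Proof.
move=> [f1 f2] [g1 g2]; split.
  have := rintD f1 g1; apply: eq_integrable => // x _ /=; by rewrite cReD.
have := rintD f2 g2; apply: eq_integrable => // x _ /=; by rewrite cImD.
Qed.

Lemma cint0 : cint (fun=> 0).
Proof. by split; exact: integrable0. Qed.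

Lemma int010 : int01 (fun=> 0 : R[i]) = 0.
Proof.
rewrite /int01 /=; apply: complex_eq => /=;
  by rewrite Rintegral_cst // mul0r.
Qed.

Lemma int01_sum (T : Type) (s : seq T) (F : T -> R -> R[i]) :
  (forall x, cint (F x)) ->
  cint (fun t => \sum_(x <- s) F x t) /\
  int01 (fun t => \sum_(x <- s) F x t) = \sum_(x <- s) int01 (F x).
Proof.
move=> cF; elim: s => [|x s [IH1 IH2]].
  rewrite big_nil (_ : (fun t => _) = fun=> 0); last by apply/funext => t; rewrite big_nil.
  by split; [exact: cint0|exact: int010].
rewrite big_cons (_ : (fun t => _) = fun t => F x t + \sum_(x <- s) F x t); last first.
  by apply/funext => t; rewrite big_cons.
by split; [exact: cintD|rewrite int01D // IH2].
Qed.

(** The factor [2] comes from estimating the real and the imaginary part separately. *)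
Lemma nc_int01_le f G : cmeas f -> rint G -> (forall x, I01 x -> nc (f x) <= G x) ->
  nc (int01 f) <= 2 * \int[mu]_(x in I01) G x.
Proof.
move=> mf iG fG; have [f1 f2] := cint_le mf iG fG.
apply: le_trans (nc_ReIm _) _; rewrite /int01 /= mulrDl mul1r lerD //.
  apply: le_trans (le_normr_Rintegral _ f1) _ => //.
  apply: le_Rintegral => //; first exact: integrable_norm.
  by move=> x xI /=; apply: le_trans (nc_Re _) _; exact: fG.
apply: le_trans (le_normr_Rintegral _ f2) _ => //.
apply: le_Rintegral => //; first exact: integrable_norm.
by move=> x xI /=; apply: le_trans (nc_Im _) _; exact: fG.
Qed.

Definition lip f := exists2 C : R, 0 <= C & forall x y, nc (f x - f y) <= C * `|x - y|.

Lemma lipR_continuous (h : R -> R) (C : R) : (forall x y, `|h x - h y| <= C * `|x - y|) ->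
  continuous h.
Proof.
move=> hC x; apply/cvgrPdist_le => e e0.
have C1 : 0 < `|C| + 1 by have := normr_ge0 C; lra.
near=> y; apply: le_trans (hC x y) _.
apply: (@le_trans _ _ ((`|C| + 1) * `|x - y|)).
  by rewrite ler_wpM2r //; have := ler_norm C; lra.
rewrite -ler_pdivlMl // mulrC; near: y.
by apply: cvgr_dist_le; [exact: cvg_id|rewrite divr_gt0].
Unshelve. all: by end_near. Qed.

Lemma lip_re f : lip f -> continuous (fun x => re (f x)).
Proof.
move=> [C C0 h]; apply: (@lipR_continuous _ C) => x y.
by rewrite -cReN -cReD; apply: le_trans (nc_Re _) (h x y).
Qed.

Lemma lip_im f : lip f -> continuous (fun x => im (f x)).
Proof.
move=> [C C0 h]; apply: (@lipR_continuous _ C) => x y.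
by rewrite -cImN -cImD; apply: le_trans (nc_Im _) (h x y).
Qed.

Lemma lip_meas f : lip f -> cmeas f.
Proof.
move=> h; split; apply: measurable_funTS; apply: continuous_measurable_fun.
  exact: lip_re.
exact: lip_im.
Qed.

Lemma continuous_rint (h : R -> R) : continuous h -> rint h.
Proof.
move=> ch; apply: continuous_compact_integrable; first exact: segment_compact.
exact: continuous_subspaceT.
Qed.

Lemma lip_cint f : lip f -> cint f.
Proof.
by move=> h; split; apply: continuous_rint; [exact: lip_re|exact: lip_im].
Qed.

Lemma riemann_sum_real (h : R -> R) (C : R) : (forall x y, `|h x - h y| <= C * `|x - y|) ->
  forall N, (0 < N)%N ->
  `|\int[mu]_(x in I01) h x - N%:R^-1 * \sum_(k < N) h (k%:R / N%:R)| <= C / N%:R.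
Proof.
move=> hC N N0; have ch := lipR_continuous hC.
have NR : 0 < N%:R :> R by rewrite ltr0n.
have C0 : 0 <= C by have := hC 0 1; rewrite sub0r normrN normr1 mulr1; apply: le_trans.
pose F (x : R) := \int[mu]_(t in `]-1, x]) h t.
have ih (a : itv_bound R) : (a = BLeft (-1) \/ a = BRight (-1)) -> mu.-integrable [set` Interval
  a (BRight 2)] (EFin \o h).
  move=> aE; apply: (@integrableS _ _ _ mu (`[(-1), 2])) => //.
    by move=> x /=; case: aE => ->; rewrite !in_itv /= => /andP[h1 h2]; rewrite h2 andbT // ltW.
  apply: continuous_compact_integrable; first exact: segment_compact.
  exact: continuous_subspaceT.
have dF (x : R) : -1 < x < 2 -> is_derive x 1 F (h x).
  move=> /andP[x1 x2].
  have [|d1 d2] := @continuous_FTC1 R h (BRight (-1)) x 2 x2 (ih _ (or_intror erefl)) _ (ch x).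
    exact: x1.
  by apply: DeriveDef; [exact: d1|rewrite -derive1E; exact: d2].
have -> : \int[mu]_(x in I01) h x = F 1 - F 0.
  rewrite /F (@Rintegral_itvB R h (BRight (-1)) (BRight 1) 0) ?bnd_simp //.
    rewrite Rintegral_itv_obnd_cbnd //.
    apply: (@integrableS _ _ _ mu (I01)) => //; last exact: continuous_rint.
    by apply: subset_itv; rewrite bnd_simp.
  apply: (@integrableS _ _ _ mu (`]-1, 2])) => //; last exact: ih (or_intror erefl).
  by move=> x /=; rewrite !in_itv /= => /andP[-> h2] /=; apply: le_trans h2 _; rewrite ler1n.
have -> : F 1 - F 0 = \sum_(k < N) (F (k.+1%:R / N%:R) - F (k%:R / N%:R)).
  rewrite -(big_mkord xpredT (fun k => F (k.+1%:R / N%:R) - F (k%:R / N%:R))).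
  by rewrite (telescope_sumr (fun k => F (k%:R / N%:R))) // mul0r divff ?gt_eqF.
rewrite mulr_sumr -sumrB; apply: le_trans (ler_norm_sum _ _ _) _.
apply: (@le_trans _ _ (\sum_(k < N) C / N%:R ^+ 2)); last first.
  by rewrite sumr_const card_ord -[leLHS]mulr_natr expr2 invfM mulrA divfK ?gt_eqF.
apply: ler_sum => k _.
have k0 : 0 <= k%:R / N%:R :> R by rewrite divr_ge0.
have kN : k.+1%:R / N%:R <= 1 :> R by rewrite ler_pdivrMr // mul1r ler_nat.
have kk : k.+1%:R / N%:R = k%:R / N%:R + N%:R^-1 :> R by rewrite -natr1 mulrDl mul1r.
have N1 : 0 < N%:R^-1 :> R by rewrite invr_gt0.
have [|x xk|c /andP[c1 c2] ->] := @mean_value R F h (k%:R / N%:R) (k.+1%:R / N%:R).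
- by rewrite kk lerDl ltW.
- by apply: dF; case/andP: xk => x1 x2; apply/andP; split; lra.
rewrite kk addrAC subrr add0r [h c * _]mulrC -mulrBr normrM (ger0_norm (ltW N1)).
rewrite (_ : C / _ = N%:R^-1 * (C * N%:R^-1)); last by field; rewrite gt_eqF.
rewrite ler_wpM2l ?(ltW N1) //; apply: le_trans (hC _ _) _; rewrite ler_wpM2l //.
by rewrite ger0_norm; lra.
Qed.

(** Only Lipschitz functions occur, because singular kernels are regularized first. *)
Lemma riemann_sum f (C : R) : (forall x y, nc (f x - f y) <= C * `|x - y|) ->
  forall N, (0 < N)%N ->
  nc (int01 f - N%:R^-1 * \sum_(k < N) f (k%:R / N%:R)) <= 2 * C / N%:R.
Proof.
move=> fC N N0; apply: le_trans (nc_ReIm _) _.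
have E : (N%:R^-1 : R[i]) = (N%:R^-1)%:C by rewrite fmorphV rmorph_nat.
rewrite cReD cReN cImD cImN E ![_%:C * _]mulrC Re_mulr_real Im_mulr_real Re_sum Im_sum.
rewrite (_ : 2 * C / _ = C / N%:R + C / N%:R); last by ring.
rewrite ![(\sum_(_ < _) _) * N%:R^-1]mulrC.
apply: lerD; apply: riemann_sum_real => // x y.
  by rewrite -cReN -cReD; apply: le_trans (nc_Re _) (fC x y).
by rewrite -cImN -cImD; apply: le_trans (nc_Im _) (fC x y).
Qed.

Lemma lip_cis (n : int) (x y : R) : nc (cis (n%:~R * x) - cis (n%:~R * y)) <= 2 * pi * `|n%:~R| *
  `|x - y|.
Proof.
by apply: le_trans (nc_cisB_le _ _) _; rewrite -mulrBr normrM mulrA.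
Qed.

Lemma archi_eq0 (z : R[i]) (C : R) (N0 : nat) :
  (forall N, (N0 < N)%N -> nc z <= C / N%:R) -> z = 0.
Proof.
move=> h; apply/eqP; rewrite -nc_eq0 eq_le nc_ge0 andbT leNgt; apply/negP => z0.
pose N := (maxn N0 (Num.bound (`|C| / nc z))).+1.
have NN : (N0 < N)%N by rewrite ltnS leq_maxl.
have := h N NN; rewrite ler_pdivlMr ?ltr0n //; apply/negP; rewrite -ltNge.
apply: le_lt_trans (ler_norm C) _; rewrite mulrC -ltr_pdivrMr //.
apply: lt_le_trans (archi_boundP _) _; first by rewrite divr_ge0 // ltW.
by rewrite ler_nat; exact: leq_trans (leq_maxr _ _) (leqnSn _).
Qed.

(** Through Riemann sums this is the orthogonality of the discrete characters. *)
Lemma int01_cis (n : int) : int01 (fun t => cis (n%:~R * t)) = (n == 0)%:R :> R[i].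
Proof.
apply/eqP; rewrite -subr_eq0; apply/eqP.
apply: (@archi_eq0 _ (2 * (2 * pi * `|n%:~R|)) (absz n)) => N nN.
have N0 : (0 < N)%N by exact: leq_ltn_trans nN.
have := riemann_sum (lip_cis n) N0.
congr (nc (_ - _) <= _).
transitivity (N%:R^-1 * psum N (fun k => cis (n%:~R * k%:~R / N%:R : R))).
  by congr (_ * _); apply: eq_bigr => k _; rewrite mulrA.
rewrite psum_cis //; have NC : (N%:R : R[i]) != 0 by rewrite pnatr_eq0 -lt0n.
have [->|n0] := eqVneq n 0; first by rewrite dvdz0 mulVf.
rewrite ifN ?mulr0 //; apply/negP => /dvdzP[q qE].
have q0 : q <> 0 by move=> q0; apply: (negP n0); rewrite qE q0 mul0r.
by rewrite qE abszM in nN; move: nN; rewrite ltnNge leq_pmull // absz_gt0; apply/eqP.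
Qed.

End ComplexIntegral.

(** * Fourier coefficients of the logarithmic kernel *)

Section LogIntegral.
Context {R : realType}.
Local Notation mu := (@lebesgue_measure R).
Local Notation I01 := (`[0%R : R, 1%R]%classic).
Implicit Types (r s t : R).

Lemma ln_lip (m a b : R) : 0 < m -> m <= a -> m <= b -> `|ln a - ln b| <= m^-1 * `|a - b|.
Proof.
move=> m0.
have half (x y : R) : m <= x -> m <= y -> x <= y -> `|ln x - ln y| <= m^-1 * `|x - y|.
  move=> mx my xy; have x0 : 0 < x by exact: lt_le_trans mx.
  have y0 : 0 < y by exact: lt_le_trans my.
  rewrite distrC [`|x - y|]distrC ger0_norm; last first.
    by rewrite subr_ge0 ler_ln.
  rewrite -ln_div ?posrE // ger0_norm ?subr_ge0 //.
  have -> : y / x = 1 + (y - x) / x by field; rewrite gt_eqF.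
  have h : 0 <= (y - x) / x by rewrite divr_ge0 ?subr_ge0 // ltW.
  apply: le_trans (le_ln1Dx _) _; first by lra.
  by rewrite mulrC ler_wpM2r ?subr_ge0 // lef_pV2 ?posrE.
move=> ma mb; have [ab|/ltW ab] := leP a b; first exact: half.
by rewrite distrC [`|a - b|]distrC; exact: half.
Qed.

Lemma quad_lb r x : 0 <= r -> (1 - r) ^+ 2 <= quad r x.
Proof. by move=> r0; rewrite /quad; have := cos_le1 (2 * pi * x); nra. Qed.

Lemma quad_ub r x : 0 <= r <= 1 -> quad r x <= 4.
Proof. by move=> /andP[r0 r1]; rewrite /quad; have := cos_geN1 (2 * pi * x); nra. Qed.

Lemma quad_lip r x y : 0 <= r <= 1 -> `|quad r x - quad r y| <= 4 * pi * `|x - y|.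
Proof.
move=> /andP[r0 r1]; rewrite /quad.
rewrite (_ : _ - _ = - (2 * r) * (cos (2 * pi * x) - cos (2 * pi * y))); last by ring.
rewrite normrM normrN (ger0_norm (_ : 0 <= 2 * r)) ?mulr_ge0 //.
have h : `|cos (2 * pi * x) - cos (2 * pi * y)| <= 2 * pi * `|x - y|.
  have h := le_trans (nc_Re _) (nc_cisB_le x y); rewrite cReD cReN /= in h.
  exact: h.
by apply: (@le_trans _ _ (2 * (2 * pi * `|x - y|))); [apply: ler_pM => //; lra|lra].
Qed.

(** The logarithm regularized by moving the singularity off the circle: [r < 1] gives
a Lipschitz function, and [r = 1] the logarithmic kernel itself. *)
Definition lnq r s t : R := ln (quad r (s - t)).

Definition singular s := [set t : R | sin (pi * (s - t)) = 0].

Lemma singular_countable s : countable (singular s).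
Proof.
apply: (@sub_countable _ _ _ (range (fun k : int => s - k%:~R))).
  apply: subset_card_le => t /= h.
  have /eqP := nc_cis_sub1 (s - t); rewrite h normr0 mulr0 nc_eq0 subr_eq0 => /eqP/cis_eq1 [k kE].
  by exists k => //; rewrite -kE; ring.
exact: sub_countable (card_image_le _ _) (countableP _).
Qed.

Let mI : measurable (I01 : set (measurableTypeR R)). Proof. exact: measurable_itv. Qed.

Lemma singular_measurable s : measurable (singular s : set (measurableTypeR R)).
Proof.
apply: countable_measurable; last exact: singular_countable.
by move=> x; exact: measurable_set1.
Qed.

Lemma Rintegral01_cst (c : R) : \int[mu]_(_ in I01) c = c.
Proof.
rewrite Rintegral_cst //; have := @lebesgue_measure_itv R `[0, 1].
rewrite /= lte_fin ltr01 oppr0 adde0 => /(congr1 fine) h.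
by rewrite -[RHS]mulr1; congr (_ * _); exact: h.
Qed.

Lemma rint_cst (c : R) : rint (fun=> c).
Proof. by apply: continuous_rint => x; exact: cvg_cst. Qed.

Lemma Rintegral_off_singular s (F : R -> R) : rint F ->
  \int[mu]_(x in I01) F x = \int[mu]_(x in I01 `\` singular s) F x.
Proof.
move=> iF; congr fine; apply: negligible_integral => //; first exact: singular_measurable.
exact/countable_lebesgue_measure0/singular_countable.
Qed.

(** On the singular set the logarithm takes the value of [ln 0], so pointwise comparisons are
available only off it. *)
Lemma le_Rintegral_off_singular s (F G : R -> R) : rint F -> rint G ->
  (forall t, sin (pi * (s - t)) != 0 -> F t <= G t) ->
  \int[mu]_(x in I01) F x <= \int[mu]_(x in I01) G x.
Proof.
move=> iF iG FG; rewrite !(Rintegral_off_singular s) //.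
have mD : measurable (I01 `\` singular s : set (measurableTypeR R)).
  by apply: measurableD => //; exact: singular_measurable.
apply: le_Rintegral => //; try exact: (integrableS mI).
by move=> x [_ /= /eqP h]; exact: FG.
Qed.

Lemma cis_continuous (h : R -> R) : continuous h ->
  continuous (fun t => re (cis (h t))) /\ continuous (fun t => im (cis (h t))).
Proof.
move=> ch; split => t /=; apply: continuous_comp; try exact: continuous_cos; try exact:
  continuous_sin;
  by apply: cvgM; [exact: cvg_cst|exact: ch].
Qed.

Lemma measurable_lnq r s : measurable_fun I01 (lnq r s).
Proof.
apply: measurable_funTS; apply: measurableT_comp; first exact: measurable_ln.
apply: continuous_measurable_fun => t.
have [cre _] : continuous (fun t => re (cis (s - t))) /\ continuous (fun t => im (cis (s - t))).
  by apply: cis_continuous => y; apply: cvgB; [exact: cvg_cst|exact: cvg_id].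
rewrite /quad; apply: cvgD; last exact: cvg_cst.
apply: cvgB; first exact: cvg_cst.
by apply: cvgM; [exact: cvg_cst|exact: cre].
Qed.

Section Regular.
Variables (r s : R).
Hypothesis (r0 : 0 <= r) (r1 : r < 1).

Lemma lnq_bound t : `|lnq r s t| <= ln 4 - 2 * ln (1 - r).
Proof.
have r0' := r0; have r1' := r1.
have h0 : 0 < 1 - r by lra.
have h1 := @quad_lb r (s - t) r0.
have h2 : quad r (s - t) <= 4 by apply: quad_ub; apply/andP; split; lra.
have h3 : 0 < (1 - r) ^+ 2 by exact: exprn_gt0.
have l1 : ln ((1 - r) ^+ 2) <= lnq r s t by rewrite ler_ln ?posrE //; lra.
have l2 : lnq r s t <= ln 4 by rewrite ler_ln ?posrE //; lra.
have l3 : ln (1 - r) <= 0 by apply: ln_le0; lra.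
have l4 : 0 <= ln (4 : R) by apply: ln_ge0; lra.
move: l1; rewrite lnXn // mulr2n => l1.
by rewrite ler_norml; apply/andP; split; lra.
Qed.

Lemma lnq_lip x y : `|lnq r s x - lnq r s y| <= ((1 - r) ^- 2 * (4 * pi)) * `|x - y|.
Proof.
have r0' := r0; have r1' := r1.
have h3 : 0 < (1 - r) ^+ 2 by apply: exprn_gt0; lra.
apply: le_trans (ln_lip h3 (quad_lb _ r0) (quad_lb _ r0)) _.
rewrite -[leRHS]mulrA ler_wpM2l ?invr_ge0 ?(ltW h3) //.
apply: le_trans (quad_lip _ _ _) _; first by apply/andP; split; lra.
by rewrite (_ : s - x - (s - y) = y - x) 1?distrC //; ring.
Qed.

Lemma lnq_cis_lip (n : int) : exists2 C : R, 0 <= C & forall x y,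
  nc ((lnq r s x)%:C * cis (n%:~R * x) - (lnq r s y)%:C * cis (n%:~R * y)) <= C * `|x - y|.
Proof.
have r0' := r0; have r1' := r1.
pose B := ln 4 - 2 * ln (1 - r).
have B0 : 0 <= B by apply: le_trans (lnq_bound 0); exact: normr_ge0.
have h0 : 0 < 1 - r by lra.
exists ((1 - r) ^- 2 * (4 * pi) + B * (2 * pi * `|n%:~R|)) => [|x y].
  by rewrite addr_ge0 // !mulr_ge0 ?pi_ge0 // invr_ge0 exprn_ge0 ?(ltW h0).
rewrite (_ : _ - _ = ((lnq r s x - lnq r s y)%:C) * cis (n%:~R * x) +
   (lnq r s y)%:C * (cis (n%:~R * x) - cis (n%:~R * y))); last by rewrite rmorphB /=; ring.
apply: le_trans (ncD _ _) _; rewrite !ncM nc_cis mulr1 !nc_real [leRHS]mulrDl.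
apply: lerD; first exact: lnq_lip.
by rewrite -mulrA; apply: ler_pM => //; [exact: nc_ge0|exact: lnq_bound|exact: lip_cis].
Qed.

Definition Lreg r (n : int) : R := if n == 0 then 0 else - (r ^+ `|n|%N / `|n|%:~R).

Lemma logsum_lim (n : int) (N : nat) (e : R) : (absz n < N)%N ->
  nc (logsum N e n r - (Lreg r n)%:C) <= 2 * (1 - r)^-1 / (N - absz n)%:R.
Proof.
have r0' := r0; have r1' := r1.
move=> nN; have N0 : (0 < N)%N by exact: leq_ltn_trans nN.
have h0 : 0 < 1 - r by lra.
have h1 : 0 <= (1 - r)^-1 by rewrite invr_ge0 ltW.
have sP t : 0 <= t <= r ^+ N -> 1 - r <= nc (1 - t%:C * cis e).
  move=> /andP[t0 tr]; have t1 : t <= r.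
    by apply: le_trans tr _; rewrite -[leRHS]expr1; apply: ler_wiXn2l => //; exact: ltW.
  have := ncBl 1 (t%:C * cis e); rewrite nc1 ncM nc_cis nc_real ger0_norm // mulr1; lra.
have r1'' := ltW r1.
have rX k : r ^+ k <= 1 by apply: exprn_ile1.
have ge k : r ^+ k / k%:R <= k%:R^-1 by rewrite ler_piMl ?invr_ge0.
have main (k : nat) : (1 <= k < N)%N ->
   nc (logsum N e k%:Z r - (Lreg r k)%:C) <= 2 * (1 - r)^-1 / (N - k)%:R.
  move=> kN; have := @logsum_approx _ N N0 e r (1 - r) r0 r1'' h0 sP k kN.
  have k0 : (k%:Z == 0) = false by case: k kN.
  rewrite /Lreg k0 /= rmorphN opprK => h; apply: le_trans h _.
  rewrite (mulrC 2) -mulrA ler_wpM2l // mulrDl mul1r; apply: lerD => //.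
  apply: le_trans (ge _) _; rewrite lef_pV2 ?posrE ?ltr0n ?ler_nat ?addn_gt0 ?N0 //.
    by rewrite (leq_trans (leq_subr _ _)) ?leq_addr.
  by rewrite subn_gt0; case/andP: kN.
case: n nN => [[|k]|k] nN.
- have := @logsum0_le _ N N0 e r (1 - r) r0 h0 sP.
  rewrite /Lreg eqxx subr0 subn0 -mulrA => h; apply: le_trans h _.
  by rewrite mulrA ler_wpM2l // ?mulr_ge0.
- exact: main.
have := main k.+1; rewrite NegzE logsumN.
have -> : Lreg r (- k.+1%:Z) = Lreg r k.+1 by rewrite /Lreg oppr_eq0 abszN normrN.
have -> : cj (logsum N e k.+1 r) - (Lreg r k.+1)%:C = cj (logsum N e k.+1 r - (Lreg r k.+1)%:C).
  by rewrite cjB conjc_real.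
by rewrite ncJ => h; apply: h.
Qed.

(** The Riemann sums of the regularized kernel are logarithmic sums over shifted roots of
unity, whose limits are known from [logsum_lim]. *)
Lemma int01_lnq_cis (n : int) :
  int01 (fun t => (lnq r s t)%:C * cis (n%:~R * t)) = (Lreg r n)%:C * cis (n%:~R * s).
Proof.
have r0' := r0; have r1' := r1.
have [C C0 CP] := lnq_cis_lip n.
apply/eqP; rewrite -subr_eq0; apply/eqP.
have h0 : 0 <= (1 - r)^-1 by rewrite invr_ge0; lra.
apply: (@archi_eq0 _ _ (2 * C + 4 * (1 - r)^-1) (2 * absz n)) => N nN.
have N0 : (0 < N)%N by exact: leq_ltn_trans nN.
have nN2 : (absz n < N)%N by apply: leq_ltn_trans nN; rewrite mul2n -addnn leq_addr.
have NR : (N%:R : R) != 0 by rewrite pnatr_eq0 -lt0n.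
have h1 := riemann_sum CP N0.
have E : N%:R^-1 * (\sum_(k < N) (lnq r s (k%:R / N%:R))%:C * cis (n%:~R * (k%:R / N%:R)))
   = cis (n%:~R * s) * logsum N (s * N%:R) n r.
  rewrite /logsum mulrCA; congr (_ * _).
  rewrite -(@psum_reflect _ N N0); last first.
    move=> j /=; have -> : node N (s * N%:R) (j + N%:Z) = node N (s * N%:R) j + 1%:~R.
      by rewrite /node rmorphD /=; field.
    by rewrite !quadE mulrDr opprD -intrM -rmorphN /= !cisDz.
  rewrite -psumZ; apply: eq_bigr => k _.
  have -> : node N (s * N%:R) (- k%:Z) = s - k%:R / N%:R.
    by rewrite /node rmorphN /=; field.
  rewrite [RHS]mulrCA -cisD; congr (_ * cis _); ring.
rewrite (_ : int01 _ - _ = (int01 (fun t : R => (lnq r s t)%:C * cis (n%:~R * t)) -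
   N%:R^-1 * (\sum_(k < N) (lnq r s (k%:R / N%:R))%:C * cis (n%:~R * (k%:R / N%:R)))) +
   cis (n%:~R * s) * (logsum N (s * N%:R) n r - (Lreg r n)%:C)); last by rewrite E; ring.
apply: le_trans (ncD _ _) _; rewrite mulrDl; apply: lerD => //.
rewrite ncM nc_cis mul1r; apply: le_trans (logsum_lim _ nN2) _.
rewrite (_ : 4 = 2 * 2) //; last by ring.
have -> : 2 * 2 * (1 - r)^-1 / N%:R = 2 * (1 - r)^-1 * (2 / N%:R) by ring.
apply: ler_wpM2l; first by rewrite mulr_ge0.
rewrite -[2 / _]invf_div lef_pV2 ?posrE ?divr_gt0 ?ltr0n ?subn_gt0 //.
rewrite ler_pdivrMr // -natrM ler_nat; lia.
Qed.

Lemma rint_lnq : rint (lnq r s).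
Proof. by apply: continuous_rint; exact: (lipR_continuous lnq_lip). Qed.

Lemma Rintegral_lnq : \int[mu]_(t in I01) lnq r s t = 0.
Proof.
have := congr1 re (int01_lnq_cis 0); rewrite /Lreg eqxx mul0r => h; apply: etrans h.
rewrite /int01; cbn [complex.Re]; apply: eq_Rintegral => t _.
by rewrite mul0r cis0 mulr1.
Qed.

End Regular.

Lemma pow_sub1_le r k : 0 <= r <= 1 -> 1 - r ^+ k <= k%:R * (1 - r).
Proof.
move=> /andP[r0 r1]; elim: k => [|k IH]; first by rewrite expr0 mul0r subrr.
have rk : r ^+ k <= 1 by exact: exprn_ile1.
by rewrite exprS -natr1; nra.
Qed.

Lemma quad1_gt0 (x : R) : sin (pi * x) != 0 -> 0 < quad 1 x.
Proof.
move=> h; rewrite quadE exprn_gt0 // rmorph1 mul1r ncC nc_cis_sub1.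
by rewrite mulr_gt0 ?normr_gt0.
Qed.

Let rho (j : nat) : R := 1 - harmonic j / 2.

Let rhoP j : 0 < (harmonic j : R) <= 1.
Proof. by rewrite /harmonic /= invr_gt0 ltr0n /= invf_le1 ?ltr0n // ler1n. Qed.

Let rho0 j : 0 <= rho j. Proof. by have /andP[] := rhoP j; rewrite /rho; lra. Qed.
Let rho1 j : rho j < 1. Proof. by have /andP[] := rhoP j; rewrite /rho; lra. Qed.

Let rho_cvg : rho @ \oo --> (1 : R).
Proof.
rewrite -[X in _ --> X]subr0 -[X in _ --> _ - X](mul0r (2^-1)).
by apply: cvgB; [exact: cvg_cst|apply: cvgM; [exact: cvg_harmonic|exact: cvg_cst]].
Qed.

Lemma lnq_cvg s t : sin (pi * (s - t)) != 0 -> lnq (rho j) s t @[j --> \oo] --> lnq 1 s t.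
Proof.
move=> h; apply: cvg_comp; last exact: continuous_ln (quad1_gt0 h).
rewrite /quad; apply: cvgD; last exact: cvgM rho_cvg rho_cvg.
apply: cvgB; first exact: cvg_cst.
by apply: cvgM; [apply: cvgM; [exact: cvg_cst|exact: rho_cvg]|exact: cvg_cst].
Qed.

Lemma lnq_le4 r s t : 0 <= r <= 1 -> lnq r s t <= ln 4.
Proof.
move=> rr; have h := @quad_ub r (s - t) rr.
have [q0|q0] := ltP 0 (quad r (s - t)); first by rewrite ler_ln ?posrE.
by rewrite /lnq ln0 // ln_ge0 // ler1n.
Qed.

(** Fatou lemma along [rho j --> 1]; the integrals of the regularized logarithms vanish. *)
Lemma lnq1_integral s : rint (lnq 1 s) /\ 0 <= \int[mu]_(t in I01) lnq 1 s t.
Proof.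
pose D := I01 `\` singular s.
have mS := singular_measurable s.
have S0 : mu (singular s) = 0%E by exact/countable_lebesgue_measure0/singular_countable.
have mD : measurable (D : set (measurableTypeR R)) by exact: measurableD.
pose F t := ln 4 - lnq 1 s t.
pose f (j : nat) t := (ln 4 - lnq (rho j) s t)%:E.
have if_ j : rint (fun t => ln 4 - lnq (rho j) s t).
  have h := rintD (rint_cst (ln 4)) (rintZ (-1) (rint_lnq s (rho0 j) (rho1 j))).
  by apply: eq_integrable h => // t _ /=; rewrite mulN1r.
have mF : measurable_fun I01 F.
  by apply: measurable_funB; [exact: measurable_cst|exact: measurable_lnq].
have F0 t : 0 <= F t by rewrite subr_ge0 lnq_le4 // ler01 lexx.
have intf j : (\int[mu]_(t in D) f j t = (ln 4)%:E)%E.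
  rewrite -(negligible_integral mS mI (if_ j) S0).
  rewrite -[LHS](@fineK R); last exact: integrable_fin_num (if_ j).
  congr EFin; rewrite -[LHS]/(Rintegral mu I01 (fun t => ln 4 - lnq (rho j) s t)).
  rewrite RintegralB //; [|exact: rint_cst|exact: rint_lnq].
  by rewrite Rintegral_lnq // subr0 Rintegral01_cst.
have fatF : (\int[mu]_(t in D) (F t)%:E <= (ln 4)%:E)%E.
  have fat : (forall n, measurable_fun D (f n)) -> (forall n x, D x -> (0 <= f n x)%E) ->
      (\int[mu]_(t in D) limn_einf (f^~ t) <= (ln 4)%:E)%E.
    move=> mf f0; apply: le_trans (fatou mu mD mf f0) _.
    rewrite (_ : (fun n : nat => \int[mu]_(x in D) f n x)%E = fun=> (ln 4)%:E).
      by rewrite (cvg_limn_einf_sup (cvg_cst _)).1.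
    by apply/funext => n; exact: intf.
  apply: le_trans (fat _ _).
  - rewrite le_eqVlt; apply/orP; left; apply/eqP; apply: eq_integral => t.
    rewrite inE => -[_ /eqP st]; apply/esym.
    apply: (cvg_limn_einf_sup _).1; apply: cvg_EFin; first by near=> n.
    by apply: cvgB; [exact: cvg_cst|exact: lnq_cvg].
  - move=> n; apply/measurable_EFinP; apply: (measurable_funS mI); first by move=> x [].
    by apply: measurable_funB; [exact: measurable_cst|exact: measurable_lnq].
  - by move=> n t _; rewrite lee_fin subr_ge0 lnq_le4 // rho0 ltW.
have iF : rint F.
  apply/(negligible_integrable mS mI _ S0); first exact/measurable_EFinP.
  apply/integrableP; split.
    by apply/measurable_EFinP; apply: (measurable_funS mI) => // x [].
  rewrite (_ : (fun x => _) = fun t => (F t)%:E).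
    exact: le_lt_trans fatF (ltry _).
  by apply/funext => t /=; rewrite ger0_norm.
have i1 : rint (lnq 1 s).
  have h := rintD (rint_cst (ln 4)) (rintZ (-1) iF).
  by apply: eq_integrable h => // t _ /=; rewrite mulN1r /F; congr EFin; ring.
split => //.
have : \int[mu]_(x in I01) F x <= ln 4.
  rewrite -lee_fin fineK; last exact: integrable_fin_num iF.
  by rewrite (negligible_integral mS mI iF S0).
rewrite RintegralB //; last exact: rint_cst.
by rewrite Rintegral01_cst; lra.
Unshelve. all: by end_near. Qed.

Lemma cmeas_mul_cis (n : int) (g : R -> R) : measurable_fun I01 g ->
  cmeas (fun t => (g t)%:C * cis (n%:~R * t)).
Proof.
move=> mg; have [c1 c2] : continuous (fun t => re (cis (n%:~R * t : R))) /\ continuous (fun t =>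
  im (cis (n%:~R * t : R))).
  by apply: cis_continuous => t; apply: cvgM; [exact: cvg_cst|exact: cvg_id].
split.
  rewrite (_ : (fun x => _) = fun x => g x * re (cis (n%:~R * x))).
    by apply: measurable_funM => //; apply: measurable_funTS; exact: continuous_measurable_fun.
  by apply/funext => x; rewrite mulrC Re_mulr_real mulrC.
rewrite (_ : (fun x => _) = fun x => g x * im (cis (n%:~R * x))).
  by apply: measurable_funM => //; apply: measurable_funTS; exact: continuous_measurable_fun.
by apply/funext => x; rewrite mulrC Im_mulr_real mulrC.
Qed.

(** Since [quad r - r * quad 1 = (1 - r) ^ 2], the difference [lnq r - lnq 1] is bounded
below by [ln r]; its integral is at most [0], which bounds its L1 norm by [- 2 ln r]. *)
Lemma lnq_L1 r s : 0 < r -> r < 1 ->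
  rint (fun t => lnq r s t - lnq 1 s t) /\
  \int[mu]_(t in I01) `|lnq r s t - lnq 1 s t| <= - 2 * ln r.
Proof.
move=> r0 r1; have [i1 p1] := lnq1_integral s.
have ir := rint_lnq s (ltW r0) r1.
have iD : rint (fun t => lnq r s t - lnq 1 s t).
  have h := rintD ir (rintZ (-1) i1).
  by apply: eq_integrable h => // t _ /=; rewrite mulN1r.
split => //.
apply: (@le_trans _ _ (\int[mu]_(t in I01) (lnq r s t - lnq 1 s t - 2 * ln r))).
  apply: (@le_Rintegral_off_singular s).
  - exact: integrable_norm iD.
  - have h := rintD iD (rint_cst (- (2 * ln r))).
    by apply: eq_integrable h.
  move=> t st; have q1 := quad1_gt0 st.
  have lr : ln r <= 0 by apply: ln_le0; exact: ltW.
  have : ln r + lnq 1 s t <= lnq r s t.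
    rewrite -lnM ?posrE // ler_ln ?posrE ?mulr_gt0 //.
      by rewrite /quad; nra.
    apply: lt_le_trans (quad_lb _ (ltW r0)); apply: exprn_gt0; lra.
  by move=> h; rewrite ler_norml; apply/andP; split; lra.
rewrite (@RintegralB _ _ _ mu _ (fun t => lnq r s t - lnq 1 s t) (fun=> 2 * ln r)) //; last
  exact: rint_cst.
by rewrite RintegralB // Rintegral_lnq ?(ltW r0) // Rintegral01_cst; lra.
Qed.

Lemma rint_lnk s : rint (fun t => lnk (s - t)).
Proof.
have [i1 _] := lnq1_integral s.
apply: (rint_le _ (rintD (integrable_norm i1) (rint_cst (ln 4)))).
  apply: measurable_funTS; rewrite (_ : (fun t => _) = @ln R \o (fun t => sin (pi * (s - t)) ^+
    2)) //.
  apply: measurableT_comp; first exact: measurable_ln.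
  apply: continuous_measurable_fun => t; apply: cvgM; apply: continuous_comp;
   try exact: continuous_sin; apply: cvgM; try exact: cvg_cst; apply: cvgB; try exact: cvg_cst;
     exact: cvg_id.
move=> t _; have l4 : 0 <= ln (4 : R) by apply: ln_ge0; lra.
have [st|st] := eqVneq (sin (pi * (s - t))) 0.
  by rewrite /lnk st expr0n /= ln0 // normr0 addr_ge0.
rewrite /lnk logkernelE // -[ln (quad 1 _)]/(lnq 1 s t).
by apply: le_trans (ler_normB _ _) _; rewrite (ger0_norm l4).
Qed.

(** The functions [cis (n * t)] diagonalize the convolution with the logarithmic kernel. *)
Lemma int01_lnk_cis s (n : int) :
  int01 (fun t => (lnk (s - t))%:C * cis (n%:~R * t)) = (Lhat n)%:C * cis (n%:~R * s).
Proof.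
apply/eqP; rewrite -subr_eq0; apply/eqP.
apply: (@archi_eq0 _ _ 9 1) => N N1.
have N0 : (0 < N)%N by exact: leq_trans N1.
have NR : 0 < N%:R :> R by rewrite ltr0n.
have N2 : 2 <= N%:R :> R by rewrite ler_nat.
have hN : N%:R^-1 <= 2^-1 :> R by rewrite lef_pV2 ?posrE.
have NV : 0 < N%:R^-1 :> R by rewrite invr_gt0.
pose r : R := 1 - N%:R^-1.
have r0 : 0 < r by rewrite /r; lra.
have r1 : r < 1 by rewrite /r; lra.
have [iL1 L1] := lnq_L1 s r0 r1.
have ir := rint_lnq s (ltW r0) r1.
pose g t := lnk (s - t) - lnq r s t + ln 4.
have ig : rint g.
  have h := rintD (rintD (rint_lnk s) (rintZ (-1) ir)) (rint_cst (ln 4)).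
  by apply: eq_integrable h => // t _ /=; rewrite mulN1r.
have mg : measurable_fun I01 g by have /integrableP[/measurable_EFinP] := ig.
have cintM (h : R -> R) : rint h -> cint (fun t => (h t)%:C * cis (n%:~R * t)).
  move=> ih; apply: (cint_le _ (integrable_norm ih)).
    by apply: cmeas_mul_cis; have /integrableP[/measurable_EFinP] := ih.
  by move=> t _; rewrite ncM nc_cis mulr1 nc_real.
have split_g : int01 (fun t => (g t)%:C * cis (n%:~R * t)) =
   int01 (fun t => (lnk (s - t))%:C * cis (n%:~R * t)) - (Lreg r n)%:C * cis (n%:~R * s)
   + (ln 4)%:C * (n == 0)%:R.
  rewrite -(int01_lnq_cis s (ltW r0) r1) -int01_cis -int01Z; last first.
    by apply: lip_cint; exists (2 * pi * `|n%:~R|); [rewrite !mulr_ge0 ?pi_ge0|exact: lip_cis].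
  rewrite -mulN1r -int01Z; last exact: cintM.
  rewrite -int01D; [|exact: cintM (rint_lnk s)|exact/cintZ/cintM].
  rewrite -int01D; [|by apply: cintD; [exact: cintM (rint_lnk s)|exact/cintZ/cintM]|].
    by congr int01; apply/funext => t; rewrite /g rmorphD rmorphB /=; ring.
  exact: cintM (rint_cst (ln 4)).
have hg : nc (int01 (fun t => (g t)%:C * cis (n%:~R * t))) <= 2 * (- 2 * ln r).
  apply: le_trans (nc_int01_le (cmeas_mul_cis n mg) (integrable_norm ig) _) _.
    by move=> t _; rewrite ncM nc_cis mulr1 nc_real.
  rewrite ler_wpM2l //; apply: le_trans L1.
  apply: (@le_Rintegral_off_singular s).
  - exact: integrable_norm ig.
  - exact: integrable_norm iL1.
  move=> t st /=; rewrite /g /lnk logkernelE // -[ln (quad 1 _)]/(lnq 1 s t) distrC.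
  by rewrite (_ : _ - _ + _ = lnq 1 s t - lnq r s t) //; ring.
have lnr : - ln r <= 2 / N%:R.
  rewrite -lnV ?posrE //; have -> : r^-1 = 1 + (r^-1 - 1) by ring.
  have rV : r^-1 - 1 = N%:R^-1 / r.
    have NE : N%:R^-1 = 1 - r by rewrite /r; ring.
    by rewrite NE mulrBl mul1r divff ?gt_eqF.
  apply: le_trans (le_ln1Dx _) _; rewrite rV.
    have h : 0 <= N%:R^-1 / r by apply: divr_ge0; exact: ltW.
    by lra.
  by rewrite mulrC ler_wpM2r ?(ltW NV) // -[leLHS]mul1r ler_pdivrMr //; rewrite /r; lra.
have hL : nc ((Lhat n)%:C + (ln 4)%:C * (n == 0)%:R - (Lreg r n)%:C) <= N%:R^-1.
  rewrite /Lhat /Lreg; case: eqVneq => [_|n0].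
    by rewrite mulr1 subr0 rmorphN addNr nc0 ltW.
  have [k [k0 kE]] : exists k : nat, (0 < k)%N /\ absz n = k by exists (absz n); rewrite absz_gt0.
  have nE : `|n|%:~R = k%:R :> R by rewrite -kE natr_absz.
  have kR : 0 < k%:R :> R by rewrite ltr0n.
  rewrite mulr0 addr0 -rmorphB nc_real opprK nE kE.
  have -> : - k%:R^-1 + r ^+ k / k%:R = - ((1 - r ^+ k) / k%:R) by ring.
  have rk : r ^+ k <= 1 by apply: exprn_ile1; exact: ltW.
  rewrite normrN ger0_norm ?divr_ge0 ?subr_ge0 ?(ltW kR) // ler_pdivrMr //.
  apply: le_trans (pow_sub1_le _ _) _; first by rewrite !ltW.
  by rewrite mulrC /r opprB addrC subrK.
rewrite (_ : int01 _ - _ = int01 (fun t => (g t)%:C * cis (n%:~R * t)) -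
   ((Lhat n)%:C + (ln 4)%:C * (n == 0)%:R - (Lreg r n)%:C) * cis (n%:~R * s)); last first.
  rewrite split_g; have [->|n0] := eqVneq n 0; first by rewrite mul0r cis0; ring.
  rewrite (_ : false%:R = 0 :> R[i]) //; ring.
apply: le_trans (ncB _ _) _; rewrite ncM nc_cis mulr1.
by apply: le_trans (lerD hg hL) _; lra.
Qed.

End LogIntegral.

(** * Derivatives and integrals of trigonometric series *)

Section TrigonometricSeries.
Context {R : realType}.
Local Notation mu := (@lebesgue_measure R).
Local Notation I01 := (`[0%R : R, 1%R]%classic).

Lemma wt_int (n : int) : `|n%:~R| <= wt n :> R.
Proof. by rewrite /wt intr_norm lerDr. Qed.

Lemma sumle_wt_mono (T : choiceType) (a : T -> R[i]) (n : T -> int) (j k : nat) (C : R) :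
  (j <= k)%N -> sumle (fun x => nc (a x) * wt (n x) ^+ k) C ->
  sumle (fun x => nc (a x) * wt (n x) ^+ j) C.
Proof.
move=> jk; apply: sumle_le => x; rewrite ler_wpM2l ?nc_ge0 //.
by rewrite ler_weXn2l // wt_ge1.
Qed.

Lemma cis_taylor (y : R) : nc (cis y - 1 - 0 +i* (2 * pi * y)) <= 8 * pi ^+ 2 * y ^+ 2.
Proof.
pose th := 2 * pi * y; have cosB (z : R) : `|cos z - 1| <= z ^+ 2 / 2.
  have -> : cos z - 1 = - 2 * sin (z / 2) ^+ 2.
    rewrite {1}(_ : z = z / 2 + z / 2); last by field.
    by rewrite cosD; have := cos2Dsin2 (z / 2); lra.
  rewrite normrM normrN (ger0_norm (_ : 0 <= 2)) // normrX.
  have h := norm_sin_le (z / 2).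
  have h2 : `|sin (z / 2)| ^+ 2 <= `|z / 2| ^+ 2 by rewrite ler_pXn2r ?nnegrE.
  apply: (@le_trans _ _ (2 * `|z / 2| ^+ 2)); first by rewrite ler_wpM2l.
  by rewrite real_normK ?num_real //; lra.
have half (z : R) : 0 <= z -> `|sin z - z| <= z ^+ 2.
  move=> z0; have [c /andP[c1 c2]] := @mean_value _ (fun z => sin z - z) (fun z => cos z - 1) 0 z z0
    (fun z _ => is_deriveB (is_derive_sin z) (is_derive_id z 1)).
  rewrite sin0 !subr0 => ->; rewrite normrM (ger0_norm z0) expr2 ler_wpM2r //.
  have h : `|cos c - 1| <= `|c|.
    have [d _] := @mean_value _ cos (fun z => - sin z) 0 c c1 (fun z _ => is_derive_cos z).
    rewrite cos0 subr0 => ->; rewrite normrM normrN -[leRHS]mul1r ler_wpM2r //.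
    by rewrite ler_norml sin_geN1 sin_le1.
  by apply: le_trans h _; rewrite ger0_norm.
have sinB (z : R) : `|sin z - z| <= z ^+ 2.
  have [z0|/ltW z0] := leP 0 z; first exact: half.
  have := half (- z); rewrite oppr_ge0 sinN sqrrN -opprD normrN; exact.
apply: le_trans (nc_ReIm _) _.
rewrite !cReD !cImD !cReN !cImN /= ?subr0 ?oppr0 ?addr0 ?subr0 -/th.
apply: le_trans (lerD (cosB th) (sinB th)) _.
by have := sqr_ge0 th; rewrite /th !exprMn; lra.
Qed.

Lemma is_derive_quadratic (f : R -> R) (x l C : R) :
  (forall h, `|f (x + h) - f x - h * l| <= C * h ^+ 2) -> is_derive x 1 f l.
Proof.
move=> fC.
have H : h^-1 *: (f (h *: (1 : R) + x) - f x) @[h --> 0^'] --> l.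
  apply/cvgrPdist_le => e e0; near=> h.
  have h0 : h != 0 by near: h; exact: nbhs_dnbhs_neq.
  have C1 : 0 < `|C| + 1 by have := normr_ge0 C; lra.
  have hs : `|h| <= e / (`|C| + 1) by near: h; apply: dnbhs0_le; rewrite divr_gt0.
  have -> : l - h^-1 *: (f (h *: (1 : R) + x) - f x) = - h^-1 * (f (x + h) - f x - h * l).
    by rewrite /GRing.scale /= mulr1 [h + x]addrC; field.
  rewrite normrM normrN normfV ler_pdivrMl ?normr_gt0 //.
  apply: le_trans (fC h) _; rewrite -[h ^+ 2](@real_normK _ h) ?num_real // expr2.
  have hn := normr_ge0 h; have hC := ler_norm C.
  rewrite ler_pdivlMr // in hs.
  have : C * (`|h| * `|h|) <= (`|C| + 1) * (`|h| * `|h|) by rewrite ler_wpM2r ?mulr_ge0 //; lra.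
  have := ler_wpM2l hn hs; nra.
by apply: DeriveDef; [apply/cvg_ex; exists l|exact: cvg_lim].
Unshelve. all: by end_near. Qed.

(** Summability against [wt ^ 2] bounds the second-order Taylor remainder uniformly in the
number of terms. *)
Lemma series_derive (T : choiceType) (a : T -> R[i]) (n : T -> int) (f f' : R -> R[i]) (C : R) :
  sumle (fun x => nc (a x) * wt (n x) ^+ 2) C ->
  (forall t, hasSum (fun x => a x * cis ((n x)%:~R * t)) (f t)) ->
  (forall t, hasSum (fun x => (0 +i* (2 * pi * (n x)%:~R)) * a x * cis ((n x)%:~R * t)) (f' t)) ->
  forall t : R, is_derive t (1 : R) (fun y => re (f y)) (re (f' t)) /\
            is_derive t (1 : R) (fun y => im (f y)) (im (f' t)).
Proof.
move=> aC hf hf' t.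
have bound h : nc (f (t + h) - f t - h%:C * f' t) <= (8 * pi ^+ 2 * C) * h ^+ 2.
  have hs := hasSumB (hasSumB (hf (t + h)) (hf t)) (hasSumZ h%:C (hf' t)).
  apply: hasSum_bound hs _.
  rewrite (_ : _ * _ * _ = (8 * pi ^+ 2 * h ^+ 2) * C); last by ring.
  have p0 : 0 <= 8 * pi ^+ 2 * h ^+ 2 :> R by apply: mulr_ge0; [apply: mulr_ge0|]; rewrite ?sqr_ge0.
  apply: sumle_le (sumleZ p0 aC) => x.
  rewrite (_ : _ - _ = a x * cis ((n x)%:~R * t) *
      (cis ((n x)%:~R * h) - 1 - 0 +i* (2 * pi * ((n x)%:~R * h)))); last first.
    rewrite mulrDr cisD.
    have -> : 0 +i* (2 * pi * ((n x)%:~R * h)) = (0 +i* (2 * pi * (n x)%:~R)) * h%:C :> R[i].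
      by apply: complex_eq; rewrite ?cReM ?cImM /=; ring.
    by ring.
  rewrite !ncM nc_cis mulr1.
  apply: le_trans (ler_wpM2l (nc_ge0 _) (cis_taylor _)) _.
  rewrite [leLHS](_ : _ = (8 * pi ^+ 2 * h ^+ 2) * (nc (a x) * (n x)%:~R ^+ 2)); last by ring.
  rewrite ler_wpM2l // ler_wpM2l ?nc_ge0 // -[(n x)%:~R ^+ 2]real_normK ?num_real //.
  by rewrite ler_pXn2r ?nnegrE ?wt_int // ltW // wt_gt0.
split; apply: (@is_derive_quadratic _ _ _ (8 * pi ^+ 2 * C)) => h.
  apply: le_trans (bound h); rewrite [_%:C * _]mulrC.
  by apply: le_trans (nc_Re _); rewrite !cReD !cReN Re_mulr_real mulrC.
apply: le_trans (bound h); rewrite [_%:C * _]mulrC.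
by apply: le_trans (nc_Im _); rewrite !cImD !cImN Im_mulr_real mulrC.
Qed.

Lemma series_opD (T : choiceType) (a : T -> R[i]) (n : T -> int) (f : R -> R[i]) (C : R) :
  sumle (fun x => nc (a x) * wt (n x) ^+ 2) C ->
  (forall t, hasSum (fun x => a x * cis ((n x)%:~R * t)) (f t)) ->
  forall t, hasSum (fun x => (0 +i* (2 * pi * (n x)%:~R)) * a x * cis ((n x)%:~R * t)) (opD f t).
Proof.
move=> aC hf.
have ex t : exists S, hasSum (fun x => (0 +i* (2 * pi * (n x)%:~R)) * a x * cis ((n x)%:~R * t)) S.
  apply: (@hasSum_exists _ _ _ ((2 * pi) * C)); rewrite -/(wt _).
  have p0 : 0 <= 2 * pi :> R by rewrite mulr_ge0 ?pi_ge0.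
  apply: sumle_le (sumleZ p0 (sumle_wt_mono (isT : (1 <= 2)%N) aC)) => x.
  rewrite !ncM nc_cis mulr1 expr1 ncE /= expr0n add0r sqrtr_sqr normrM (ger0_norm p0).
  by rewrite -[leLHS]mulrA ler_wpM2l // mulrC ler_wpM2l ?nc_ge0 ?wt_int.
have [f' hf'] := choice ex.
move=> t; have [d1 d2] := series_derive aC hf hf' t.
suff -> : opD f t = f' t by exact: hf'.
by apply: complex_eq; rewrite /= derive1E derive_val.
Qed.

(** The weight [wt] makes the sum Lipschitz, hence measurable; the tails are then small
uniformly on the period. *)
Lemma int01_series (T : choiceType) (g : R -> R) (a : T -> R[i]) (n : T -> int)
    (psi : R -> R[i]) (ghat : int -> R[i]) (C : R) :
  rint g -> (forall m, int01 (fun t => (g t)%:C * cis (m%:~R * t)) = ghat m) ->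
  sumle (fun x => nc (a x) * wt (n x)) C ->
  (forall t, hasSum (fun x => a x * cis ((n x)%:~R * t)) (psi t)) ->
  cint (fun t => (g t)%:C * psi t) /\
  hasSum (fun x => a x * ghat (n x)) (int01 (fun t => (g t)%:C * psi t)).
Proof.
move=> ig hg aC hpsi.
have mg : measurable_fun I01 g by have /integrableP[/measurable_EFinP] := ig.
have aC0 : sumle (fun x => nc (a x)) C.
  by apply: sumle_le aC => x; rewrite ler_peMr ?nc_ge0 ?wt_ge1.
have cmeasM (f : R -> R[i]) : cmeas f -> cmeas (fun t => (g t)%:C * f t).
  move=> [m1 m2]; split.
    rewrite (_ : (fun x => _) = fun x => re (f x) * g x); first exact: measurable_funM.
    by apply/funext => x; rewrite mulrC Re_mulr_real.
  rewrite (_ : (fun x => _) = fun x => im (f x) * g x); first exact: measurable_funM.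
  by apply/funext => x; rewrite mulrC Im_mulr_real.
have psi_lip : lip psi.
  exists (2 * pi * C) => [|t t']; first by rewrite mulr_ge0 ?mulr_ge0 ?pi_ge0 ?(sumle_ge0 aC).
  apply: hasSum_bound (hasSumB (hpsi t) (hpsi t')) _.
  rewrite (_ : _ * _ * _ = (2 * pi * `|t - t'|) * C); last by ring.
  have p0 : 0 <= 2 * pi * `|t - t'| :> R by rewrite !mulr_ge0 ?pi_ge0.
  apply: sumle_le (sumleZ p0 aC) => x; rewrite -mulrBr ncM.
  apply: le_trans (ler_wpM2l (nc_ge0 _) (lip_cis _ _ _)) _.
  rewrite [leLHS](_ : _ = (2 * pi * `|t - t'|) * (nc (a x) * `|(n x)%:~R|)); last by ring.
  by rewrite ler_wpM2l // ler_wpM2l ?nc_ge0 ?wt_int.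
have cintM (f : R -> R[i]) (B : R) : lip f -> (forall t, nc (f t) <= B) -> cint (fun t => (g
  t)%:C * f t).
  move=> lf fB; apply: (cint_le _ (rintZ B (integrable_norm ig))).
    by apply: cmeasM; exact: lip_meas.
  by move=> t _; rewrite ncM nc_real mulrC ler_wpM2r.
have cpsi : cint (fun t => (g t)%:C * psi t).
  by apply: (cintM _ C) => // t; apply: hasSum_bound (hpsi t) _;
    apply: sumle_le aC0 => x; rewrite ncM nc_cis mulr1.
split => // e e0.
pose G := \int[mu]_(t in I01) `|g t|.
have G0 : 0 <= G by apply: Rintegral_ge0 => t _; exact: normr_ge0.
have e'0 : 0 < e / (2 * (G + 1)) by rewrite divr_gt0 // mulr_gt0 //; lra.
have [s0 us0 tail] := sumle_tail (fun x => nc_ge0 (a x)) aC0 e'0.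
exists s0 => // s us ss.
have cterm x : cint (fun t => (g t)%:C * (a x * cis ((n x)%:~R * t))).
  apply: (cintM _ (nc (a x))) => [|t]; last by rewrite ncM nc_cis mulr1.
  exists (nc (a x) * (2 * pi * `|(n x)%:~R|)) => [|y z].
    by rewrite mulr_ge0 ?nc_ge0 // !mulr_ge0 ?pi_ge0.
  by rewrite -mulrBr ncM -[leRHS]mulrA ler_wpM2l ?nc_ge0 ?lip_cis.
have [cs intS] := int01_sum s cterm.
have -> : \sum_(x <- s) a x * ghat (n x) =
    int01 (fun t => \sum_(x <- s) (g t)%:C * (a x * cis ((n x)%:~R * t))).
  rewrite intS; apply: eq_bigr => x _; rewrite -hg -int01Z; last first.
    by apply: (cintM _ 1) => [|t]; [exists (2 * pi * `|(n x)%:~R|); [rewrite !mulr_ge0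
      ?pi_ge0|exact: lip_cis]|rewrite nc_cis].
  by congr int01; apply/funext => t; rewrite mulrCA.
rewrite -mulN1r -int01Z // -int01D //; last exact: cintZ.
have -> : (fun x => \sum_(y <- s) (g x)%:C * (a y * cis ((n y)%:~R * x)) + -1 * ((g x)%:C * psi
  x)) =
   fun t => (g t)%:C * (\sum_(y <- s) a y * cis ((n y)%:~R * t) - psi t).
  by apply/funext => t; rewrite -mulr_sumr mulN1r mulrBr.
have dl : lip (fun t => \sum_(y <- s) a y * cis ((n y)%:~R * t) - psi t).
  have [L L0 hL] := psi_lip.
  exists (2 * pi * C + L) => [|t t']; first by rewrite addr_ge0 // mulr_ge0 ?mulr_ge0 ?pi_ge0
    ?(sumle_ge0 aC).
  rewrite [X in nc X](_ : _ = (\sum_(y <- s) a y * cis ((n y)%:~R * t) - \sum_(y <- s) a y * cis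
    ((n y)%:~R * t')) - (psi t - psi t')); last by ring.
  rewrite -sumrB mulrDl; apply: le_trans (ncB _ _) _; apply: lerD => //.
  apply: le_trans (nc_sum _ _ _) _.
  rewrite (_ : _ * C * _ = (2 * pi * `|t - t'|) * C); last by ring.
  have p0 : 0 <= 2 * pi * `|t - t'| :> R by rewrite !mulr_ge0 ?pi_ge0.
  apply: le_trans (sumleZ p0 aC us); apply: ler_sum => x _; rewrite -mulrBr ncM.
  apply: le_trans (ler_wpM2l (nc_ge0 _) (lip_cis _ _ _)) _.
  rewrite [leLHS](_ : _ = (2 * pi * `|t - t'|) * (nc (a x) * `|(n x)%:~R|)); last by ring.
  by rewrite ler_wpM2l // ler_wpM2l ?nc_ge0 ?wt_int.
apply: le_trans (nc_int01_le (cmeasM _ (lip_meas dl)) (rintZ (e / (2 * (G + 1))) (integrable_norm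
  ig)) _) _.
  move=> t _; rewrite ncM nc_real mulrC ler_wpM2r // ncC.
  apply: (hasSum_tail (hpsi t) (B := fun x => nc (a x))) => // [x|s' us' h].
    by rewrite ncM nc_cis mulr1.
  apply: tail => // x xs'; apply/negP => /ss; apply/negP; exact: h.
rewrite RintegralZl //; last exact: integrable_norm.
rewrite -/G; have -> : 2 * (e / (2 * (G + 1)) * G) = e * (G / (G + 1)) by field; rewrite gt_eqF
  //; lra.
by rewrite ler_piMr ?(ltW e0) // ler_pdivrMr; lra.
Qed.

End TrigonometricSeries.

(** * Kernels with a logarithmic singularity *)

Section KernelSeries.
Context {R : realType}.
Local Notation mu := (@lebesgue_measure R).
Local Notation I01 := (`[0%R : R, 1%R]%classic).

Definition rapid1 (c : int -> R[i]) := forall k, exists2 C : R, 0 <= C &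
  forall l, nc (c l) <= C / wt l ^+ k.

Lemma hasSum_prod (T1 T2 : choiceType) (f : T1 -> R[i]) (g : T2 -> R[i]) S S' (C C' : R) :
  sumle (fun x => nc (f x)) C -> sumle (fun x => nc (g x)) C' ->
  hasSum f S -> hasSum g S' -> hasSum (fun z : T1 * T2 => f z.1 * g z.2) (S * S').
Proof.
move=> fC gC hf hg.
have [|S2 h2] := @hasSum_exists _ _ (fun z : T1 * T2 => f z.1 * g z.2) (C * C').
  apply: sumle_le (sumle_prod (fun x => nc_ge0 (f x)) (fun x => nc_ge0 (g x)) fC gC).
  by move=> z; rewrite ncM.
have h := hasSum_sigma h2 (fun x => hasSumZ (f x) hg).
suff <- : S2 = S * S' by [].
apply: (hasSum_unique h); have := hasSumZ S' hf; rewrite mulrC.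
by congr hasSum; apply/funext => x; rewrite mulrC.
Qed.

Lemma sumle_dom (F : (int * int) * int -> R) (C : R) : 0 <= C ->
  (forall z, F z <= C / (wt z.1.1 * wt z.1.2 * wt z.2) ^+ 2) -> sumle F (C * (4 * 4 * 4)).
Proof.
move=> C0 FC.
have w0 (p : int) : 0 <= (wt p ^+ 2)^-1 :> R by rewrite invr_ge0 exprn_ge0 // ltW // wt_gt0.
have h2 := sumle_prod w0 w0 (@sumle_wt R) (@sumle_wt R).
have w20 (x : int * int) : 0 <= (wt x.1 ^+ 2)^-1 * (wt x.2 ^+ 2)^-1 :> R by rewrite mulr_ge0.
apply: sumle_le (sumleZ C0 (sumle_prod w20 w0 h2 (@sumle_wt R))) => z.
by apply: le_trans (FC z) _; rewrite !exprMn !invfM.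
Qed.

Lemma sumle_dom_shift (F : (int * int) * int -> R) (C : R) : 0 <= C ->
  (forall z, F z <= C / (wt z.1.1 * wt z.1.2 * wt (z.2 - z.1.2)) ^+ 2) -> sumle F (C * (4 * 4 * 4)).
Proof.
move=> C0 FC; pose G z := C / (wt z.1.1 * wt z.1.2 * wt z.2) ^+ 2 : R.
have hG : sumle (fun z : (int * int) * int => G (z.1, z.2 - z.1.2)) (C * (4 * 4 * 4)).
  apply: (@sumle_reindex _ _ _ (fun z : (int * int) * int => (z.1, z.2 - z.1.2)) G).
    by move=> [x m] [y n] [-> /addIr ->].
  by apply: sumle_dom.
by apply: sumle_le hG => z; exact: FC.
Qed.

Lemma rapid1_sumle (c : int -> R[i]) (j : nat) : rapid1 c -> exists2 C : R, 0 <= C &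
  sumle (fun l => nc (c l) * wt l ^+ j) C.
Proof.
move=> /(_ (j + 2)%N) [C C0 cC]; exists (C * 4); first by rewrite mulr_ge0.
apply: sumle_le (sumleZ C0 (@sumle_wt R)) => l.
have w0 := @wt_gt0 R l.
apply: le_trans (ler_wpM2r (ltW (exprn_gt0 j w0)) (cC l)) _.
by rewrite exprD invfM mulrA mulrAC mulfVK // gt_eqF // exprn_gt0.
Qed.

Lemma rapid1_deriv (c : int -> R[i]) : rapid1 c ->
  rapid1 (fun l => (0 +i* (2 * pi * l%:~R)) * c l).
Proof.
move=> cr k; have [C C0 cC] := cr k.+1; exists (2 * pi * C); first by rewrite !mulr_ge0 ?pi_ge0.
move=> l; have w0 := @wt_gt0 R l.
rewrite ncM ncE /= expr0n add0r sqrtr_sqr normrM (ger0_norm (_ : 0 <= 2 * pi)); last by rewrite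
  mulr_ge0 ?pi_ge0.
rewrite -!mulrA ler_wpM2l // ler_wpM2l ?pi_ge0 //.
apply: le_trans (ler_pM (normr_ge0 _) (nc_ge0 _) (wt_int l) (cC l)) _.
rewrite exprS invfM; have -> : wt l * (C * ((wt l)^-1 * (wt l ^+ k)^-1)) = C / wt l ^+ k * (wt l
  / wt l) :> R by ring.
by rewrite divff ?gt_eqF // mulr1.
Qed.

Lemma rapid1_opD (c : int -> R[i]) (f : R -> R[i]) : rapid1 c ->
  (forall t, hasSum (fun l : int => c l * cis (l%:~R * t)) (f t)) ->
  forall t, hasSum (fun l : int => (0 +i* (2 * pi * l%:~R)) * c l * cis (l%:~R * t)) (opD f t).
Proof. by move=> /(rapid1_sumle 2)[C _ cC] hf; exact: (series_opD cC). Qed.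

Lemma rapid1_smooth (c : int -> R[i]) (f : R -> R[i]) : rapid1 c ->
  (forall t, hasSum (fun l : int => c l * cis (l%:~R * t)) (f t)) -> calD f.
Proof.
move=> cr hf.
have iter n : exists c' f', [/\ rapid1 c',
    forall t, hasSum (fun l : int => c' l * cis (l%:~R * t)) (f' t),
    derive1n n (fun x => re (f x)) = (fun x => re (f' x)) &
    derive1n n (fun x => im (f x)) = (fun x => im (f' x))].
  elim: n => [|n [c' [f' [r' h' e1 e2]]]]; first by exists c, f; rewrite !derive1n0.
  exists (fun l => (0 +i* (2 * pi * l%:~R)) * c' l), (opD f'); split.
  - exact: rapid1_deriv.
  - exact: rapid1_opD.
  - by rewrite derive1nS e1.
  - by rewrite derive1nS e2.
split.
- move=> n x; have [c' [f' [r' h' -> _]]] := iter n.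
  have [C _ cC] := rapid1_sumle 2 r'.
  by have [[]] := series_derive cC h' (rapid1_opD r' h') x.
- move=> n x; have [c' [f' [r' h' _ ->]]] := iter n.
  have [C _ cC] := rapid1_sumle 2 r'.
  by have [_ []] := series_derive cC h' (rapid1_opD r' h') x.
move=> t; apply: hasSum_unique (hf (t + 1)) _.
have := hf t; congr hasSum; apply/funext => l; congr (_ * _).
by rewrite mulrDr mulr1 cisDz.
Qed.

(** A Fourier expansion of a kernel with logarithmic singularity in which the coefficients of
[lnk] are split as [u + v * cis]: the family [u] sums to zero. Choosing [u] to cancel [v] off
the zero frequency is what isolates the leading part of the kernel. *)
Definition kernel_series (A K : R -> R -> R[i]) (u v k : int * int -> R[i]) :=
  [/\ rapid2 u, rapid2 v & rapid2 k] /\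
  [/\ forall t, hasSum (fun x => u x * cis (x.2%:~R * t)) 0,
      forall s t, hasSum (fun x => v x * cis (x.1%:~R * (s - t)) * cis (x.2%:~R * t))
        ((0 +i* (2 * pi)^-1) * A s t) &
      forall s t, hasSum (fun x => k x * cis (x.1%:~R * (s - t)) * cis (x.2%:~R * t)) (K s t)].

(** The component [x] of the kernel maps the character of frequency [m - x.2] to [csymb x m]
times the character of frequency [m]. *)
Definition csymb (u v k : int * int -> R[i]) (x : int * int) (m : int) : R[i] :=
  u x * (Lhat m)%:C + v x * (Lhat (m - x.1))%:C + k x * (m == x.1)%:R.

(** Decay in the kernel index only, uniformly in the frequency. *)
Definition rapid3 (F : int * int -> int -> R[i]) := forall j, exists2 C : R, 0 <= C &
  forall x m, nc (F x m) <= C / (wt x.1 * wt x.2) ^+ j.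

Lemma Lhat_le (m : int) : `|Lhat m| <= ln 4 + 1 :> R.
Proof.
have l4 : 0 <= ln (4 : R) by apply: ln_ge0; rewrite ler1n.
rewrite /Lhat; case: eqVneq => [_|m0]; first by rewrite normrN ger0_norm //; lra.
rewrite normrN ger0_norm ?invr_ge0 ?ler0z //.
have h : 1 <= `|m|%:~R :> R by rewrite -[1]/(1%:~R) ler_int; move: m0; clear; lia.
by have : `|m|%:~R^-1 <= 1 :> R by [rewrite invf_le1 //; lra]; lra.
Qed.

Lemma csymb_rapid u v k : rapid2 u -> rapid2 v -> rapid2 k -> rapid3 (csymb u v k).
Proof.
move=> ur vr kr j; have [Cu Cu0 hu] := ur j; have [Cv Cv0 hv] := vr j; have [Ck Ck0 hk] := kr j.
have l4 : 0 <= ln (4 : R) by apply: ln_ge0; rewrite ler1n.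
exists (Cu * (ln 4 + 1) + Cv * (ln 4 + 1) + Ck) => [|x m].
  by rewrite !addr_ge0 // mulr_ge0 //; lra.
rewrite [leRHS]mulrDl [X in _ <= X + _]mulrDl; apply: le_trans (ncD _ _) _; apply: lerD.
  apply: le_trans (ncD _ _) _; rewrite !ncM !nc_real.
  by apply: lerD; rewrite mulrAC; apply: ler_pM; rewrite ?nc_ge0 ?normr_ge0 ?Lhat_le.
rewrite ncM; apply: le_trans (hk x); rewrite ler_piMr ?nc_ge0 //.
by case: (m == x.1); rewrite ?nc1 ?nc0 ?ler01.
Qed.

Lemma rapid2_weighted (a : int * int -> R[i]) (j : nat) : rapid2 a -> exists2 C : R, 0 <= C &
  sumle (fun x => nc (a x) * (wt x.1 * wt x.2) ^+ j) C.
Proof.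
move=> /(_ (j + 2)%N)[C C0 hC]; exists (C * (4 * 4)); first by rewrite !mulr_ge0.
have w0 (p : int) : 0 <= (wt p ^+ 2)^-1 :> R by rewrite invr_ge0 exprn_ge0 // ltW // wt_gt0.
apply: sumle_le (sumleZ C0 (sumle_prod w0 w0 (@sumle_wt R) (@sumle_wt R))) => x.
have w : 0 < (wt x.1 * wt x.2) ^+ j :> R by rewrite exprn_gt0 // mulr_gt0 ?wt_gt0.
apply: le_trans (ler_wpM2r (ltW w) (hC x)) _.
rewrite (_ : _ * _ ^+ j = C / (wt x.1 * wt x.2) ^+ 2); first by rewrite exprMn invfM.
by rewrite exprD; field; rewrite !gt_eqF ?wt_gt0.
Qed.

Lemma wt3_dom (a : int * int -> R[i]) (c : int -> R[i]) (j : nat) : rapid2 a -> rapid1 c ->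
  exists2 C : R, 0 <= C & sumle (fun z : (int * int) * int =>
    nc (a z.1) * nc (c z.2) * (wt z.1.1 * wt z.1.2 * wt z.2) ^+ j) C.
Proof.
move=> /(_ (j + 2)%N)[C C0 hC] /(_ (j + 2)%N)[D D0 hD].
exists (C * D * (4 * 4 * 4)); first by rewrite !mulr_ge0.
apply: sumle_dom; first by rewrite mulr_ge0.
move=> [x l] /=; set w := wt x.1 * wt x.2.
have w0 : 0 < w by rewrite mulr_gt0 ?wt_gt0.
have wl0 : 0 < wt l :> R by exact: wt_gt0.
have ww : 0 < (w * wt l) ^+ j by rewrite exprn_gt0 // mulr_gt0.
apply: le_trans (ler_wpM2r (ltW ww) (ler_pM (nc_ge0 _) (nc_ge0 _) (hC x) (hD l))) _.
rewrite -/w (_ : C / w ^+ (j + 2) * (D / wt l ^+ (j + 2)) = C * D / (w * wt l) ^+ (j + 2)).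
  by rewrite exprD invfM mulrA mulrAC mulfVK // gt_eqF.
by rewrite [in RHS]exprMn [in RHS]invfM; ring.
Qed.

(** Each component of the kernel is a Fourier multiplier composed with a shift of the
frequency; [u], [v] and [k] are integrated separately by [int01_series]. *)
Lemma opV_series A K u v k (c : int -> R[i]) (f : R -> R[i]) (s : R) :
  kernel_series A K u v k -> rapid1 c ->
  (forall t, hasSum (fun l : int => c l * cis (l%:~R * t)) (f t)) ->
  hasSum (fun z : (int * int) * int => csymb u v k z.1 z.2 * c (z.2 - z.1.2) * cis (z.2%:~R * s))
    (opV (log_kernel A K) f s).
Proof.
move=> [[ur vr kr] [hU hA hK]] cr hf.
have [Cc _ cC] := rapid1_sumle 0 cr.
have cC' t : sumle (fun l : int => nc (c l * cis (l%:~R * t))) Cc.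
  by apply: sumle_le cC => l; rewrite expr0 mulr1 ncM nc_cis mulr1.
have key (a : int * int -> R[i]) (g : R -> R) (ghat : int -> R[i]) (q : int * int -> int)
    (w : R -> R[i]) : rapid2 a ->
    (forall x, wt (q x) <= wt x.1 :> R) ->
    rint g -> (forall m, int01 (fun t => (g t)%:C * cis (m%:~R * t)) = ghat m) ->
    (forall t, hasSum (fun x => a x * cis ((q x)%:~R * (s - t)) * cis (x.2%:~R * t)) (w t)) ->
    cint (fun t => (g t)%:C * (w t * f t)) /\
    hasSum (fun z : (int * int) * int => a z.1 * cis ((q z.1)%:~R * s) * c z.2 * ghat (z.1.2 +
      z.2 - q z.1))
      (int01 (fun t => (g t)%:C * (w t * f t))).
  move=> ar hq ig hg hw.
  have [C C0 dom] := wt3_dom 1 ar cr.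
  apply: (@int01_series _ _ g (fun z : (int * int) * int => a z.1 * cis ((q z.1)%:~R * s) * c z.2)
    (fun z => z.1.2 + z.2 - q z.1) (fun t => w t * f t) ghat C) => //.
    apply: sumle_le dom => -[x l] /=; rewrite !ncM nc_cis mulr1 expr1 ler_wpM2l ?mulr_ge0 ?nc_ge0
      //.
    apply: le_trans (wtD _ _) _; rewrite wtN mulrC -mulrA ler_pM ?(ltW (wt_gt0 _)) //.
    exact: wtD.
  move=> t; have [Ca _ aC] := rapid2_weighted 0 ar.
  have aC' : sumle (fun x => nc (a x * cis ((q x)%:~R * (s - t)) * cis (x.2%:~R * t))) Ca.
    by apply: sumle_le aC => x; rewrite !ncM !nc_cis expr0 !mulr1.
  have := hasSum_prod aC' (cC' t) (hw t) (hf t); congr hasSum; apply/funext => -[x l] /=.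
  have -> : (x.2 + l - q x)%:~R * t = x.2%:~R * t + (l%:~R * t - (q x)%:~R * t) :> R.
    by rewrite !rmorphD rmorphN /=; ring.
  by rewrite mulrBr !cisD; ring.
have lnkg m : int01 (fun t => (lnk (s - t))%:C * cis (m%:~R * t)) = (Lhat m)%:C * cis (m%:~R * s)
  by exact: int01_lnk_cis.
have oneg m : int01 (fun t => (1 : R)%:C * cis (m%:~R * t)) = (m == 0)%:R :> R[i].
  by rewrite -int01_cis; congr int01; apply/funext => t; rewrite mul1r.
have [] := key u _ _ (fun=> 0) (fun=> 0) ur _ (rint_lnk s) lnkg.
- by move=> x; rewrite {1}/wt normr0 addr0 wt_ge1.
- by move=> t; have := hU t; congr hasSum; apply/funext => x; rewrite mul0r cis0 mulr1.
move=> c1 h1.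
have [] := key v _ _ fst _ vr _ (rint_lnk s) lnkg (hA s); first by move=> x.
move=> c2 h2.
have [] := key k _ _ fst _ kr _ (rint_cst 1) oneg (hK s); first by move=> x.
move=> c3 h3.
have := hasSumD (hasSumD h1 h2) h3.
rewrite -int01D // -int01D //; last exact: cintD.
have -> : (fun x : R => (lnk (s - x))%:C * (0 * f x) + (lnk (s - x))%:C * ((0 +i* (2 * pi)^-1) *
  A s x * f x) + 1%:C * (K s x * f x)) =
   fun t => log_kernel A K s t * f t.
  by apply/funext => t; rewrite /log_kernel -/(lnk _) rmorph1; ring.
rewrite -/(opV (log_kernel A K) f s) => h.
have := @hasSum_reindex _ _ _ (fun z : (int * int) * int => (z.1, z.2 - z.1.2)) (fun z => (z.1,
  z.2 + z.1.2)) _ _ _ _ h.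
move=> /(_ _ _)/wrap[]; [by move=> [x m] /=; rewrite subrK|by move=> [x m] /=; rewrite addrK|].
congr hasSum; apply/funext => -[x m] /=; rewrite /csymb.
rewrite (_ : x.2 + (m - x.2) = m); last by rewrite addrC subrK.
rewrite subr0 mul0r cis0 mulr1 subr_eq0.
have -> : (m - x.1)%:~R * s = m%:~R * s - x.1%:~R * s by rewrite rmorphB /=; ring.
have E : cis (x.1%:~R * s) * cis (m%:~R * s - x.1%:~R * s) = cis (m%:~R * s).
  by rewrite -cisD addrC subrK.
rewrite -E; case: eqVneq => [->|_] /=; last by ring.
by rewrite mulr1 subrr cis0; ring.
Qed.

End KernelSeries.

(** * The rows of the integro-differential operator *)

Section LimitEquation.
Context {R : realType}.

Lemma hasSum_swap (F : (int * int) * int -> R[i]) (S : R[i]) (g : int -> R[i]) :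
  hasSum F S -> (forall m, hasSum (fun x => F (x, m)) (g m)) -> hasSum g S.
Proof.
move=> hF hg.
have h : hasSum (fun z : int * (int * int) => F (z.2, z.1)) S.
  by apply: (@hasSum_reindex _ _ _ (fun z : int * (int * int) => (z.2, z.1)) (fun z => (z.2,
    z.1))) hF => -[].
exact: hasSum_sigma h hg.
Qed.

Variables (A1 K1 A2 K2 : R -> R -> R[i]) (u1 v1 k1 u2 v2 k2 : int * int -> R[i]).
Hypothesis (ks1 : kernel_series A1 K1 u1 v1 k1) (ks2 : kernel_series A2 K2 u2 v2 k2).

(** The first kernel is differentiated on both sides, which multiplies its symbol by the two
frequencies that it connects. *)
Definition crow (m : int) (x : int * int) : R[i] :=
  (4 * pi ^+ 2 * m%:~R * (m - x.2)%:~R)%:C * csymb u1 v1 k1 x m + csymb u2 v2 k2 x m.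

Lemma csymb_dom (F : int * int -> int -> R[i]) (c : int -> R[i]) (j : nat) :
  rapid3 F -> rapid1 c -> exists2 C : R, 0 <= C &
  sumle (fun z : (int * int) * int => nc (F z.1 z.2) * nc (c (z.2 - z.1.2)) * wt z.2 ^+ j) C.
Proof.
move=> /(_ (j + 2)%N)[C C0 hC] /(_ (j + 2)%N)[D D0 hD].
exists (C * D * (4 * 4 * 4)); first by rewrite !mulr_ge0.
apply: sumle_dom_shift; first by rewrite mulr_ge0.
move=> [x m] /=; set w := wt x.1 * wt x.2; set l := m - x.2.
have w0 : 0 < w by rewrite mulr_gt0 ?wt_gt0.
have wl0 : 0 < wt l :> R by exact: wt_gt0.
have ww : 0 < (w * wt l) ^+ j by rewrite exprn_gt0 // mulr_gt0.
have wm : wt m ^+ j <= (w * wt l) ^+ j.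
  apply: lerXn2r; rewrite ?nnegrE ?(ltW (wt_gt0 _)) ?(mulr_ge0 (ltW w0) (ltW wl0)) //.
  rewrite (_ : m = x.2 + l); last by rewrite /l addrC subrK.
  apply: le_trans (wtD _ _) _; rewrite ler_wpM2r ?(ltW wl0) // /w.
  by rewrite ler_peMl ?wt_ge1 // ltW // wt_gt0.
apply: le_trans (ler_pM _ _ (ler_pM (nc_ge0 _) (nc_ge0 _) (hC x m) (hD l)) wm) _.
- by rewrite mulr_ge0 ?nc_ge0.
- by rewrite exprn_ge0 // ltW // wt_gt0.
rewrite -/w (_ : C / w ^+ (j + 2) * (D / wt l ^+ (j + 2)) = C * D / (w * wt l) ^+ (j + 2)).
  by rewrite exprD invfM mulrA mulrAC mulfVK // gt_eqF.
by rewrite [in RHS]exprMn [in RHS]invfM; ring.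
Qed.

(** Termwise, the integro-differential operator acts on Fourier coefficients through [crow]. *)
Lemma opW_series (c : int -> R[i]) (f : R -> R[i]) (s : R) : rapid1 c ->
  (forall t, hasSum (fun l : int => c l * cis (l%:~R * t)) (f t)) ->
  hasSum (fun z : (int * int) * int => crow z.2 z.1 * c (z.2 - z.1.2) * cis (z.2%:~R * s))
    (opW (log_kernel A1 K1) (log_kernel A2 K2) f s).
Proof.
move=> cr hf.
have [[ur vr kr] _] := ks1.
have [C C0 dom] := csymb_dom 2 (csymb_rapid ur vr kr) (rapid1_deriv cr).
have dom' : sumle (fun z : (int * int) * int => nc (csymb u1 v1 k1 z.1 z.2 *
    ((0 +i* (2 * pi * (z.2 - z.1.2)%:~R)) * c (z.2 - z.1.2))) * wt z.2 ^+ 2) C.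
  by apply: sumle_le dom => z; rewrite ncM.
have h1 := series_opD dom' (fun t => opV_series t ks1 (rapid1_deriv cr) (rapid1_opD cr hf)) s.
have := hasSumD (hasSumZ (-1) h1) (opV_series s ks2 cr hf).
rewrite mulN1r -/(opW (log_kernel A1 K1) (log_kernel A2 K2) f s).
congr hasSum; apply/funext => -[x m] /=; rewrite /crow.
have -> : (4 * pi ^+ 2 * m%:~R * (m - x.2)%:~R)%:C =
   - ((0 +i* (2 * pi * m%:~R)) * (0 +i* (2 * pi * (m - x.2)%:~R))) :> R[i].
  by apply: complex_eq; rewrite ?cReN ?cImN ?cReM ?cImM /=; ring.
by ring.
Qed.

(** A rapidly decreasing solution of the limiting row equations is the Fourier family of a smooth
solution of [opW f = 0]. *)
Lemma row_solution_eq0 (c : int -> R[i]) :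
  (forall phi : R -> R[i], calD phi ->
     (forall s, opW (log_kernel A1 K1) (log_kernel A2 K2) phi s = 0) -> forall s, phi s = 0) ->
  rapid1 c -> (forall m, hasSum (fun x => crow m x * c (m - x.2)) 0) -> forall m, c m = 0.
Proof.
move=> hW cr rowE m.
have [C _ cC] := rapid1_sumle 1 cr.
have ex t : exists S, hasSum (fun l : int => c l * cis (l%:~R * t)) S.
  apply: (@hasSum_exists _ _ _ C); apply: sumle_le cC => l.
  by rewrite ncM nc_cis mulr1 ler_peMr ?nc_ge0 // expr1 wt_ge1.
have [f hf] := choice ex.
have f0 s : f s = 0.
  apply: hW; first exact: rapid1_smooth cr hf.
  move=> {}s; apply: hasSum_unique (hasSum_swap (opW_series s cr hf) (g := fun=> 0) _) _.
    by move=> n; have := hasSumZ (cis (n%:~R * s)) (rowE n); rewrite mulr0;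
      congr hasSum; apply/funext => x; rewrite mulrC.
  exact: hasSum0.
have int1 n : int01 (fun t => (1 : R)%:C * cis (n%:~R * t)) = (n == 0)%:R :> R[i].
  by rewrite -int01_cis; congr int01; apply/funext => t; rewrite mul1r.
have [C' _ cC'] := rapid1_sumle 1 cr.
have [||_] := @int01_series _ _ (fun=> 1) c (fun l => l - m) (fun t => 0) _ (C' * wt m) (rint_cst
  1) int1.
- have wm : 0 <= wt m :> R by rewrite ltW ?wt_gt0.
  rewrite mulrC; apply: sumle_le (sumleZ wm cC') => l.
  by rewrite expr1 mulrCA ler_wpM2l ?nc_ge0 // mulrC -[wt m]wtN wtD.
- move=> t; have := hasSumZ (cis (- (m%:~R * t))) (hf t); rewrite f0 mulr0.
  congr hasSum; apply/funext => l.
  by rewrite mulrCA -cisD rmorphB /= mulrBl addrC.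
rewrite (_ : (fun t : R => 1%:C * 0) = fun=> 0); last by apply/funext => t; rewrite mulr0.
rewrite int010 => h; apply/esym; apply: (hasSum_unique h).
rewrite (_ : c m = \sum_(l <- [:: m]) c l * (l - m == 0)%:R); last first.
  by rewrite big_seq1 subrr eqxx mulr1.
by apply: hasSum_finite => // l; rewrite inE subr_eq0 => /negbTE ->; rewrite mulr0.
Qed.

End LimitEquation.

(** * The rows of the collocation matrix *)

Section DiscreteEquation.
Context {R : realType}.

Definition kterm (u v k : int * int -> R[i]) (x : int * int) (s t : R) : R[i] :=
  ((u x + v x * cis (x.1%:~R * (s - t))) * (lnk (s - t))%:C + k x * cis (x.1%:~R * (s - t)))
  * cis (x.2%:~R * t).

Lemma kernel_expansion A K (u v k : int * int -> R[i]) s t : kernel_series A K u v k ->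
  hasSum (fun x => kterm u v k x s t) (log_kernel A K s t).
Proof.
move=> [_ [hU hA hK]].
have := hasSumD (hasSumZ ((lnk (s - t))%:C) (hasSumD (hU t) (hA s t))) (hK s t).
rewrite /log_kernel -/(lnk (s - t)) add0r [_%:C * (_ * _)]mulrC.
by congr hasSum; apply/funext => x; rewrite /kterm; ring.
Qed.

Variables (N : nat) (N0 : (0 < N)%N) (eps : R).
Implicit Types (i j m : int).

Let NR : (N%:R : R) != 0. Proof. by rewrite pnatr_eq0 -lt0n. Qed.
Let NC : (N%:R : R[i]) != 0. Proof. by rewrite pnatr_eq0 -lt0n. Qed.

Lemma node_shift k (q : int) : node N eps (k + q * N%:Z) = node N eps k + q%:~R :> R.
Proof. by rewrite /node rmorphD rmorphM /=; field. Qed.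

(** A convolution matrix modulated by a character becomes a multiplier and a shift of the
frequency. *)
Lemma psum_conv (G phi : int -> R[i]) m (r : int) : Nper N G -> Nper N phi ->
  psum N (fun i => psum N (fun j => G (i - j) * cis (r%:~R * j%:~R / N%:R) * phi j)
     * cis (- (m%:~R * i%:~R / N%:R))) =
  psum N (fun k => G k * cis (- (m%:~R * k%:~R / N%:R))) * (N%:R * dft N phi (m - r)).
Proof.
move=> pG pphi; rewrite /dft mulVKf // -psumZ /psum.
under eq_bigr => i _ do rewrite mulr_suml.
rewrite exchange_big; apply: eq_bigr => j _ /=.
rewrite -/(psum N (fun i => G (i - j%:Z) * cis (r%:~R * j%:R / N%:R) * phi j%:Z * cis (- (m%:~R *
  i%:~R / N%:R)))).
have pf : Nper N (fun k => G k * cis (- (m%:~R * k%:~R / N%:R))).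
  move=> k; rewrite pG; congr (_ * _).
  by rewrite !cisN; congr conjc; exact: Nper_cis.
rewrite -/(psum N (fun k => G k * cis (- (m%:~R * k%:~R / N%:R)))) -(psum_shift N0 (- j%:Z) pf).
rewrite [RHS]mulrC -psumZ; apply: eq_bigr => i _.
have -> : cis (- (m%:~R * (i%:Z - j%:Z)%:~R / N%:R)) =
   cis (- (m%:~R * i%:~R / N%:R)) * cis (m%:~R * j%:~R / N%:R) :> R[i].
  by rewrite -cisD; congr cis; rewrite rmorphB /=; ring.
have -> : cis (- ((m - r)%:~R * j%:~R / N%:R)) = cis (- (m%:~R * j%:~R / N%:R)) * cis (r%:~R *
  j%:~R / N%:R) :> R[i].
  by rewrite -cisD; congr cis; rewrite rmorphB /=; ring.
set a := cis (m%:~R * j%:~R / N%:R); set b := cis (- (m%:~R * j%:~R / N%:R)).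
have ab : b * a = 1 by exact: cisNK.
rewrite -[LHS]mul1r -ab; ring.
Qed.

Definition dsymb (u v k : int * int -> R[i]) (x : int * int) m : R[i] :=
  cis (m%:~R * eps / N%:R) * (u x * symb eps N m + v x * symb eps N (m - x.1)) +
  k x * (if (N%:Z %| x.1 - m)%Z then cis (x.1%:~R * eps / N%:R) else 0).

(** The component [x] of the kernel without its factor in the second variable, at the node that
separates a collocation point from a grid point [j] steps away. *)
Definition knode (u v k : int * int -> R[i]) (x : int * int) j : R[i] :=
  (u x + v x * cis (x.1%:~R * node N eps j)) * (lnk (node N eps j))%:C
   + k x * cis (x.1%:~R * node N eps j).

Lemma Nper_knode u v k x : Nper N (knode u v k x).
Proof.
move=> j; rewrite /knode -{1 2 3}[N%:Z]mul1r node_shift.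
by rewrite lnkDz mulrDr mulr1 cisDz.
Qed.

Lemma psum_knode u v k x m :
  psum N (fun j => knode u v k x j * cis (- (m%:~R * j%:~R / N%:R))) = N%:R * dsymb u v k x m.
Proof.
pose a := u x * cis (m%:~R * eps / N%:R); pose b := v x * cis (m%:~R * eps / N%:R).
have E j : cis (- (m%:~R * j%:~R / N%:R)) = cis (m%:~R * eps / N%:R) * cis (- (m%:~R * node N eps
  j)) :> R[i].
  by rewrite -cisD; congr cis; rewrite /node; field.
transitivity (a * psum N (fun j => (lnk (node N eps j))%:C * cis (- (m%:~R * node N eps j))) +
   b * psum N (fun j => (lnk (node N eps j))%:C * cis (- ((m - x.1)%:~R * node N eps j))) +
   k x * cis (m%:~R * eps / N%:R) * psum N (fun j => cis ((x.1 - m)%:~R * node N eps j))).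
  rewrite -!psumZ -!psumD; apply: eq_bigr => j _; rewrite E /knode /a /b.
  have -> : cis (- ((m - x.1)%:~R * node N eps j%:Z)) = cis (x.1%:~R * node N eps j%:Z) * cis (-
    (m%:~R * node N eps j%:Z)) :> R[i].
    by rewrite -cisD; congr cis; rewrite rmorphB /=; ring.
  have -> : cis ((x.1 - m)%:~R * node N eps j%:Z) = cis (x.1%:~R * node N eps j%:Z) * cis (-
    (m%:~R * node N eps j%:Z)) :> R[i].
    by rewrite -cisD; congr cis; rewrite rmorphB /=; ring.
  by ring.
rewrite psum_node // /dsymb /symb; case: ifP => _; last first.
  by rewrite !mulr0 !addr0 mulrDr /a /b; field.
have -> : cis ((x.1 - m)%:~R * eps / N%:R) = cis (x.1%:~R * eps / N%:R) * cis (- (m%:~R * eps /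
  N%:R)) :> R[i].
  by rewrite -cisD; congr cis; rewrite rmorphB /=; ring.
have h : cis (- (m%:~R * eps / N%:R)) * cis (m%:~R * eps / N%:R) = 1 :> R[i] by exact: cisNK.
rewrite [k x * _ * _](_ : _ = N%:R * (k x * cis (x.1%:~R * eps / N%:R)) *
   (cis (- (m%:~R * eps / N%:R)) * cis (m%:~R * eps / N%:R))); last by ring.
by rewrite h mulr1 /a /b; field.
Qed.

Definition entry (V1 V2 : R -> R -> R[i]) i j : R[i] :=
  V1 (node_s N (i%:~R + 1 + eps)) (node_s N (j%:~R + 1))
  - V1 (node_s N (i%:~R + eps)) (node_s N (j%:~R + 1))
  - V1 (node_s N (i%:~R + 1 + eps)) (node_s N j%:~R)
  + V1 (node_s N (i%:~R + eps)) (node_s N j%:~R)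
  + (N%:R^-1) ^+ 2 * V2 (node_t N (i%:~R + eps)) (node_t N j%:~R).

Definition galerkin (V1 V2 : R -> R -> R[i]) (phi : int -> R[i]) i : R[i] :=
  N%:R * psum N (fun j => entry V1 V2 i j * phi j).

Variables (u1 v1 k1 u2 v2 k2 : int * int -> R[i]).

(** The analogue of [crow] in which differences replace derivatives; the half step in the
exponent comes from the midpoints [node_s]. *)
Definition drow m (x : int * int) : R[i] :=
  N%:R ^+ 2 * ((cis (m%:~R / N%:R) - 1) * (cis ((x.2 - m)%:~R / N%:R) - 1)) *
    cis (- (x.2%:~R / (2 * N%:R))) * dsymb u1 v1 k1 x m + dsymb u2 v2 k2 x m.

(** Since the component depends on the first variable only through the difference of the two,
the second difference in both variables is a three-term combination of a convolution. *)
Lemma entry_kterm x i j : entry (kterm u1 v1 k1 x) (kterm u2 v2 k2 x) i j =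
  (cis (- (x.2%:~R / (2 * N%:R))) *
   ((cis (x.2%:~R / N%:R) + 1) * knode u1 v1 k1 x (i - j)
     - cis (x.2%:~R / N%:R) * knode u1 v1 k1 x (i - j - 1) - knode u1 v1 k1 x (i - j + 1))
  + (N%:R^-1) ^+ 2 * knode u2 v2 k2 x (i - j)) * cis (x.2%:~R * j%:~R / N%:R).
Proof.
have d (i' : R) (q : int) (k : R) : i' - k = (i - j + q)%:~R + eps -> node_s N i' - node_s N k =
  node N eps (i - j + q).
  by move=> e; rewrite /node_s /node -e; field.
rewrite /entry /kterm.
have -> : node_s N (i%:~R + 1 + eps) - node_s N (j%:~R + 1) = node N eps (i - j).
  by rewrite (d _ 0) ?addr0 // rmorphB /=; ring.
have -> : node_s N (i%:~R + eps) - node_s N (j%:~R + 1) = node N eps (i - j - 1).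
  by rewrite (d _ (-1)) // !rmorphD rmorphN /=; ring.
have -> : node_s N (i%:~R + 1 + eps) - node_s N j%:~R = node N eps (i - j + 1).
  by rewrite (d _ 1) // !rmorphD rmorphN /=; ring.
have -> : node_s N (i%:~R + eps) - node_s N j%:~R = node N eps (i - j).
  by rewrite (d _ 0) ?addr0 // rmorphB /=; ring.
have -> : node_t N (i%:~R + eps) - node_t N j%:~R = node N eps (i - j).
  by rewrite /node_t /node rmorphB /=; field.
have -> : cis (x.2%:~R * node_s N (j%:~R + 1)) = cis (x.2%:~R / N%:R) *
   (cis (- (x.2%:~R / (2 * N%:R))) * cis (x.2%:~R * j%:~R / N%:R)) :> R[i].
  by rewrite -!cisD; congr cis; rewrite /node_s; field.
have -> : cis (x.2%:~R * node_s N j%:~R) =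
   cis (- (x.2%:~R / (2 * N%:R))) * cis (x.2%:~R * j%:~R / N%:R) :> R[i].
  by rewrite -!cisD; congr cis; rewrite /node_s; field.
have -> : cis (x.2%:~R * node_t N j%:~R) = cis (x.2%:~R * j%:~R / N%:R) :> R[i].
  by congr cis; rewrite /node_t mulrA.
by rewrite /knode; ring.
Qed.

(** The discrete Fourier transform turns the collocation matrix into the discrete analogue of
[crow]: differences become the factors [cis (m / N) - 1]. *)
Lemma galerkin_dft A1 K1 A2 K2 (phi : int -> R[i]) m :
  kernel_series A1 K1 u1 v1 k1 -> kernel_series A2 K2 u2 v2 k2 -> Nper N phi ->
  hasSum (fun x => drow m x * dft N phi (m - x.2))
    (dft N (galerkin (log_kernel A1 K1) (log_kernel A2 K2) phi) m).
Proof.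
move=> ks1 ks2 pphi.
have he i j : hasSum (fun x => entry (kterm u1 v1 k1 x) (kterm u2 v2 k2 x) i j)
    (entry (log_kernel A1 K1) (log_kernel A2 K2) i j).
  apply: hasSumD; last by apply: hasSumZ; exact: kernel_expansion.
  apply: hasSumD; last exact: kernel_expansion.
  apply: hasSumB; last exact: kernel_expansion.
  by apply: hasSumB; exact: kernel_expansion.
have hg i : hasSum (fun x => galerkin (kterm u1 v1 k1 x) (kterm u2 v2 k2 x) phi i)
    (galerkin (log_kernel A1 K1) (log_kernel A2 K2) phi i).
  apply: hasSumZ; apply: hasSum_big => j.
  by have := hasSumZ (phi j) (he i j); rewrite mulrC; congr hasSum; apply/funext => x; rewrite
    mulrC.
have : hasSum (fun x => dft N (galerkin (kterm u1 v1 k1 x) (kterm u2 v2 k2 x) phi) m)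
    (dft N (galerkin (log_kernel A1 K1) (log_kernel A2 K2) phi) m).
  apply: hasSumZ; apply: hasSum_big => i; rewrite [X in hasSum _ X]mulrC.
  by have := hasSumZ (cis (- (m%:~R * i%:~R / N%:R))) (hg i); congr hasSum; apply/funext => x;
    rewrite mulrC.
congr hasSum; apply/funext => x.
pose G k : R[i] := cis (- (x.2%:~R / (2 * N%:R))) *
   ((cis (x.2%:~R / N%:R) + 1) * knode u1 v1 k1 x k
     - cis (x.2%:~R / N%:R) * knode u1 v1 k1 x (k - 1) - knode u1 v1 k1 x (k + 1))
  + (N%:R^-1) ^+ 2 * knode u2 v2 k2 x k.
have pG : Nper N G.
  move=> k; have e1 : k + N%:Z - 1 = k - 1 + N%:Z by lia.
  have e2 : k + N%:Z + 1 = k + 1 + N%:Z by lia.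
  by rewrite /G e1 e2 !Nper_knode.
transitivity (psum N (fun i => psum N (fun j => G (i - j) * cis (x.2%:~R * j%:~R / N%:R) * phi j)
     * cis (- (m%:~R * i%:~R / N%:R)))).
  rewrite /dft -psumZ; apply: eq_bigr => i _; rewrite /galerkin -mulrA mulKf //; congr (_ * _).
  by apply: eq_bigr => j _; rewrite entry_kterm.
rewrite psum_conv //; set c := dft N phi _.
have pf u v k : Nper N (fun j => knode u v k x j * cis (- (m%:~R * j%:~R / N%:R))).
  move=> j; rewrite Nper_knode; congr (_ * _).
  by rewrite !cisN; congr conjc; exact: Nper_cis.
have sh (q : int) : psum N (fun j => knode u1 v1 k1 x (j + q) * cis (- (m%:~R * j%:~R / N%:R))) =
   cis (m%:~R * q%:~R / N%:R) * (N%:R * dsymb u1 v1 k1 x m).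
  rewrite -psum_knode -(psum_shift N0 q (pf u1 v1 k1)) -psumZ; apply: eq_bigr => j _.
  by rewrite mulrCA; congr (_ * _); rewrite -cisD; congr cis; rewrite rmorphD /=; ring.
have -> : psum N (fun k => G k * cis (- (m%:~R * k%:~R / N%:R))) =
   cis (- (x.2%:~R / (2 * N%:R))) * ((cis (x.2%:~R / N%:R) + 1) * (N%:R * dsymb u1 v1 k1 x m)
    - cis (x.2%:~R / N%:R) * (cis (- (m%:~R / N%:R)) * (N%:R * dsymb u1 v1 k1 x m))
    - cis (m%:~R / N%:R) * (N%:R * dsymb u1 v1 k1 x m))
   + (N%:R^-1) ^+ 2 * (N%:R * dsymb u2 v2 k2 x m).
  have e1 := sh 1; rewrite mulr1 in e1; rewrite -e1.
  have e2 := sh (-1); rewrite rmorphN /= mulrN1 mulNr in e2; rewrite -e2.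
  rewrite -!psum_knode; set al := cis (- (x.2%:~R / _)); set be := cis (x.2%:~R / _).
  set P0 := psum N (fun j => knode u1 v1 k1 x j * _); set P1 := psum N (fun j => knode u1 v1 k1 x
    (j - 1) * _).
  set P2 := psum N (fun j => knode u1 v1 k1 x (j + 1) * _); set Q := psum N (fun j => knode u2 v2
    k2 x j * _).
  rewrite [RHS](_ : _ = al * (be + 1) * P0 + - (al * be) * P1 + - al * P2 + N%:R^-1 ^+ 2 * Q);
    last by ring.
  rewrite -!psumZ -!psumD.
  by apply: eq_bigr => j _; rewrite /G -/al -/be; ring.
rewrite /drow; have -> : cis (x.2%:~R / N%:R) = cis (m%:~R / N%:R) * cis ((x.2 - m)%:~R / N%:R)
  :> R[i].
  by rewrite -cisD; congr cis; rewrite rmorphB /=; ring.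
have h : cis (m%:~R / N%:R) * cis (- (m%:~R / N%:R)) = 1 :> R[i] by rewrite mulrC; exact: cisNK.
set a := cis (m%:~R / N%:R) in h *; set a' := cis (- (m%:~R / N%:R)) in h *.
set b := cis ((x.2 - m)%:~R / N%:R).
rewrite [a * b * (a' * _)](_ : _ = a * a' * (b * (N%:R * dsymb u1 v1 k1 x m))); last by ring.
by rewrite h; field.
Qed.

End DiscreteEquation.

(** * Uniform bounds for the rows *)

Section RowEstimates.
Context {R : realType}.
Variables (eps : R).
Local Notation s := `|im (cis eps)|.
Hypothesis s0 : 0 < s.

Definition symb_const : R := 2 * s^-1 + ln 4.
Definition diff_const : R := 8 * symb_const + 8 * s^-1.

Lemma symb_const_ge0 : 0 <= symb_const.
Proof. by rewrite addr_ge0 ?ln_ge0 ?ler1n // mulr_ge0 // invr_ge0. Qed.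

Lemma diff_const_ge0 : 0 <= diff_const.
Proof.
by have h := symb_const_ge0; rewrite addr_ge0 // mulr_ge0 // invr_ge0.
Qed.

Variables (u1 v1 k1 u2 v2 k2 : int * int -> R[i]) (alpha : R[i]).
Hypothesis (alpha_u1v1 : forall x, u1 x + v1 x = (x == (0, 0))%:R * alpha).

(** The part of [drow] on the diagonal that grows with the frequency. *)
Definition lam (N : nat) (m : int) : R[i] :=
  N%:R ^+ 2 * ((cis (m%:~R / N%:R) - 1) * (cis ((- m)%:~R / N%:R) - 1)) *
  (cis (m%:~R * eps / N%:R) * (alpha * symb eps N m)).

Definition row_bound (x : int * int) : R :=
  4 * pi ^+ 2 * (diff_const * nc (v1 x) + nc (k1 x)) * (wt x.1 ^+ 2 * wt x.2)
  + (symb_const * (nc (u2 x) + nc (v2 x)) + nc (k2 x)).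

Lemma row_bound_ge0 x : 0 <= row_bound x.
Proof.
have h1 := symb_const_ge0; have h2 := diff_const_ge0.
have w1 := ltW (@wt_gt0 R x.1); have w2 := ltW (@wt_gt0 R x.2).
apply: addr_ge0; last by rewrite addr_ge0 ?nc_ge0 // mulr_ge0 // addr_ge0 ?nc_ge0.
apply: mulr_ge0; last by rewrite mulr_ge0 // exprn_ge0.
by rewrite !mulr_ge0 ?pi_ge0 ?exprn_ge0 ?pi_ge0 // addr_ge0 ?nc_ge0 // mulr_ge0 ?nc_ge0.
Qed.

(** In the resolved window [m] is an absolutely least residue of [p]. *)
Lemma dvd_window (N : nat) (m p : int) : (N%:Z %| p - m)%Z -> 2 * `|m| <= N%:Z -> `|m| <= `|p|.
Proof.
move=> /dvdzP[q qE] mN; have pE : p = m + q * N%:Z by lia.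
have [q0|q0|q0] := ltrgtP q 0; last by rewrite pE q0 mul0r addr0.
  by have : q * N%:Z <= - N%:Z by [nia]; lia.
by have : N%:Z <= q * N%:Z by [nia]; lia.
Qed.

Section FixedN.
Variables (N : nat) (N0 : (0 < N)%N).
Implicit Types (m : int).
Let NR : 0 < N%:R :> R. Proof. by rewrite ltr0n. Qed.

Lemma dsymb_le x m : nc (dsymb N eps u2 v2 k2 x m) <=
  symb_const * (nc (u2 x) + nc (v2 x)) + nc (k2 x).
Proof.
apply: le_trans (ncD _ _) _; apply: lerD.
  rewrite ncM nc_cis mul1r; apply: le_trans (ncD _ _) _; rewrite (ncM (u2 x)) (ncM (v2 x)) mulrDr.
  by apply: lerD; rewrite mulrC ler_wpM2r ?nc_ge0 //; exact: (symb_le s0 N0).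
by rewrite ncM ler_piMr ?nc_ge0 //; case: ifP; rewrite ?nc_cis ?nc0 ?ler01.
Qed.

Lemma nc_difference_le m : N%:R * nc (cis (m%:~R / N%:R : R) - 1) <= 2 * pi * `|m|%:~R.
Proof.
rewrite mulrC -ler_pdivlMr // ; apply: le_trans (nc_cis_sub1_le _) _.
by rewrite normrM (gtr0_norm (_ : 0 < N%:R^-1)) ?invr_gt0 // mulrA intr_norm.
Qed.

Lemma nc_lam m : nc (lam N m) =
  (N%:R * nc (cis (m%:~R / N%:R : R) - 1)) ^+ 2 * nc alpha * nc (symb eps N m).
Proof.
have -> : nc (cis (m%:~R / N%:R : R) - 1) = nc (cis ((- m)%:~R / N%:R : R) - 1).
  by rewrite !nc_cis_sub1 rmorphN mulNr mulrN sinN normrN.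
rewrite /lam !ncM nc_cis.
have -> : nc (cis (m%:~R / N%:R : R) - 1) = nc (cis ((- m)%:~R / N%:R : R) - 1).
  by rewrite !nc_cis_sub1 rmorphN mulNr mulrN sinN normrN.
by rewrite -(rmorph_nat (real_complex R)) nc_real ger0_norm //; ring.
Qed.

Lemma lam_ge m : 2 * `|m| <= N%:Z -> s / 2 * nc alpha * `|m|%:~R <= nc (lam N m).
Proof.
move=> mN; have [->|m0] := eqVneq m 0; first by rewrite normr0 mulr0 nc_ge0.
have m1 : 1 <= `|m| by move: m0; clear; lia.
have mR : 0 < `|m|%:~R :> R by rewrite ltr0z; move: m1; clear; lia.
have h1 : 4 * `|m|%:~R <= N%:R * nc (cis (m%:~R / N%:R : R) - 1) *+ 2.
  have NR' := NR; have := mN; rewrite -(ler_int R) rmorphM /= => mN'.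
  have := @nc_cis_sub1_ge R (m%:~R / N%:R).
  rewrite normrM (gtr0_norm (_ : 0 < N%:R^-1)) ?invr_gt0 // -intr_norm => h.
  have {}h := h _; rewrite ler_pdivrMr // in h.
  have {}h : 2 * (`|m|%:~R / N%:R) <= nc (cis (m%:~R / N%:R : R) - 1).
    by apply: h; have : N%:Z%:~R = N%:R :> R by []; lra.
  by move: h; rewrite mulrA ler_pdivrMr // mulr2n; lra.
have h2 := symb_ge s0 N0 m1 mN.
have a0 := nc_ge0 alpha; have s0' := s0.
rewrite nc_lam.
apply: (@le_trans _ _ ((2 * `|m|%:~R) ^+ 2 * nc alpha * (s / 8 / `|m|%:~R))).
  by rewrite (_ : _ * (s / 8 / _) = s / 2 * nc alpha * `|m|%:~R) //; field; rewrite gt_eqF.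
have p0 : 0 <= 2 * `|m|%:~R :> R by lra.
have q0 : 0 <= N%:R * nc (cis (m%:~R / N%:R : R) - 1) by rewrite mulr_ge0 ?nc_ge0.
apply: ler_pM => //; first by rewrite mulr_ge0 // exprn_ge0.
by rewrite ler_wpM2r //; apply: lerXn2r; rewrite ?nnegrE //; lra.
Qed.

Lemma lam_le m : nc (lam N m) <= (2 * pi * `|m|%:~R) ^+ 2 * nc alpha * symb_const.
Proof.
rewrite nc_lam; apply: ler_pM; rewrite ?nc_ge0 ?mulr_ge0 ?exprn_ge0 ?mulr_ge0 ?nc_ge0 //.
  rewrite ler_wpM2r ?nc_ge0 //; apply: lerXn2r; rewrite ?nnegrE ?mulr_ge0 ?nc_ge0 ?pi_ge0 ?ler0z //.
  exact: nc_difference_le.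
exact: (symb_le s0 N0).
Qed.

Local Notation drow := (drow N eps u1 v1 k1 u2 v2 k2).

(** Off the leading term the rows are bounded uniformly in [N] and [m]: [symb_diff] compensates
the two factors of order [`|m|], and the smooth part enters only when [`|m| <= `|x.1|]. *)
Lemma drow_remainder m x : 2 * `|m| <= N%:Z ->
  nc (drow m x - (x == (0, 0))%:R * lam N m) <= row_bound x.
Proof.
move=> mN.
have B0 : 0 <= 4 * pi ^+ 2 * (diff_const * nc (v1 x) + nc (k1 x)) * (wt x.1 ^+ 2 * wt x.2).
  have h2 := diff_const_ge0; have w1 := ltW (@wt_gt0 R x.1); have w2 := ltW (@wt_gt0 R x.2).
  apply: mulr_ge0; last by rewrite mulr_ge0 // exprn_ge0.
  by rewrite !mulr_ge0 ?pi_ge0 ?exprn_ge0 ?pi_ge0 // addr_ge0 ?nc_ge0 // mulr_ge0 ?nc_ge0.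
have [w1 w2] : 0 < wt x.1 :> R /\ 0 < wt x.2 :> R by rewrite !wt_gt0.
pose P : R[i] := N%:R ^+ 2 * ((cis (m%:~R / N%:R) - 1) * (cis ((x.2 - m)%:~R / N%:R) - 1)) *
    cis (- (x.2%:~R / (2 * N%:R))).
pose T : R[i] := cis (m%:~R * eps / N%:R) * (v1 x * (symb eps N (m - x.1) - symb eps N m)) +
  k1 x * (if (N%:Z %| x.1 - m)%Z then cis (x.1%:~R * eps / N%:R) else 0).
have -> : drow m x - (x == (0, 0))%:R * lam N m = P * T + dsymb N eps u2 v2 k2 x m.
  rewrite /drow -/P.
  have -> : dsymb N eps u1 v1 k1 x m = T + cis (m%:~R * eps / N%:R) * ((u1 x + v1 x) * symb eps N
    m).
    by rewrite /dsymb /T; ring.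
  rewrite alpha_u1v1; case: eqVneq => [xE|_]; last by rewrite !mul0r !mulr0 addr0 subr0.
  have -> : P * (T + cis (m%:~R * eps / N%:R) * (1%:R * alpha * symb eps N m)) = P * T + lam N m.
    rewrite mulrDr /P /lam xE /= mul0r oppr0 cis0 sub0r mul1r; ring.
  by rewrite (_ : true%:R = 1 :> R[i]) //; ring.
apply: le_trans (ncD _ _) _; apply: lerD; last exact: dsymb_le.
rewrite ncM.
have PE : nc P <= (2 * pi) ^+ 2 * `|m|%:~R * `|x.2 - m|%:~R.
  rewrite /P !ncM nc_cis mulr1 -(rmorph_nat (real_complex R)) nc_real ger0_norm //.
  have := ler_pM (mulr_ge0 (ltW NR) (nc_ge0 _)) (mulr_ge0 (ltW NR) (nc_ge0 _))
    (nc_difference_le m) (nc_difference_le (x.2 - m)).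
  by rewrite (_ : 2 * pi * _ * _ = (2 * pi) ^+ 2 * `|m|%:~R * `|x.2 - m|%:~R); [apply: le_trans;
    rewrite le_eqVlt; apply/orP; left; apply/eqP; ring|ring].
have [m0|m0] := eqVneq m 0.
  have -> : nc P = 0 by apply/eqP; rewrite eq_le nc_ge0 andbT; apply: le_trans PE _; rewrite m0
    normr0 mulr0 mul0r.
  by rewrite mul0r; exact: B0.
have m1 : 1 <= `|m| by move: m0; clear; lia.
have mR : 1 <= `|m|%:~R :> R by rewrite -[1]/(1%:~R) ler_int.
have TE : nc T <= nc (v1 x) * (diff_const * wt x.1 ^+ 2 / `|m|%:~R ^+ 2) +
    nc (k1 x) * ((`|m| <= `|x.1|)%R)%:R.
  apply: le_trans (ncD _ _) _; apply: lerD.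
    by rewrite ncM nc_cis mul1r (ncM (v1 x)) ler_wpM2l ?nc_ge0 //; exact: (symb_diff s0 N0).
  rewrite ncM ler_wpM2l ?nc_ge0 //; case: ifP => [dv|_]; last by rewrite nc0.
  by rewrite nc_cis (dvd_window dv mN).
have xm : `|x.2 - m|%:~R <= wt x.2 * `|m|%:~R :> R.
  have : `|x.2 - m|%:~R <= `|x.2|%:~R + `|m|%:~R :> R by rewrite -intrD ler_int ler_normB.
  have : 0 <= `|x.2|%:~R :> R by rewrite ler0z.
  by rewrite /wt; nra.
have pi0 := sqr_ge0 (2 * pi : R).
have PE2 : nc P <= (2 * pi) ^+ 2 * wt x.2 * `|m|%:~R ^+ 2.
  apply: le_trans PE _; rewrite -[leLHS]mulrA -[leRHS]mulrA ler_wpM2l // expr2.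
  have := ler_wpM2l (le_trans ler01 mR) xm; lra.
apply: le_trans (ler_pM (nc_ge0 _) (nc_ge0 _) PE2 TE) _.
have dc := diff_const_ge0; have w1' := ltW w1; have w2' := ltW w2.
have v0 := nc_ge0 (v1 x); have k0 := nc_ge0 (k1 x).
have mp : `|m|%:~R ^+ 2 * ((`|m| <= `|x.1|)%R)%:R <= wt x.1 ^+ 2 :> R.
  case: (boolP (`|m| <= `|x.1|)) => [h|_]; last by rewrite mulr0 exprn_ge0.
  rewrite mulr1; apply: lerXn2r; rewrite ?nnegrE ?ler0z // /wt.
  by have : `|m|%:~R <= `|x.1|%:~R :> R by [rewrite ler_int]; lra.
rewrite (_ : (2 * pi) ^+ 2 * wt x.2 * `|m|%:~R ^+ 2 * _ =
  (2 * pi) ^+ 2 * wt x.2 * (diff_const * nc (v1 x) * wt x.1 ^+ 2 +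
     nc (k1 x) * (`|m|%:~R ^+ 2 * ((`|m| <= `|x.1|)%R)%:R))); last by field; rewrite gt_eqF //; lra.
rewrite (_ : 4 * pi ^+ 2 * _ * _ = (2 * pi) ^+ 2 * wt x.2 * (diff_const * nc (v1 x) * wt x.1 ^+ 2 +
     nc (k1 x) * wt x.1 ^+ 2)); last by ring.
by rewrite (ler_wpM2l (mulr_ge0 pi0 w2')) // lerD2l ler_wpM2l.
Qed.

End FixedN.
End RowEstimates.

(** * Limits of the rows *)

Section Compactness.
Context {R : realType}.
Variables (eps : R).
Local Notation s := `|im (cis eps)|.
Hypothesis s0 : 0 < s.
Variables (A1 K1 A2 K2 : R -> R -> R[i]) (u1 v1 k1 u2 v2 k2 : int * int -> R[i]) (alpha : R[i]).
Hypothesis (ks1 : kernel_series A1 K1 u1 v1 k1) (ks2 : kernel_series A2 K2 u2 v2 k2).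
Hypothesis (alpha_u1v1 : forall x, u1 x + v1 x = (x == (0, 0))%:R * alpha).
Hypothesis alpha0 : alpha != 0.

Local Notation bound := (row_bound eps v1 k1 u2 v2 k2).
Local Notation crow := (crow u1 v1 k1 u2 v2 k2).

Lemma row_bound_weighted (j : nat) : exists2 C : R, 0 <= C & sumle (fun x => bound x * wt x.2 ^+
  j) C.
Proof.
have [[u1r v1r k1r] _] := ks1; have [[u2r v2r k2r] _] := ks2.
have [C1 C10 h1] := rapid2_weighted (j + 2) v1r; have [C2 C20 h2] := rapid2_weighted (j + 2) k1r.
have [C3 C30 h3] := rapid2_weighted (j + 2) u2r; have [C4 C40 h4] := rapid2_weighted (j + 2) v2r.
have [C5 C50 h5] := rapid2_weighted (j + 2) k2r.
have d0 := diff_const_ge0 eps; have c0 := symb_const_ge0 eps.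
have p0 : 0 <= 4 * pi ^+ 2 :> R by rewrite mulr_ge0 ?sqr_ge0.
have H := sumleD (sumleZ p0 (sumleD (sumleZ d0 h1) h2))
  (sumleD (sumleZ c0 (sumleD h3 h4)) h5).
eexists; last apply: sumle_le H.
  by apply: addr_ge0; [apply: mulr_ge0 => //|]; apply: addr_ge0 => //; apply: mulr_ge0 => //;
    exact: addr_ge0.
move=> x; set w := (wt x.1 * wt x.2) ^+ (j + 2).
have [a1 a2] : 1 <= wt x.1 :> R /\ 1 <= wt x.2 :> R by rewrite !wt_ge1.
have [b1 b2] : 0 <= wt x.1 :> R /\ 0 <= wt x.2 :> R by split; lra.
have w2 : wt x.1 ^+ 2 * wt x.2 * wt x.2 ^+ j <= w.
  rewrite /w exprMn; rewrite -mulrA; apply: ler_pM; rewrite ?exprn_ge0 ?mulr_ge0 ?exprn_ge0 //.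
    by rewrite ler_weXn2l // leq_addl.
  by rewrite -exprS ler_weXn2l // addn2 leqnSn.
have w1 : wt x.2 ^+ j <= w.
  apply: le_trans w2; rewrite ler_peMl ?exprn_ge0 //.
  by rewrite -[1]mulr1; apply: ler_pM => //; rewrite exprn_ege1.
rewrite /row_bound mulrDl.
have -> : 4 * pi ^+ 2 * (diff_const eps * nc (v1 x) + nc (k1 x)) * (wt x.1 ^+ 2 * wt x.2) * wt
  x.2 ^+ j
   = 4 * pi ^+ 2 * (diff_const eps * nc (v1 x) + nc (k1 x)) * (wt x.1 ^+ 2 * wt x.2 * wt x.2 ^+
     j) by ring.
have -> : 4 * pi ^+ 2 * (diff_const eps * (nc (v1 x) * w) + nc (k1 x) * w) + (symb_const eps *
  (nc (u2 x) * w + nc (v2 x) * w) + nc (k2 x) * w)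
  = 4 * pi ^+ 2 * (diff_const eps * nc (v1 x) + nc (k1 x)) * w + (symb_const eps * (nc (u2 x) +
    nc (v2 x)) + nc (k2 x)) * w by ring.
apply: lerD; rewrite ler_wpM2l //.
  by rewrite mulr_ge0 // addr_ge0 ?nc_ge0 // mulr_ge0 ?nc_ge0.
by rewrite addr_ge0 ?nc_ge0 // mulr_ge0 // addr_ge0 ?nc_ge0.
Qed.

Section Limit.
Variables (U : set_system nat) (UU : UltraFilter U).
Hypothesis Uoo : forall m : nat, U [set n | (m <= n)%N].
Variable N : nat -> nat.
Hypothesis nN : forall n, (n < N n)%N.
Implicit Types (m : int).

Let N0 n : (0 < N n)%N. Proof. exact: leq_ltn_trans (nN n). Qed.

Let large (q : nat) : U [set n | (q < N n)%N].
Proof. by apply: filterS (Uoo q) => n /= h; exact: leq_ltn_trans (nN n). Qed.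

Lemma ucvg_rate_N (u : nat -> R[i]) l (C : R) : 0 <= C ->
  U [set n | nc (u n - l) <= C / (N n)%:R] -> ucvg U u l.
Proof.
move=> C0 h; apply: (@ucvg_rate _ U UU Uoo _ _ C); apply: filterS h => n /= h; apply: le_trans h _.
by rewrite ler_wpM2l // lef_pV2 ?posrE ?ltr0n ?ler_nat.
Qed.

Lemma ucvg_cis (x : R) : ucvg U (fun n => cis (x / (N n)%:R)) 1.
Proof.
apply: (@ucvg_rate_N _ _ (2 * pi * `|x|)); first by rewrite !mulr_ge0 ?pi_ge0.
apply: filterS filterT => n _ /=; apply: le_trans (nc_cis_sub1_le _) _.
by rewrite normrM (ger0_norm (_ : 0 <= (N n)%:R^-1)) ?invr_ge0 // mulrA.
Qed.

Lemma ucvg_difference m :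
  ucvg U (fun n => (N n)%:R * (cis (m%:~R / (N n)%:R) - 1)) (0 +i* (2 * pi * m%:~R) : R[i]).
Proof.
apply: (@ucvg_rate_N _ _ (8 * pi ^+ 2 * m%:~R ^+ 2)).
  by rewrite mulr_ge0 ?sqr_ge0 // mulr_ge0 ?sqr_ge0.
apply: filterS filterT => n _ /=.
have NR : 0 < (N n)%:R :> R by rewrite ltr0n.
have -> : 0 +i* (2 * pi * m%:~R) = (N n)%:R * (0 +i* (2 * pi * (m%:~R / (N n)%:R))) :> R[i].
  rewrite -(rmorph_nat (real_complex R)) [_%:C * _]mulrC.
  apply: complex_eq; rewrite ?Re_mulr_real ?Im_mulr_real /=; first by rewrite mul0r.
  by rewrite mulrA divfK ?gt_eqF.
rewrite -mulrBr ncM -(rmorph_nat (real_complex R)) nc_real ger0_norm ?(ltW NR) //.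
apply: le_trans (ler_wpM2l (ltW NR) (cis_taylor _)) _.
by rewrite le_eqVlt; apply/orP; left; apply/eqP; field; rewrite gt_eqF.
Qed.

Lemma ucvg_symb m : ucvg U (fun n => symb eps (N n) m) (Lhat m)%:C.
Proof.
apply: (@ucvg_rate_N _ _ (3 * s^-1)); first by rewrite mulr_ge0 // invr_ge0.
apply: filterS (large (2 * absz m)) => n /= h; apply: (symb_lim s0 (N0 n)).
by move: h; clear; lia.
Qed.

Lemma ucvg_dsymb u v k (x : int * int) m :
  ucvg U (fun n => dsymb (N n) eps u v k x m) (csymb u v k x m).
Proof.
rewrite /csymb -[X in _ (X + _)]mul1r; apply: ucvgD.
  apply: ucvgM; first exact: ucvg_cis.
  by apply: ucvgD; (apply: ucvgM; [exact: ucvg_cst|exact: ucvg_symb]).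
apply: ucvgM; first exact: ucvg_cst.
case: eqVneq => [->|mp]; rewrite /=.
  apply: (ucvg_near UU _ (ucvg_cis (x.1%:~R * eps))).
  by apply: filterS filterT => n _ /=; rewrite subrr dvdz0.
apply: (ucvg_near UU _ (ucvg_cst UU 0)); apply: filterS (large (absz (x.1 - m))) => n /= h.
rewrite ifN //; apply: contraNN mp => /dvdzP[q qE].
have : q = 0 by move: h qE; clear; nia.
by move=> q0; rewrite q0 mul0r in qE; rewrite eq_sym -subr_eq0 qE.
Qed.

Lemma ucvg_drow m (x : int * int) :
  ucvg U (fun n => drow (N n) eps u1 v1 k1 u2 v2 k2 m x) (crow m x).
Proof.
have -> : crow m x = (0 +i* (2 * pi * m%:~R)) * (0 +i* (2 * pi * (x.2 - m)%:~R)) * 1 *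
   csymb u1 v1 k1 x m + csymb u2 v2 k2 x m.
  congr (_ * _ + _); rewrite mulr1 -opprB rmorphN mulrN; apply: complex_eq;
   by rewrite ?cReM ?cImM /=; ring.
apply: ucvgD; last exact: ucvg_dsymb.
apply: ucvgM; last exact: ucvg_dsymb.
have := ucvgM UU (ucvgM UU (ucvg_difference m) (ucvg_difference (x.2 - m))) (ucvg_cis (- (x.2%:~R
  / 2))).
apply: ucvg_near; apply: filterS filterT => n _ /=.
have -> : - (x.2%:~R / 2) / (N n)%:R = - (x.2%:~R / (2 * (N n)%:R)) :> R.
  by field; rewrite pnatr_eq0 -lt0n.
by ring.
Qed.

(** The limit of [lam]; of order [`|m|] because [Lhat m] is the inverse of [- `|m|]. *)
Definition clam m : R[i] := (4 * pi ^+ 2 * m%:~R ^+ 2 * Lhat m)%:C * alpha.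

Lemma ucvg_lam m : ucvg U (fun n => lam eps alpha (N n) m) (clam m).
Proof.
have -> : clam m = (0 +i* (2 * pi * m%:~R)) * (0 +i* (2 * pi * (- m)%:~R)) * (1 * (alpha * (Lhat
  m)%:C)).
  rewrite /clam rmorphM /= mul1r.
  have -> : (0 +i* (2 * pi * m%:~R)) * (0 +i* (2 * pi * (- m)%:~R)) = (4 * pi ^+ 2 * m%:~R ^+
    2)%:C :> R[i].
    by rewrite rmorphN mulrN; apply: complex_eq; rewrite ?cReM ?cImM /=; ring.
  by ring.
have := ucvgM UU (ucvgM UU (ucvg_difference m) (ucvg_difference (- m)))
  (ucvgM UU (ucvg_cis (m%:~R * eps)) (ucvgM UU (ucvg_cst UU alpha) (ucvg_symb m))).
by apply: ucvg_near; apply: filterS filterT => n _ /=; rewrite /lam; ring.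
Qed.

Lemma crow_remainder m x : nc (crow m x - (x == (0, 0))%:R * clam m) <= bound x.
Proof.
apply: (@ucvg_bound _ U UU (fun n => drow (N n) eps u1 v1 k1 u2 v2 k2 m x - (x == (0, 0))%:R *
  lam eps alpha (N n) m)).
  apply: filterS (large (2 * absz m)) => n /= h; apply: drow_remainder => //.
  by move: h; clear; lia.
rewrite -mulN1r; have := ucvgD UU (ucvg_drow m x) (ucvgM UU (ucvg_cst UU (-1)) (ucvgM UU
  (ucvg_cst UU (x == (0, 0))%:R) (ucvg_lam m))).
by apply: ucvg_near; apply: filterS filterT => n _ /=; rewrite mulN1r.
Qed.

End Limit.

Lemma nc_clam m : m != 0 -> nc (clam m) = 4 * pi ^+ 2 * nc alpha * `|m|%:~R.
Proof.
move=> m0; have mR : 0 < `|m|%:~R :> R by rewrite ltr0z normr_gt0.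
rewrite /clam ncM nc_real /Lhat (negbTE m0) mulrN normrN ger0_norm; last first.
  by rewrite mulr_ge0 ?invr_ge0 ?(ltW mR) // mulr_ge0 ?sqr_ge0 // mulr_ge0 ?sqr_ge0.
rewrite -[m%:~R ^+ 2]real_normK ?num_real // -intr_norm.
by field; rewrite gt_eqF.
Qed.

End Compactness.

(** * Compactness *)

Section NoDegenerateSequence.
Context {R : realType}.
Variables (eps : R).
Local Notation s := `|im (cis eps)|.
Hypothesis s0 : 0 < s.
Variables (A1 K1 A2 K2 : R -> R -> R[i]) (u1 v1 k1 u2 v2 k2 : int * int -> R[i]) (alpha : R[i]).
Hypothesis (ks1 : kernel_series A1 K1 u1 v1 k1) (ks2 : kernel_series A2 K2 u2 v2 k2).
Hypothesis (alpha_u1v1 : forall x, u1 x + v1 x = (x == (0, 0))%:R * alpha).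
Hypothesis alpha0 : alpha != 0.
Hypothesis hW : forall phi : R -> R[i], calD phi ->
  (forall t, opW (log_kernel A1 K1) (log_kernel A2 K2) phi t = 0) -> forall t, phi t = 0.

Local Notation bound := (row_bound eps v1 k1 u2 v2 k2).
Local Notation crow := (crow u1 v1 k1 u2 v2 k2).
Local Notation drow N := (drow N eps u1 v1 k1 u2 v2 k2).
Local Notation clam := (clam alpha).
Local Notation lam := (lam eps alpha).

Lemma window_sum (N : nat) (N0 : (0 < N)%N) (c : int -> R[i]) : Nper N c ->
  exists W : seq int, [/\ uniq W, forall l, l \in W -> 2 * `|l| <= N%:Z &
    \sum_(l <- W) nc (c l) ^+ 2 = \sum_(m < N) nc (c m%:Z) ^+ 2].
Proof.
move=> pc; pose center (i : 'I_N) : int := i%:Z - (N./2)%:Z.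
exists (map center (enum 'I_N)); split.
- by rewrite map_inj_uniq ?enum_uniq // => i j /addIr [] /val_inj.
- by move=> _ /mapP[i _ ->]; rewrite /center; have := ltn_ord i; clear; lia.
rewrite big_map big_enum /=; apply: complexI; rewrite !rmorph_sum /=.
have pf : Nper N (fun j => (nc (c j) ^+ 2)%:C) by move=> j /=; rewrite pc.
by rewrite -[RHS]/(psum N (fun j => (nc (c j) ^+ 2)%:C)) -(psum_shift N0 (- (N./2)%:Z) pf).
Qed.

(** Splitting off the leading term of a row. *)
Lemma row_tail (row : int * int -> R[i]) (L y : R[i]) (c : int -> R[i]) (m : int) (B D : R)
    (w : int * int -> R) :
  (forall x, nc (row x - (x == (0, 0))%:R * L) <= bound x) ->
  hasSum (fun x => row x * c (m - x.2)) y ->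
  (forall x, nc (c (m - x.2)) <= B * w x) -> 0 <= B -> sumle (fun x => bound x * w x) D ->
  nc L * nc (c m) <= nc y + B * D.
Proof.
move=> hrow hy hc B0 hD.
have h1 : hasSum (fun x : int * int => (x == (0, 0))%:R * L * c (m - x.2)) (L * c m).
  have := @hasSum_finite R _ (fun x : int * int => (x == (0, 0))%:R * L * c (m - x.2)) [:: (0,
    0)] isT _.
  rewrite big_seq1 eqxx mul1r subr0; apply=> x; rewrite inE => /negbTE ->.
  by rewrite !mul0r.
have h2 : nc (y - L * c m) <= B * D.
  apply: hasSum_bound (hasSumB hy h1) _; apply: sumle_le (sumleZ B0 hD) => x.
  rewrite -mulrBl ncM mulrCA; apply: ler_pM; rewrite ?nc_ge0 //.
by have := ncBl (L * c m) y; rewrite ncM ncC; lra.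
Qed.

Section Sequence.
Variables (N : nat -> nat) (phi : nat -> int -> R[i]).
Hypothesis nN : forall n, (n < N n)%N.
Hypothesis pphi : forall n, Nper (N n) (phi n).
Local Notation c n := (dft (N n) (phi n)).
Local Notation y n := (dft (N n) (galerkin (N n) eps (log_kernel A1 K1) (log_kernel A2 K2) (phi
  n))).
Hypothesis c_unit : forall n, \sum_(m < N n) nc (c n m%:Z) ^+ 2 = 1.
Hypothesis y_small : forall n (m : int), nc (y n m) <= n.+1%:R^-1.

Let N0 n : (0 < N n)%N. Proof. exact: leq_ltn_trans (nN n). Qed.

Let c_le1 n m : nc (c n m) <= 1.
Proof.
have h (k : 'I_(N n)) : nc (c n k%:Z) <= 1.
  rewrite -(@ler_pXn2r _ 2) ?nnegrE ?nc_ge0 ?ler01 // expr1n -(c_unit n).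
  by rewrite (bigD1 k) //= lerDl sumr_ge0 // => i _; exact: sqr_ge0.
rewrite (Nper_modz (N0 n) m (Nper_dft (N0 n) (phi n))).
have Nz : (0 < (N n)%:Z)%R by have := N0 n; clear; lia.
have [q qE] : exists q : nat, (m %% (N n)%:Z)%Z = q%:Z.
  by exists (absz (m %% (N n)%:Z)%Z); rewrite gez0_abs // modz_ge0 // gt_eqF.
have qN : (q < N n)%N by have := ltz_pmod m Nz; rewrite qE.
by rewrite qE; exact: (h (Ordinal qN)).
Qed.

Let rowE n m : hasSum (fun x => drow (N n) m x * c n (m - x.2)) (y n m).
Proof. exact: galerkin_dft. Qed.

(** The coercivity of the leading symbol turns the bound on the rows into decay of the
coefficients, uniformly in [n]: no mass escapes to high frequencies. *)
Let tight : exists2 T : R, 0 <= T & forall n m, 2 * `|m| <= (N n)%:Z -> nc (c n m) <= T / wt m.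
Proof.
have [D D0 hD] := row_bound_weighted eps ks1 ks2 0.
have a0 : 0 < nc alpha by rewrite nc_gt0.
pose kap := s / 2 * nc alpha.
have k0 : 0 < kap by rewrite mulr_gt0 // divr_gt0.
exists (1 + 2 * ((1 + D) / kap)) => [|n m mN].
  by rewrite addr_ge0 // mulr_ge0 // divr_ge0 ?(ltW k0) //; lra.
have w0 := @wt_gt0 R m; have T0 : 0 <= 2 * ((1 + D) / kap).
  by rewrite mulr_ge0 // divr_ge0 ?(ltW k0) //; lra.
have [->|m0] := eqVneq m 0.
  by rewrite /wt normr0 addr0 divr1; have := c_le1 n 0; lra.
have h := @row_tail (drow (N n) m) (lam (N n) m) (y n m) (c n) m 1 D (fun x => wt x.2 ^+ 0)
  (fun x => drow_remainder s0 k1 u2 v2 k2 alpha_u1v1 (N0 n) x mN) (rowE n m) _ ler01 hD.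
have {}h : nc (lam (N n) m) * nc (c n m) <= nc (y n m) + 1 * D by apply: h => x; rewrite expr0
  mulr1; exact: c_le1.
have hl := lam_ge s0 alpha (N0 n) mN.
have y1 : nc (y n m) <= 1 by apply: le_trans (y_small n m) _; rewrite invf_le1 ?ltr0n // ler1n.
have m1 : 1 <= `|m|%:~R :> R by rewrite -[1]/(1%:~R) ler_int; move: m0; clear; lia.
have c0 := nc_ge0 (c n m).
have {}h : kap * `|m|%:~R * nc (c n m) <= 1 + D.
  by apply: le_trans (ler_wpM2r c0 hl) _; rewrite mul1r in h; lra.
have {}h : `|m|%:~R * nc (c n m) <= (1 + D) / kap by rewrite ler_pdivlMr // mulrC mulrA.
by rewrite ler_pdivlMr // /wt; nra.
Qed.

Section Limit.
Variables (U : set_system nat) (UU : UltraFilter U).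
Hypothesis Uoo : forall q : nat, U [set n | (q <= n)%N].
Variable cl : int -> R[i].
Hypothesis hcl : forall m, ucvg U (fun n => c n m) (cl m).

Let cl_le1 m : nc (cl m) <= 1.
Proof. by apply: (ucvg_bound UU _ (hcl m)); apply: filterS filterT => n _ /=; exact: c_le1. Qed.

(** Dominated convergence in each fixed row. *)
Let limit_row m : hasSum (fun x => crow m x * cl (m - x.2)) 0.
Proof.
have [D D0 hD] := row_bound_weighted eps ks1 ks2 0.
pose K : R := (2 * pi * `|m|%:~R) ^+ 2 * nc alpha * symb_const eps.
have K0 : 0 <= K by rewrite mulr_ge0 ?symb_const_ge0 // mulr_ge0 ?nc_ge0 ?sqr_ge0.
pose B (x : int * int) : R := bound x + (x == (0, 0))%:R * K.
have B0 x : 0 <= B x by rewrite addr_ge0 ?row_bound_ge0 // mulr_ge0.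
have hB : sumle B (D + K).
  apply: sumleD; first by apply: sumle_le hD => x; rewrite expr0 mulr1.
  move=> t ut; rewrite -mulr_suml ler_piMl //.
  have [at0|at0] := boolP ((0, 0) \in t).
    by rewrite (bigD1_seq _ at0 ut) /= big1 ?addr0 // => i /negbTE ->.
  rewrite big1_seq ?ler01 // => i /andP[_ it]; case: eqVneq => // ie.
  by rewrite -ie it in at0.
pose F n (x : int * int) : R[i] := if 2 * `|m| <= (N n)%:Z then drow (N n) m x * c n (m - x.2)
  else 0.
have FB n x : nc (F n x) <= B x.
  rewrite /F; case: ifP => [mN|_]; last by rewrite nc0.
  rewrite ncM; apply: le_trans (ler_piMr (nc_ge0 _) (c_le1 _ _)) _.
  rewrite -[drow _ m x](subrK ((x == (0, 0))%:R * lam (N n) m)).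
  apply: le_trans (ncD _ _) _; apply: lerD; first exact: (drow_remainder s0 k1 u2 v2 k2
    alpha_u1v1 (N0 n) x mN).
  rewrite ncM; case: (x == (0, 0)); last by rewrite nc0 !mul0r.
  by rewrite nc1 !mul1r; exact: (lam_le s0 alpha (N0 n) m).
have Flim x : ucvg U (F ^~ x) (crow m x * cl (m - x.2)).
  apply: ucvg_near (ucvgM UU (ucvg_drow s0 u1 v1 k1 u2 v2 k2 UU Uoo nN m x) (hcl (m - x.2))) => //.
  apply: filterS (Uoo (2 * absz m)) => n /= h; rewrite /F ifT //.
  by move: h (nN n); clear; lia.
have [|S hS] := @hasSum_exists _ _ (fun x => crow m x * cl (m - x.2)) (D + K).
  apply: sumle_le hB => x; apply: (ucvg_bound UU _ (Flim x)).
  by apply: filterS filterT => n _ /=; exact: FB.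
pose SS n : R[i] := if 2 * `|m| <= (N n)%:Z then y n m else 0.
have hF n : hasSum (F n) (SS n).
  by rewrite /F /SS; case: ifP => _; [exact: rowE|exact: hasSum0].
have lim1 : ucvg U SS S.
  by move=> e e0; apply: (@sumle_limit R _ _ U _ F _ B SS S (D + K) B0 hB FB _ hF hS e e0) => x d
    d0; exact: Flim.
have lim0 : ucvg U SS 0.
  apply: (@ucvg_rate _ U UU Uoo _ _ 1); apply: filterS filterT => n _ /=.
  rewrite subr0 mul1r /SS; case: ifP => _; first exact: y_small.
  by rewrite nc0 invr_ge0.
by rewrite (ucvg_unique UU lim0 lim1).
Qed.

(** Each use of the row equation gains one power: the remainder has rapidly decreasing
off-diagonal weights, while the leading symbol grows linearly. *)
Let bootstrap : rapid1 cl.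
Proof.
elim=> [|k [C C0 IH]]; first by exists 1 => // l; rewrite expr0 divr1 cl_le1.
have [D D0 hD] := row_bound_weighted eps ks1 ks2 k.
have a0 : 0 < nc alpha by rewrite nc_gt0.
have p2 : 0 < pi ^+ 2 :> R by rewrite exprn_gt0 // pi_gt0.
pose kap := 4 * pi ^+ 2 * nc alpha.
have kap0 : 0 < kap by rewrite !mulr_gt0 ?pi_gt0.
have E0 : 0 <= 2 * (C * D / kap) by rewrite mulr_ge0 // divr_ge0 ?(ltW kap0) // mulr_ge0.
exists (1 + 2 * (C * D / kap)) => [|m]; first by rewrite addr_ge0.
have w0 := @wt_gt0 R m; have wk : 0 < wt m ^+ k :> R by rewrite exprn_gt0.
have [->|m0] := eqVneq m 0.
  by rewrite /wt normr0 addr0 expr1n divr1; have := cl_le1 0; lra.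
have h := @row_tail (crow m) (clam m) 0 cl m (C / wt m ^+ k) D (fun x => wt x.2 ^+ k)
  (crow_remainder s0 k1 u2 v2 k2 alpha_u1v1 UU Uoo nN m) (limit_row m) _ _ hD.
have {}h : nc (clam m) * nc (cl m) <= nc (0 : R[i]) + C / wt m ^+ k * D.
  apply: h; last by rewrite divr_ge0 // ltW.
  move=> x; apply: le_trans (IH _) _; rewrite -mulrA ler_wpM2l //.
  have wx : 0 < wt (m - x.2) ^+ k :> R by rewrite exprn_gt0 ?wt_gt0.
  rewrite mulrC ler_pdivlMr // mulrC ler_pdivrMr // -exprMn.
  apply: lerXn2r; rewrite ?nnegrE ?mulr_ge0 ?(ltW (wt_gt0 _)) //.
  by apply: le_trans (wtD _ _); rewrite addrC subrK.
have m1 : 1 <= `|m|%:~R :> R by rewrite -[1]/(1%:~R) ler_int; move: m0; clear; lia.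
have c0 := nc_ge0 (cl m).
rewrite nc0 add0r nc_clam // -/kap in h.
have {}h : `|m|%:~R * nc (cl m) <= C * D / kap / wt m ^+ k.
  rewrite (_ : C * D / kap / _ = (C / wt m ^+ k * D) / kap); last by ring.
  by rewrite ler_pdivlMr // mulrC mulrA.
rewrite ler_pdivlMr ?exprn_gt0 // exprS.
have {}h : `|m|%:~R * nc (cl m) * wt m ^+ k <= C * D / kap by rewrite -ler_pdivlMr.
have : nc (cl m) * (wt m * wt m ^+ k) <= 2 * (`|m|%:~R * nc (cl m) * wt m ^+ k).
  have P0 : 0 <= nc (cl m) * wt m ^+ k by rewrite mulr_ge0 // ltW.
  have hw : wt m <= 2 * `|m|%:~R :> R by rewrite /wt; lra.
  have := ler_wpM2r P0 hw; lra.
lra.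
Qed.

Let cl_eq0 m : cl m = 0.
Proof. exact: (row_solution_eq0 ks1 ks2 hW bootstrap limit_row). Qed.

Let mass_lost (t : seq int) e : 0 < e -> U [set n | \sum_(l <- t) nc (c n l) ^+ 2 <= e].
Proof.
elim: t e => [|l t IH] e e0.
  by apply: filterS filterT => n _ /=; rewrite big_nil ltW.
have e2 : 0 < e / 2 by rewrite divr_gt0.
have := hcl l; rewrite cl_eq0 => /(_ _ e2) hl.
apply: filterS (filterI hl (IH _ e2)) => n /= [h1 h2]; rewrite subr0 in h1.
rewrite big_cons; have := c_le1 n l; have := nc_ge0 (c n l); rewrite expr2; nra.
Qed.

Lemma no_ultralimit : False.
Proof.
have [T T0 hT] := tight.
have B0 (l : int) : 0 <= T ^+ 2 * (wt l ^+ 2)^-1 by rewrite mulr_ge0 ?sqr_ge0 // invr_ge0 sqr_ge0.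
have h2 : 0 < 2^-1 :> R by rewrite invr_gt0.
have h4 : 0 < 4^-1 :> R by rewrite invr_gt0.
have [t ut tail] := sumle_tail B0 (sumleZ (sqr_ge0 T) (@sumle_wt R)) h2.
have [n /= hn] := filter_ex (mass_lost t h4).
have [W [uW hW' sumW]] := window_sum (N0 n) (Nper_dft (N0 n) (phi n)).
move: sumW; rewrite c_unit (bigID [in t]) /= => sumW.
have p1 : \sum_(l <- W | l \in t) nc (c n l) ^+ 2 <= \sum_(l <- t) nc (c n l) ^+ 2.
  rewrite -big_filter; set W' := [seq l <- W | l \in t].
  have uW' : uniq W' by exact: filter_uniq.
  have sW' : {subset W' <= t} by move=> l; rewrite mem_filter => /andP[].
  by rewrite (sum_subset _ uW' ut sW') lerDl sumr_ge0 // => l _; exact: sqr_ge0.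
have p2 : \sum_(l <- W | l \notin t) nc (c n l) ^+ 2 <= 2^-1.
  rewrite -big_filter; set W' := [seq l <- W | l \notin t].
  have uW' : uniq W' by exact: filter_uniq.
  apply: le_trans (tail W' uW' _); last by move=> l; rewrite mem_filter => /andP[].
  rewrite !big_seq; apply: ler_sum => l; rewrite mem_filter => /andP[_ lW].
  rewrite -exprVn -exprMn; apply: lerXn2r; rewrite ?nnegrE ?nc_ge0 //.
    by rewrite divr_ge0 // ltW // wt_gt0.
  by apply: hT; exact: hW'.
lra.
Qed.

End Limit.

Lemma no_degenerate_sequence : False.
Proof.
have [U UU Uoo] := @ultra_exists.
have [cl hcl] := choice (fun m => ultra_lim UU (c_le1 ^~ m)).
exact: (@no_ultralimit U UU Uoo cl hcl).
Qed.

End Sequence.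
End NoDegenerateSequence.

(** * Norms of splines *)

Section SplineNorm.
Context {R : realType}.
Local Notation mu := (@lebesgue_measure R).
Local Notation I01 := (`[0%R : R, 1%R]%classic).

Let mI : measurable (I01 : set (measurableTypeR R)). Proof. exact: measurable_itv. Qed.

Variables (N : nat) (N0 : (0 < N)%N).
Let NR : 0 < N%:R :> R. Proof. by rewrite ltr0n. Qed.
Let N1 : 1 <= N%:R :> R. Proof. by rewrite ler1n. Qed.

Lemma node_sS (y : R) : node_s N (y + 1) = node_s N y + N%:R^-1.
Proof. by rewrite /node_s; field; rewrite gt_eqF. Qed.

(** The supporting interval is no longer than a period, so the periodized indicator only takes
the values [0] and [1]. *)
Lemma chiE (y x : R) :
  chi N y x = (`[< exists k : int, node_s N y < x + k%:~R < node_s N (y + 1) >])%:R.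
Proof.
have N1' := N1; have NV : N%:R^-1 <= 1 :> R by rewrite invf_le1.
have uniq_k (k k' : int) : node_s N y < x + k%:~R < node_s N (y + 1) ->
    node_s N y < x + k'%:~R < node_s N (y + 1) -> k' = k.
  rewrite node_sS => /andP[h1 h2] /andP[h3 h4].
  have a : k'%:~R < k%:~R + 1%:~R :> R by lra.
  have b : k%:~R < k'%:~R + 1%:~R :> R by lra.
  move: a b; rewrite -!intrD !ltr_int; clear; lia.
rewrite /chi /periodization; case: asboolP => [[k hk]|nk].
  rewrite -(@fsbig_widen _ _ _ _ [set k]) //; last first.
    move=> k' [_ /= kk]; rewrite indicE mem_setE in_itv /=.
    by apply/eqP; rewrite pnatr_eq0 eqb0; apply/negP => hk'; case: kk; exact: uniq_k hk hk'.
  by rewrite fsbig_set1 indicE mem_setE in_itv /= hk.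
rewrite fsbig1 // => k _; rewrite indicE mem_setE in_itv /=.
by apply/eqP; rewrite pnatr_eq0 eqb0; apply/negP => hk; case: nk; exists k.
Qed.

Lemma chi_disjoint (eps x : R) (i j : 'I_N) : i != j ->
  chi N (i%:R + eps) x * chi N (j%:R + eps) x = 0.
Proof.
move=> ij; rewrite !chiE; case: asboolP => [[k hk]|]; last by rewrite mul0r.
case: asboolP => [[k' hk']|]; last by rewrite mulr0.
exfalso; move: hk hk'; rewrite /node_s !ltr_pdivrMr // !ltr_pdivlMr //.
move=> /andP[h1 h2] /andP[h3 h4].
have NR' := NR.
have a : i%:Z%:~R - j%:Z%:~R < N%:Z%:~R * (k%:~R - k'%:~R) + 1%:~R :> R.
  by have : i%:Z%:~R = i%:R :> R by []; have : j%:Z%:~R = j%:R :> R by []; have : N%:Z%:~R = N%:R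
    :> R by []; lra.
have b : N%:Z%:~R * (k%:~R - k'%:~R) < i%:Z%:~R - j%:Z%:~R + 1%:~R :> R.
  by have : i%:Z%:~R = i%:R :> R by []; have : j%:Z%:~R = j%:R :> R by []; have : N%:Z%:~R = N%:R
    :> R by []; lra.
rewrite -!rmorphB -!intrM -!intrD !ltr_int in a b.
have {}a : (N%:Z * (k - k') = i%:Z - j%:Z)%R by move: a b; clear; lia.
have := ltn_ord i; have := ltn_ord j; move: ij a; rewrite -val_eqE /=.
move: (k - k') (nat_of_ord i) (nat_of_ord j) => d p q; clear => pq a qN pN.
have [d0|d0|d0] := ltrgtP d 0; [nia|nia|].
by move: a pq; rewrite d0 mulr0; lia.
Qed.

Lemma integral_interval (J : interval R) : [set` J] `<=` I01 ->
  rint (\1_([set` J]) : R -> R) /\ \int[mu]_(x in I01) \1_([set` J]) x = fine (mu [set` J]).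
Proof.
move=> JI; have mJ : measurable ([set` J] : set (measurableTypeR R)) by exact: measurable_itv.
split.
  apply: (rint_le _ (rint_cst 1)); first exact: measurable_indic.
  by move=> x _; rewrite indicE; case: (_ \in _); rewrite ?normr1 ?normr0.
by rewrite /Rintegral integral_indic // (setIidl JI).
Qed.

(** After an integral translation the supporting interval starts in the unit interval; it
either stays inside or wraps around once. *)
Lemma chi_integral (y : R) : rint (chi N y) /\ \int[mu]_(x in I01) chi N y x = N%:R^-1.
Proof.
pose k : int := Num.floor (node_s N y); pose a := node_s N y - k%:~R.
have NV1 : N%:R^-1 <= 1 :> R by rewrite invf_le1.
have NV0 : 0 < N%:R^-1 :> R by rewrite invr_gt0.
have a0 : 0 <= a by rewrite subr_ge0 floor_le_tmp.
have a1 : a < 1 by rewrite /a ltrBlDl -[1]/(1%:~R) -intrD floorD1_gt.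
have chiI x : I01 x -> chi N y x = ((a < x < a + N%:R^-1) || (a - 1 < x < a - 1 + N%:R^-1))%:R.
  rewrite /= in_itv /= => /andP[x0 x1]; rewrite chiE node_sS; congr (_%:R); congr nat_of_bool.
  have E (q : int) : (node_s N y < x + q%:~R < node_s N y + N%:R^-1) =
      (a < x + (q - k)%:~R < a + N%:R^-1).
    by rewrite /a rmorphB /=; apply/idP/idP => /andP[h1 h2]; apply/andP; split; lra.
  apply/asboolP/idP => [[q]|/orP[] /andP[h1 h2]].
  - rewrite E; move: (q - k) => d /andP[h1 h2].
    have d1 : -1%:~R < d%:~R :> R by lra.
    have d2 : d%:~R < 2%:~R :> R by lra.
    rewrite -rmorphN /= !ltr_int in d1 d2.
    have [dE|dE] : d = 0 \/ d = 1 by move: d1 d2; clear; lia.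
      by rewrite dE addr0 in h1 h2; rewrite h1 h2.
    by rewrite dE in h1 h2; apply/orP; right; apply/andP; split; lra.
  - by exists k; rewrite E subrr addr0 h1 h2.
  - exists (k + 1); rewrite E addrAC subrr add0r; apply/andP; split; lra.
have ext (F G : R -> R) : (forall x, I01 x -> F x = G x) -> rint G ->
    rint F /\ \int[mu]_(x in I01) F x = \int[mu]_(x in I01) G x.
  move=> FG iG; split; last by apply: eq_Rintegral => x; rewrite inE; exact: FG.
  by apply: eq_integrable iG => // x; rewrite inE => xI /=; rewrite FG.
have mitv (c d : R) (b1 b2 : bool) : c <= d -> fine (mu [set` Interval (BSide b1 c) (BSide b2
  d)]) = d - c.
  move=> cd; rewrite lebesgue_measure_itv /= lte_fin; case: ltP => // dc.
  by rewrite (@le_anti _ _ c d) ?subrr // cd.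
have [b1|b1] := leP (a + N%:R^-1) 1.
  have [|i1 e1] := @integral_interval `]a, (a + N%:R^-1)[.
    by move=> x /=; rewrite !in_itv /= => /andP[h1 h2]; apply/andP; split; lra.
  have [|i2 ->] := ext (chi N y) _ _ i1.
    move=> x xI; rewrite chiI // indicE mem_setE in_itv /=; congr (nat_of_bool _)%:R.
    case: (a < x < _) => //=; apply/negP => /andP[h1 h2].
    by move: xI; rewrite /= in_itv /= => /andP[]; lra.
  by split=> //; rewrite e1 mitv; [ring|lra].
have [|i1 e1] := @integral_interval `[0, (a - 1 + N%:R^-1)[.
  by move=> x /=; rewrite !in_itv /= => /andP[h1 h2]; apply/andP; split; lra.
have [|i2 e2] := @integral_interval `]a, 1].
  by move=> x /=; rewrite !in_itv /= => /andP[h1 h2]; apply/andP; split; lra.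
have [|i3 ->] := ext (chi N y) _ _ (rintD i1 i2).
  move=> x xI; rewrite chiI // !indicE !mem_setE !in_itv /=.
  move: xI; rewrite /= in_itv /= => /andP[x0 x1]; rewrite x0 x1 andbT /=.
  have -> : x < a + N%:R^-1 by lra.
  have -> : a - 1 < x by lra.
  rewrite andbT /=; case: (ltP a x) => ax /=; last by rewrite addr0.
  by rewrite (_ : (x < _) = false) ?add0r //; apply/negbTE; rewrite -leNgt; lra.
split=> //; rewrite RintegralD // e1 e2 !mitv; [ring|lra|lra].
Qed.

Lemma spline_norm (eps : R) (c : {ffun 'I_N -> R[i]}) :
  L2norm (spline eps c) = Num.sqrt (N%:R^-1 * \sum_(i < N) nc (c i) ^+ 2).
Proof.
have sq x : nc (spline eps c x) ^+ 2 = \sum_(i < N) nc (c i) ^+ 2 * chi N (i%:R + eps) x.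
  have chi01 i : chi N (i%:R + eps) x = 0 \/ chi N (i%:R + eps) x = 1.
    by rewrite chiE; case: asboolP => _; [right|left].
  have [[i ci]|none] := pselect (exists i : 'I_N, chi N (i%:R + eps) x = 1).
    have z j : j != i -> chi N (j%:R + eps) x = 0.
      by move=> ji; have := chi_disjoint eps x ji; rewrite ci mulr1.
    rewrite /spline (bigD1 i) //= ci rmorph1 mulr1 big1 ?addr0; last first.
      by move=> j /z ->; rewrite mulr0.
    by rewrite (bigD1 i) //= ci mulr1 big1 ?addr0 // => j /z ->; rewrite mulr0.
  have z (j : 'I_N) : chi N (j%:R + eps) x = 0.
    by have [//|h] := chi01 j; case: none; exists j.
  rewrite /spline big1 => [|j _]; last by rewrite z rmorph0 mulr0.
  by rewrite big1 ?nc0 ?expr0n // => j _; rewrite z mulr0.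
rewrite /L2norm; congr Num.sqrt.
transitivity (\int[mu]_(x in I01) \sum_(i < N) nc (c i) ^+ 2 * chi N (i%:R + eps) x).
  by apply: eq_Rintegral => x _; exact: sq.
suff gen (t : seq 'I_N) : rint (fun x => \sum_(i <- t) nc (c i) ^+ 2 * chi N (i%:R + eps) x) /\
  \int[mu]_(x in I01) (\sum_(i <- t) nc (c i) ^+ 2 * chi N (i%:R + eps) x) = N%:R^-1 * \sum_(i <-
    t) nc (c i) ^+ 2.
  by case: (gen (index_enum 'I_N)).
elim: t => [|i t [IH1 IH2]].
  rewrite big_nil (_ : (fun x => _) = fun=> 0); last by apply/funext => x; rewrite big_nil.
  by rewrite mulr0 Rintegral01_cst; split=> //; exact: rint_cst.
have [ri ei] := chi_integral (i%:R + eps).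
rewrite big_cons (_ : (fun x => _) = fun x => nc (c i) ^+ 2 * chi N (i%:R + eps) x +
   \sum_(i <- t) nc (c i) ^+ 2 * chi N (i%:R + eps) x); last first.
  by apply/funext => x; rewrite big_cons.
have rz := rintZ (nc (c i) ^+ 2) ri.
split; first exact: rintD.
by rewrite RintegralD // IH2 RintegralZl // ei; ring.
Qed.

End SplineNorm.

(** * Coercivity *)

Section Assembly.
Context {R : realType}.

(** On the diagonal the Fourier series of [A] reduces to the constant [alpha]; replacing its
coefficients by a single one at frequency zero therefore changes them by a family that sums to
zero. *)
Lemma main_kernel_series (A K : R -> R -> R[i]) (alpha : R[i]) :
  smooth_periodic2 A -> smooth_periodic2 K -> (forall t, A t t = alpha) ->
  exists u v k, kernel_series A K u v k /\
    forall x, u x + v x = (x == (0, 0))%:R * ((0 +i* (2 * pi)^-1) * alpha).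
Proof.
move=> /fourier_convolution_expansion[b br hb] /fourier_convolution_expansion[k kr hk] diag.
set a : R[i] := (0 +i* (2 * pi)^-1) * alpha.
pose v x := (0 +i* (2 * pi)^-1) * b x.
pose u (x : int * int) := (x == (0, 0))%:R * a - v x.
have vr : rapid2 v.
  move=> j; have [C C0 hC] := br j.
  exists (nc (0 +i* (2 * pi)^-1) * C) => [|x]; first by rewrite mulr_ge0 ?nc_ge0.
  by rewrite ncM -mulrA ler_wpM2l ?nc_ge0.
have hv s t : hasSum (fun x => v x * cis (x.1%:~R * (s - t)) * cis (x.2%:~R * t))
    ((0 +i* (2 * pi)^-1) * A s t).
  have := hasSumZ (0 +i* (2 * pi)^-1) (hb s t).
  by congr hasSum; apply/funext => x; rewrite /v !mulrA.
exists u, v, k; split=> [|x]; last by rewrite /u subrK.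
split; split => //.
  move=> j; have [C C0 hC] := vr j.
  exists (nc a + C) => [|x]; first by rewrite addr_ge0 ?nc_ge0.
  rewrite mulrDl; apply: le_trans (ncB _ _) _; apply: lerD => //.
  have w0 : 0 < (wt x.1 * wt x.2) ^+ j :> R by rewrite exprn_gt0 // mulr_gt0 ?wt_gt0.
  rewrite ncM; case: eqVneq => [->|_]; last by rewrite nc0 mul0r divr_ge0 ?nc_ge0 // ltW.
  by rewrite /wt /= normr0 addr0 mulr1 expr1n divr1 nc1 mul1r.
move=> t; have h1 := hv t t; rewrite diag -/a in h1.
have h2 : hasSum (fun x : int * int => (x == (0, 0))%:R * a * cis (x.2%:~R * t)) a.
  have := @hasSum_finite R _ (fun x : int * int => (x == (0, 0))%:R * a * cis (x.2%:~R * t)) [::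
    (0, 0)] isT _.
  rewrite big_seq1 eqxx mul1r mul0r cis0 mulr1; apply=> x; rewrite inE => /negbTE ->.
  by rewrite !mul0r.
have := hasSumB h2 h1; rewrite [a - a]subrr; congr hasSum; apply/funext => x.
by rewrite /u subrr mulr0 cis0 mulr1 mulrBl.
Qed.

Lemma smooth_kernel_series (A K : R -> R -> R[i]) :
  smooth_periodic2 A -> smooth_periodic2 K -> exists v k, kernel_series A K (fun=> 0) v k.
Proof.
move=> /fourier_convolution_expansion[b br hb] /fourier_convolution_expansion[k kr hk].
pose v x := (0 +i* (2 * pi)^-1) * b x.
exists v, k; split; split => //.
- by move=> j; exists 0 => // x; rewrite nc0 mul0r.
- move=> j; have [C C0 hC] := br j.
  exists (nc (0 +i* (2 * pi)^-1) * C) => [|x]; first by rewrite mulr_ge0 ?nc_ge0.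
  by rewrite ncM -mulrA ler_wpM2l ?nc_ge0.
- by move=> t; have := @hasSum0 R (int * int)%type; congr hasSum; apply/funext => x; rewrite mul0r.
move=> s t; have := hasSumZ (0 +i* (2 * pi)^-1) (hb s t).
by congr hasSum; apply/funext => x; rewrite /v !mulrA.
Qed.

Lemma periodic_log_kernel (A K : R -> R -> R[i]) :
  smooth_periodic2 A -> smooth_periodic2 K ->
  (forall t, periodic (fun s => log_kernel A K s t) 1).
Proof.
move=> [_ _ pA _] [_ _ pK _] t s; rewrite /log_kernel (pA t) (pK t) -!/(lnk _).
have -> : s + 1 - t = s - t + 1%:~R by rewrite addrAC.
by rewrite lnkDz.
Qed.

Lemma Nper_galerkin (N : nat) (eps : R) (V1 V2 : R -> R -> R[i]) (phi : int -> R[i]) :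
  (0 < N)%N -> (forall t, periodic (fun s => V1 s t) 1) -> (forall t, periodic (fun s => V2 s t)
    1) ->
  Nper N (galerkin N eps V1 V2 phi).
Proof.
move=> N0 p1 p2 i; have NR : (N%:R : R) != 0 by rewrite pnatr_eq0 -lt0n.
rewrite /galerkin; congr (_ * _); apply: eq_bigr => j _; congr (_ * _); rewrite /entry.
have -> : node_s N ((i + N%:Z)%:~R + 1 + eps) = node_s N (i%:~R + 1 + eps) + 1 :> R.
  by rewrite /node_s rmorphD /=; field.
have -> : node_s N ((i + N%:Z)%:~R + eps) = node_s N (i%:~R + eps) + 1 :> R.
  by rewrite /node_s rmorphD /=; field.
have -> : node_t N ((i + N%:Z)%:~R + eps) = node_t N (i%:~R + eps) + 1 :> R.
  by rewrite /node_t rmorphD /=; field.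
by rewrite !p1 !p2.
Qed.

Lemma galerkinZ (N : nat) (eps : R) (V1 V2 : R -> R -> R[i]) (phi : int -> R[i]) (a : R[i]) i :
  galerkin N eps V1 V2 (fun j => a * phi j) i = a * galerkin N eps V1 V2 phi i.
Proof.
rewrite /galerkin [RHS]mulrCA -[a * psum _ _]psumZ; congr (_ * _); apply: eq_bigr => j _.
by rewrite mulrCA.
Qed.

(** Discrete coercivity: otherwise normalized counterexamples form a degenerate sequence. *)
Lemma galerkin_coercive (A1 A2 K1 K2 : R -> R -> R[i]) (alpha : R[i]) (eps : R) :
  smooth_periodic2 A1 -> smooth_periodic2 A2 -> smooth_periodic2 K1 -> smooth_periodic2 K2 ->
  (forall s, A1 s s = alpha) -> alpha <> 0 -> (forall k : int, eps <> k%:~R / 2) ->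
  (forall phi : R -> R[i], calD phi ->
     (forall s, opW (log_kernel A1 K1) (log_kernel A2 K2) phi s = 0) -> forall s, phi s = 0) ->
  exists n : nat, forall N, (n < N)%N -> forall phi, Nper N phi ->
    n.+1%:R^-1 * Num.sqrt (N%:R^-1 * \sum_(i < N) nc (phi i%:Z) ^+ 2) <=
    Num.sqrt (N%:R^-1 * \sum_(i < N) nc (galerkin N eps (log_kernel A1 K1) (log_kernel A2 K2) phi
      i%:Z) ^+ 2).
Proof.
move=> sA1 sA2 sK1 sK2 diag alpha0 heps hW.
have s0 := im_cis_neq0 heps.
have [u1 [v1 [k1 [ks1 uv]]]] := main_kernel_series sA1 sK1 diag.
have [v2 [k2 ks2]] := smooth_kernel_series sA2 sK2.
have a0 : (0 +i* (2 * pi)^-1) * alpha != 0 :> R[i].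
  rewrite mulf_neq0 //; last exact/eqP.
  by apply/eqP => -[] /eqP; rewrite invr_eq0 mulf_eq0 pnatr_eq0 /= gt_eqF // pi_gt0.
set V1 := log_kernel A1 K1; set V2 := log_kernel A2 K2.
apply: contrapT => /forallNP none.
have bad (n : nat) : exists z : nat * (int -> R[i]), [/\ (n < z.1)%N, Nper z.1 z.2,
    z.1%:R^-1 * (\sum_(i < z.1) nc (z.2 i%:Z) ^+ 2) = 1 &
    z.1%:R^-1 * (\sum_(i < z.1) nc (galerkin z.1 eps V1 V2 z.2 i%:Z) ^+ 2) <= n.+1%:R^-1 ^+ 2].
  have /existsNP[N /not_implyP[nN /existsNP[phi /not_implyP[pphi /negP]]]] := none n.
  rewrite -ltNge; set S := _ * \sum_(i < N) nc (phi i) ^+ 2; set G := _ * \sum_(i < N) _ => lt.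
  have S0 : 0 <= S by rewrite mulr_ge0 ?invr_ge0 // sumr_ge0 // => i _; exact: sqr_ge0.
  have G0 : 0 <= G by rewrite mulr_ge0 ?invr_ge0 // sumr_ge0 // => i _; exact: sqr_ge0.
  have n0 : 0 < n.+1%:R^-1 :> R by rewrite invr_gt0.
  have Sp : 0 < Num.sqrt S.
    by move: (le_lt_trans (sqrtr_ge0 G) lt); rewrite pmulr_rgt0.
  pose a : R := (Num.sqrt S)^-1.
  have aS : a ^+ 2 * S = 1.
    by rewrite /a exprVn sqr_sqrtr // mulVf // gt_eqF // -sqrtr_gt0.
  have a2 : 0 < a by rewrite invr_gt0.
  have nca : nc a%:C = a by rewrite nc_real gtr0_norm.
  exists (N, fun j => a%:C * phi j); split => //=.
  - by move=> j /=; rewrite pphi.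
  - rewrite -[RHS]aS /S [RHS]mulrCA; congr (_ * _); rewrite mulr_sumr; apply: eq_bigr => i _.
    by rewrite ncM exprMn nca.
  have -> : N%:R^-1 * (\sum_(i < N) nc (galerkin N eps V1 V2 (fun j => a%:C * phi j) i%:Z) ^+ 2)
    = a ^+ 2 * G.
    rewrite /G [RHS]mulrCA; congr (_ * _); rewrite mulr_sumr; apply: eq_bigr => i _.
    by rewrite galerkinZ ncM exprMn nca.
  have lt2 : G <= (n.+1%:R^-1 * Num.sqrt S) ^+ 2.
    by rewrite -[G](sqr_sqrtr G0); apply: lerXn2r; rewrite ?nnegrE ?sqrtr_ge0 ?mulr_ge0
      ?sqrtr_ge0 ?(ltW n0) ?(ltW lt).
  apply: le_trans (ler_wpM2l (sqr_ge0 a) lt2) _.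
  by rewrite exprMn sqr_sqrtr // mulrCA aS mulr1.
have [z hz] := choice bad.
have N0 n : (0 < (z n).1)%N by have [h _ _ _] := hz n; exact: leq_ltn_trans h.
apply: (@no_degenerate_sequence R eps s0 A1 K1 A2 K2 u1 v1 k1 (fun=> 0) v2 k2 _ ks1 ks2 uv a0 hW
  (fun n => (z n).1) (fun n => (z n).2)).
- by move=> n; have [] := hz n.
- by move=> n; have [] := hz n.
- by move=> n; have [_ p e _] := hz n; rewrite dft_parseval.
move=> n m; have [_ p _ e] := hz n.
have pg : Nper (z n).1 (galerkin (z n).1 eps V1 V2 (z n).2).
  by apply: Nper_galerkin => //; exact: periodic_log_kernel.
rewrite -dft_parseval // in e.
rewrite (Nper_modz (N0 n) m (Nper_dft (N0 n) _)).
have Nz : (0 < (z n).1%:Z)%R by have := N0 n; clear; lia.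
have [q qE] : exists q : nat, (m %% (z n).1%:Z)%Z = q%:Z.
  by exists (absz (m %% (z n).1%:Z)%Z); rewrite gez0_abs // modz_ge0 // gt_eqF.
have qN : (q < (z n).1)%N by have := ltz_pmod m Nz; rewrite qE.
rewrite qE -(@ler_pXn2r _ 2) ?nnegrE ?nc_ge0 ?invr_ge0 //.
apply: le_trans e; rewrite (bigD1 (Ordinal qN)) //= lerDl sumr_ge0 // => i _; exact: sqr_ge0.
Qed.

Definition extend (N : nat) (c : {ffun 'I_N -> R[i]}) (j : int) : R[i] :=
  \sum_(i < N) c i * ((j %% N%:Z)%Z == i%:Z)%:R.

Lemma extendE (N : nat) (c : {ffun 'I_N -> R[i]}) (i : 'I_N) : extend c i%:Z = c i.
Proof.
rewrite /extend modz_small ?ltz_nat ?ltn_ord //.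
rewrite (bigD1 i) //= eqxx mulr1 big1 ?addr0 // => k ki.
by rewrite eqz_nat (_ : (_ == _) = false) ?mulr0 //; apply/negbTE; rewrite eq_sym val_eqE.
Qed.

Lemma Nper_extend (N : nat) (c : {ffun 'I_N -> R[i]}) : Nper N (extend c).
Proof. by move=> j; rewrite /extend modzDr. Qed.

End Assembly.

Theorem theorem1 (R : realType) (A1 A2 K1 K2 : R -> R -> R[i])
    (alpha : R[i]) (eps : R)
    (hA1 : smooth_periodic2 A1) (hA2 : smooth_periodic2 A2)
    (hK1 : smooth_periodic2 K1) (hK2 : smooth_periodic2 K2)
    (hdiag : forall s, A1 s s = alpha) (halpha : alpha <> 0)
    (heps : forall k : int, eps <> k%:~R / 2)
    (hW : forall phi : R -> R[i], calD phi ->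
       (forall s, opW (log_kernel A1 K1) (log_kernel A2 K2) phi s = 0) ->
       forall s, phi s = 0) :
  exists h0 beta : R, 0 < h0 /\ 0 < beta /\
    forall N : nat, (0 < N)%N -> N%:R^-1 <= h0 ->
      forall phih, spline_space N 0 phih ->
        ((beta * L2norm phih)%:E <=
         ereal_sup
           [set (Normc.normc (wh (log_kernel A1 K1) (log_kernel A2 K2) N eps psih phih)
                 / L2norm psih)%:E
           | psih in [set psi | spline_space N eps psi /\ psi <> (fun _ => 0%R)]])%E.
Proof.
have [n hn] := galerkin_coercive hA1 hA2 hK1 hK2 hdiag halpha heps hW.
have n0 : 0 < n.+1%:R^-1 :> R by rewrite invr_gt0.
exists n.+1%:R^-1, n.+1%:R^-1; split => //; split => // N N0 Nh _ [phi _ <-].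
have NR : 0 < N%:R :> R by rewrite ltr0n.
have nN : (n < N)%N by move: Nh; rewrite lef_pV2 ?posrE // ler_nat.
set V1 := log_kernel A1 K1; set V2 := log_kernel A2 K2.
have {}hn := hn N nN (extend phi) (Nper_extend phi).
pose Y (i : 'I_N) : R[i] := psum N (fun j => entry N eps V1 V2 i%:Z j * extend phi j).
pose S := \sum_(i < N) nc (Y i) ^+ 2.
have S0 : 0 <= S by apply: sumr_ge0 => i _; exact: sqr_ge0.
have GE : N%:R^-1 * (\sum_(i < N) nc (galerkin N eps V1 V2 (extend phi) i%:Z) ^+ 2) = N%:R * S.
  rewrite /S !mulr_sumr; apply: eq_bigr => i _.
  rewrite /galerkin ncM -(rmorph_nat (real_complex R)) nc_real ger0_norm ?(ltW NR) //.
  by rewrite exprMn -/(Y i); field; rewrite gt_eqF.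
have PE : L2norm (spline 0 phi) = Num.sqrt (N%:R^-1 * \sum_(i < N) nc (extend phi i%:Z) ^+ 2).
  by rewrite spline_norm //; congr (Num.sqrt (_ * _)); apply: eq_bigr => i _; rewrite extendE.
rewrite -PE GE in hn.
have whE (psi : {ffun 'I_N -> R[i]}) : wh V1 V2 N eps (spline eps psi) (spline 0 phi) = \sum_(i <
  N) psi i * Y i.
  rewrite wh_spline; apply: eq_bigr => i _; rewrite /Y /psum mulr_sumr; apply: eq_bigr => j _.
  by rewrite extendE -mulrA [phi j * _]mulrC mulrA.
(* If the residual vanishes then so does [phi], and any non-zero test function will do. *)
have [Sz|Sz] := eqVneq S 0.
  have -> : n.+1%:R^-1 * L2norm (spline 0 phi) = 0.
    apply/eqP; rewrite eq_le; apply/andP; split; last by rewrite mulr_ge0 ?(ltW n0) ?sqrtr_ge0.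
    by rewrite Sz mulr0 sqrtr0 in hn.
  pose psi : {ffun 'I_N -> R[i]} := [ffun=> 1].
  apply: le_trans (ereal_sup_ubound _); last first.
    exists (spline eps psi) => //; split; first by exists psi.
    move=> /(congr1 (fun f => f (node_t N ((Ordinal N0)%:R + eps)))).
    by rewrite spline_node ffunE => /eqP; rewrite oner_eq0.
  by rewrite lee_fin divr_ge0 ?nc_ge0 ?sqrtr_ge0.
have Sp : 0 < S by rewrite lt_neqAle eq_sym Sz.
(* The conjugate of the residual is the optimal test function. *)
pose psi : {ffun 'I_N -> R[i]} := [ffun i => cj (Y i)].
have psiN : \sum_(i < N) nc (psi i) ^+ 2 = S by apply: eq_bigr => i _; rewrite ffunE ncJ.
apply: le_trans (ereal_sup_ubound _); last first.
  exists (spline eps psi) => //; split; first by exists psi.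
  move=> z; move/eqP: Sz; apply; rewrite -psiN big1 // => i _.
  have := congr1 (fun f => f (node_t N (i%:R + eps))) z.
  by rewrite spline_node => ->; rewrite nc0 expr0n.
rewrite lee_fin; apply: le_trans hn _.
have -> : wh V1 V2 N eps (spline eps psi) (spline 0 phi) = S%:C.
  rewrite whE rmorph_sum; apply: eq_bigr => i _ /=.
  by rewrite ffunE mulrC mulcJ.
rewrite nc_real ger0_norm // spline_norm // psiN.
rewrite ler_pdivlMr; last by rewrite sqrtr_gt0 mulr_gt0 // invr_gt0.
rewrite -sqrtrM; last by rewrite mulr_ge0 // ltW.
by rewrite (_ : N%:R * S * (N%:R^-1 * S) = S ^+ 2) ?sqrtr_sqr ?ger0_norm //; field; rewrite gt_eqF.
Qed.
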